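(* Let $p$ be a prime and let $G = E_1 \times \ldots \times E_r$ be a finite direct product of finitely generated pro-$p$ groups $E_j$, each of which is either free or Demushkin. Suppose that at least one factor $E_j$ is non-soluble. Let $\mathcal{S} \colon G_i$, $i \in \mathbb{N}_0$, be an iterated verbal filtration of $G$. Then $G$ has full Hausdorff spectrum $\mathrm{hspec}^{\mathcal{S}}(G) = [0,1]$.
   Context: Subgroups of pro-$p$ groups are understood to be closed and generation is topological. ''Free'' means free pro-$p$. A Demushkin pro-$p$ group is a Poincaré duality pro-$p$ group of dimension $2$ (i.e. a pro-$p$ group $D$ of cohomological dimension $2$ with $H^1(D,\mathbb{F}_p)$ finite, $\dim_{\mathbb{F}_p} H^2(D,\mathbb{F}_p)=1$, and non-degenerate cup product $H^1(D,\mathbb{F}_p)\times H^1(D,\mathbb{F}_p)\to H^2(D,\mathbb{F}_p)$). A filtration of a finitely generated infinite pro-$p$ group $G$ is a descending chain $\mathcal{S}\colon G_i$, $i\in\mathbb{N}_0$, of open normal subgroups with trivial intersection. It is an iterated verbal filtration if $G_0=G$ and $G_i$ is a verbal subgroup of $G_{i-1}$ for each $i\in\mathbb{N}$. Here a verbal subgroup of a pro-$p$ group $H$ is a closed subgroup (topologically) generated by all values $w(h_1,\ldots,h_k)$, $h_1,\ldots,h_k\in H$, of group words $w=w(X_1,\ldots,X_k)$ in a given set of words $\mathcal{W}$ (the set $\mathcal{W}$ may depend on $i$). The Hausdorff dimension of a closed subgroup $H\le G$ with respect to $\mathcal{S}$ is $$\mathrm{hdim}_G^{\mathcal{S}}(H)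 = \liminf_{i\to\infty} \frac{\log_p |HG_i:G_i|}{\log_p |G:G_i|},$$ and $\mathrm{hspec}^{\mathcal{S}}(G) = \{\mathrm{hdim}_G^{\mathcal{S}}(H) \mid H \le G \text{ a closed subgroup}\}$. *)

(* Defs.v *)
From HB Require Import structures.
From mathcomp Require Import all_boot all_order all_algebra finmap.
From mathcomp Require Import all_classical all_reals all_analysis.

Set Implicit Arguments.
Unset Strict Implicit.
Unset Printing Implicit Defensive.

Import Order.TTheory GRing.Theory Num.Theory.
Import numFieldNormedType.Exports.

Local Open Scope classical_set_scope.
Local Open Scope group_scope.

HB.structure Definition PreTopologicalGroup := {G of Topological G & Group G}.

HB.mixin Record PreTopologicalGroup_isTopologicalGroup G
    of PreTopologicalGroup G := {
  mulg_continuous : continuous (fun x : G * G => (x.1 * x.2)%g) ;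
  invg_continuous : continuous (fun x : G => x^-1)
}.

#[short(type="topGroupType")]
HB.structure Definition TopologicalGroup :=
  {G of PreTopologicalGroup G & PreTopologicalGroup_isTopologicalGroup G}.

Section DirectProduct.
Variables (I : Type) (E : I -> topGroupType).

Let P : Type := prod_topology (fun i => E i).

Let mulP (x y : P) : P := fun i => (x i * y i)%g.
Let oneP : P := fun i => 1%g.
Let invP (x : P) : P := fun i => ((x i)^-1)%g.

Let mulPA : associative mulP.
Proof. by move=> x y z; apply: functional_extensionality_dep => i; exact: mulgA. Qed.

Let mul1P : left_id oneP mulP.
Proof. by move=> x; apply: functional_extensionality_dep => i; exact: mul1g. Qed.

Let mulP1 : right_id oneP mulP.
Proof. by move=> x; apply: functional_extensionality_dep => i; exact: mulg1. Qed.

Let mulVP : left_inverse oneP invP mulP.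
Proof. by move=> x; apply: functional_extensionality_dep => i; exact: mulVg. Qed.

Let mulPV : right_inverse oneP invP mulP.
Proof. by move=> x; apply: functional_extensionality_dep => i; exact: mulgV. Qed.

HB.instance Definition _ := isGroup.Build (prod_topology (fun i => E i))
  mulPA mul1P mulP1 mulVP mulPV.

Let proj_cvg (i : I) (x : P) : (fun y : P => y i) @ x --> x i.
Proof. exact: (@proj_continuous {classic I} (fun i => E i) i x). Qed.

Let cvg_prodP {F : set_system P} {FF : Filter F} (x : P) :
  (forall i, (fun y : P => y i) @ F --> x i) -> F --> x.
Proof.
move=> h; apply/cvg_sup => i U [_ [[B oB <-] Bx] BU].
by apply: filterS BU _; apply: (h i); apply: open_nbhs_nbhs.
Qed.

Let mulP_continuous : continuous (fun x : P * P => (x.1 * x.2)%g : P).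
Proof.
move=> [x y]; apply: cvg_prodP => i.
have : (fun z : P * P => (z.1 i, z.2 i)) @ (x, y) --> (x i, y i).
  apply: cvg_pair.
    exact: (cvg_comp _ (fun z : P => z i) (@cvg_fst _ _ _ _ _) (@proj_cvg i x)).
  exact: (cvg_comp _ (fun z : P => z i) (@cvg_snd _ _ _ _ _) (@proj_cvg i y)).
move=> h; exact: (cvg_comp _ (fun u : E i * E i => (u.1 * u.2)%g) h (@mulg_continuous (E i) (x i, y i))).
Qed.

Let invP_continuous : continuous (fun x : P => (x^-1)%g : P).
Proof.
move=> x; have FF : Filter (nbhs x) by exact: nbhs_filter.
apply: (@cvg_prodP ((fun y : P => (y^-1)%g : P) @ x) _) => i.
exact: (cvg_comp _ (fun u : E i => u^-1%g) (@proj_cvg i x) (@invg_continuous (E i) (x i))).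
Qed.

HB.instance Definition _ := PreTopologicalGroup_isTopologicalGroup.Build
  (prod_topology (fun i => E i)) mulP_continuous invP_continuous.

End DirectProduct.

Section Subgroups.
Variable G : topGroupType.
Implicit Types (H K : set G).

Definition subgroup H : Prop :=
  [/\ H 1%g, forall x y, H x -> H y -> H (x * y)%g & forall x, H x -> H x^-1%g].

Definition normal_subgroup H : Prop :=
  subgroup H /\ forall x g, H x -> H (x ^ g)%g.

Definition closed_subgroup H : Prop := subgroup H /\ closed H.

Definition topgen (A : set G) : set G := smallest closed_subgroup A.

Definition finitely_generated : Prop :=
  exists2 A : set G, finite_set A & topgen A = setT.

Definition setprod H K : set G := [set (x * y)%g | x in H & y in K].

(* [fset_set] of an infinite set is empty, so an infinite index is read as 0. *)
Definition subgroup_index H K : nat :=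
  #|` fset_set [set setprod [set x] K | x in H]|.

(* Each term is the closed subgroup generated by commutators; solubility is the
   same as for the abstract derived series in a Hausdorff group. *)
Fixpoint derived (n : nat) : set G :=
  if n is m.+1 then topgen [set [~ x, y]%g | x in derived m & y in derived m]
  else setT.

Definition soluble : Prop := exists n, derived n = [set 1%g].

End Subgroups.

Definition pro_p (p : nat) (G : topGroupType) : Prop :=
  [/\ compact [set: G], hausdorff_space G, totally_disconnected [set: G] &
    forall N : set G, open N -> normal_subgroup N ->
      exists k, subgroup_index setT N = (p ^ k)%N].

(* A family convergent to 1: each open subgroup contains f x for all but finitely
   many indices x. *)
Definition converges_to_1 (G : topGroupType) (X : Type) (f : X -> G) : Prop :=
  forall U : set G, open U -> subgroup U -> finite_set (f @^-1` (~` U)).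

(* Free pro-p group on a family convergent to 1; the universal property in the
   category of pro-p groups. *)
Definition free_pro_p (p : nat) (F : topGroupType) : Prop :=
  pro_p p F /\ exists (X : Type) (iota : X -> F), converges_to_1 iota /\
    forall (P : topGroupType) (f : X -> P), pro_p p P -> converges_to_1 f ->
      exists! phi : F -> P,
        [/\ continuous phi, {morph phi : x y / (x * y)%g} & phi \o iota = f].

Section Cohomology.
Variables (G : topGroupType) (A : zmodType) (act : G -> A -> A).

Definition discrete_module : Prop :=
  [/\ forall a, act 1%g a = a,
      forall g h a, act (g * h)%g a = act g (act h a),
      forall g, {morph act g : a b / (a + b)%R} &
      continuous (fun x : G * discrete_topology A =>
                    act x.1 x.2 : discrete_topology A)].

Definition cochain (n : nat) : Type := {ptws 'I_n -> G} -> discrete_topology A.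

Definition tuple_tail n (g : 'I_n.+1 -> G) : 'I_n -> G :=
  fun j => g (lift ord0 j).

Definition tuple_init n (g : 'I_n.+1 -> G) : 'I_n -> G :=
  fun j => g (lift ord_max j).

(* (g_0, ..., g_n) |-> (g_0, ..., g_i * g_(i+1), ..., g_n) *)
Definition tuple_merge n (i : 'I_n) (g : 'I_n.+1 -> G) : 'I_n -> G :=
  fun j => if (j < i)%N then tuple_init g j
           else if j == i then (tuple_init g i * tuple_tail g i)%g
           else tuple_tail g j.

(* The coboundary of the inhomogeneous bar complex. *)
Definition coboundary_map n (f : cochain n) : cochain n.+1 := fun g =>
  (act (g ord0) (f (tuple_tail g))
   + \sum_(i < n) ((f (tuple_merge i g) : A) *~ (-1) ^+ i.+1)
   + (f (tuple_init g) : A) *~ (-1) ^+ n.+1)%R.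

Definition cocycle n (f : cochain n) : Prop :=
  continuous f /\ forall g, coboundary_map f g = (0 : A)%R.

Definition coboundary n : cochain n -> Prop :=
  match n with
  | 0 => fun f => forall g, f g = (0 : A)%R
  | m.+1 => fun f => exists2 h : cochain m, continuous h &
                       forall g, f g = coboundary_map h g
  end.

Definition cohomologous n (f h : cochain n) : Prop :=
  coboundary (fun g => (f g : A) - (h g : A))%R.

Definition cohomology_class n (f : cochain n) : set (cochain n) :=
  [set h | cocycle h /\ cohomologous h f].

Definition cohomology n : set (set (cochain n)) :=
  [set cohomology_class f | f in [set f | cocycle f]].

End Cohomology.

Arguments cohomology {G A} act n.

Definition torsion (A : zmodType) : Prop :=
  forall a : A, exists2 k, (0 < k)%N & (a *+ k = 0)%R.

(* Cohomological dimension is tested on discrete torsion modules. *)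
Definition cd_le (G : topGroupType) (n : nat) : Prop :=
  forall (A : zmodType) (act : G -> A -> A), discrete_module act -> torsion A ->
    forall (q : nat) (f : cochain G A q), (n < q)%N -> cocycle act f ->
      coboundary act f.

Definition cohomological_dimension (G : topGroupType) (n : nat) : Prop :=
  forall m, cd_le G m <-> (n <= m)%N.

Section FpCohomology.
Variables (p : nat) (G : topGroupType).

Definition trivial_act : G -> 'F_p -> 'F_p := fun _ a => a.

Definition Fp_lincomb n d (c : 'I_d -> 'F_p) (z : 'I_d -> cochain G 'F_p n) :
    cochain G 'F_p n :=
  fun g => (\sum_(i < d) c i * (z i g : 'F_p))%R.

(* H^n(G, F_p) has an F_p-basis of d elements: the classes of the cocycles
   [z i] are linearly independent and span. *)
Definition Fp_cohomology_dim (n d : nat) : Prop :=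
  exists z : 'I_d -> cochain G 'F_p n,
    [/\ forall i, cocycle trivial_act (z i),
        forall c, coboundary trivial_act (Fp_lincomb c z) ->
          forall i, c i = 0%R &
        forall f, cocycle trivial_act f ->
          exists c, cohomologous trivial_act f (Fp_lincomb c z)].

(* The cup product followed by the multiplication of F_p. *)
Definition cup m n (a : cochain G 'F_p m) (b : cochain G 'F_p n) :
    cochain G 'F_p (m + n) :=
  fun g => ((a (fun i => g (lshift n i)) : 'F_p)
            * (b (fun j => g (rshift m j)) : 'F_p))%R.

Definition cup11_nondegenerate : Prop :=
  (forall a : cochain G 'F_p 1%N, cocycle trivial_act a ->
     (forall b : cochain G 'F_p 1%N, cocycle trivial_act b ->
        coboundary trivial_act (cup a b)) ->
     coboundary trivial_act a) /\
  (forall b : cochain G 'F_p 1%N, cocycle trivial_act b ->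
     (forall a : cochain G 'F_p 1%N, cocycle trivial_act a ->
        coboundary trivial_act (cup a b)) ->
     coboundary trivial_act b).

Definition demushkin : Prop :=
  [/\ pro_p p G, cohomological_dimension G 2%N,
      finite_set (cohomology trivial_act 1%N), Fp_cohomology_dim 2%N 1%N &
      cup11_nondegenerate].

End FpCohomology.

(* A group word in X_0, X_1, ...; [(k, b)] is X_k if b, and X_k^-1 otherwise. *)
Definition word : Type := seq (nat * bool).

Section Filtrations.
Variable G : topGroupType.
Implicit Types (S : nat -> set G) (H : set G).

Definition word_value (h : nat -> G) (w : word) : G :=
  (\prod_(x <- w) (if x.2 then h x.1 else (h x.1)^-1))%g.

Definition verbal_closure (W : set word) H : set G :=
  topgen [set word_value h w | h in [set h | forall k, H (h k)] & w in W].

Definition verbal_subgroup (V H : set G) : Prop :=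
  exists W : set word, V = verbal_closure W H.

Definition filtration S : Prop :=
  [/\ forall i, S i.+1 `<=` S i,
      forall i, open (S i) /\ normal_subgroup (S i) &
      \bigcap_i S i = [set 1%g]].

Definition iterated_verbal_filtration S : Prop :=
  [/\ filtration S, S 0%N = setT & forall i, verbal_subgroup (S i.+1) (S i)].

Definition logb (R : realType) (p n : nat) : R := (ln n%:R / ln p%:R)%R.

(* The quotient is 0 when G_i = G; this does not affect the limit inferior for a
   filtration of an infinite group. *)
Definition hdim (R : realType) (p : nat) S H : R :=
  limn_inf (fun i => (logb R p (subgroup_index (setprod H (S i)) (S i))
                      / logb R p (subgroup_index setT (S i)))%R).

Definition hspec (R : realType) (p : nat) S : set R :=
  [set hdim R p S H | H in [set H | closed_subgroup H]].

End Filtrations.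

Arguments hdim {G} R p S H.
Arguments hspec {G} R p S.

(* Main.v *)
(* Put l_i = log_p |G : G_i|. Duality of a factor E is encoded by a linear trace on
   F_p-valued 2-cocycles whose kernel is the set of coboundaries, and for which the cup
   product on H^1 is either nondegenerate (Demushkin) or identically of trace zero (free).
   By Shapiro's lemma the trace passes to an open subgroup V of index p in U, with
   dim H^1(V) - 2 >= p (dim H^1(U) - 2). So if some open subgroup has dim H^1 >= 3, then
   dim H^1 of open subgroups grows linearly in the index. At least half of a basis of H^1
   can be taken isotropic and liftable to Z/p^n; solving central embedding problems one at
   a time, such a family shows that the subgroup maps onto every finite p-group with that
   many generators. Consequently, if a finite p-group T with s generators satisfies the
   laws defining the verbal step from E_i to E_(i+1), then T^q is a quotient of
   E_i/E_(i+1) for q of the order of |E : E_i|/s: the section T is negligible.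

   Either every finite quotient of E is metacyclic, and then E is soluble; put H_E = E.
   Or E has a nontrivial homomorphism to the p-adic integers and an open subgroup with
   dim H^1 >= 3; let H_E be the kernel. Let H be the product of the H_E, and suppose that
   some factor is of the second kind. The principle above applied to cyclic groups shows
   log_p |G : H G_i| = o(l_i); applied to metacyclic groups, and (by Schreier's index
   formula) to the sections of finitely generated subgroups of infinite index, it shows
   that every finitely generated subgroup of H has dimension zero. Start from the trivial
   group and at step i adjoin finitely many elements common to H and G_i, just enough to
   bring log_p |K G_(i+1) : G_(i+1)| to alpha l_(i+1), or as close as H allows. The
   resulting subgroup K has dimension alpha: new generators are needed infinitely often,
   since otherwise K would be finitely generated. *)
From HB Require Import structures.
From mathcomp Require Import all_boot all_order all_algebra all_fingroup all_solvable finmap.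
From mathcomp Require Import all_classical all_reals all_analysis.
From mathcomp Require Import ring lra zify.
Require Import Defs.

Set Implicit Arguments.
Unset Strict Implicit.
Unset Printing Implicit Defensive.

Import Order.TTheory GRing.Theory Num.Theory.

Local Open Scope group_scope.
Local Open Scope classical_set_scope.

(** * Open normal subgroups and finite quotients *)

Section OpenNormal.
Variable G : topGroupType.
Implicit Types (H K N U : set G).

(** The words are arbitrary and change with [i], so nothing about a verbal section S_i/S_(i+1) can
    be computed. It is compared only with its own sections, which satisfy its laws for free; what
    has to be known is that S_i maps onto large powers of them. A Demushkin group is not free, and a
    central embedding problem over it can be obstructed: commutators contribute cup products, orders
    of elements contribute Bocksteins. An isotropic family of characters liftable to every Z/p^n
    meets neither obstruction, and the dual characters absorb what remains; half of H^1 is the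
    price. The dimension estimate, with its constant 2, and duality in a subgroup of index p both
    come from one filtration of the coinduced module of functions on F_p, whose connecting maps are
    cup products with the character defining the subgroup. Finally, a finitely generated subgroup of
    E can be open, and is then too large. Inside the kernel of a p-adic character it has infinite
    index, while the kernel itself still has full dimension. *)

Definition opn N : Prop := open N /\ normal_subgroup N.

Lemma opnI N K : opn N -> opn K -> opn (N `&` K).
Proof.
move=> [oN [[N1 NM NV] NJ]] [oK [[K1 KM KV] KJ]].
split; first exact: openI.
by split; [split|] => // [x y [Nx Kx] [Ny Ky]|x [Nx Kx]|x g [Nx Kx]]; split; auto.
Qed.

Lemma mulg_cvgr (x y : G) : (fun z : G => (x * z)%g) @ y --> (x * y)%g.
Proof.
apply: (cvg_comp (fun z => (x, z)) (fun u : G * G => (u.1 * u.2)%g) _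
  (@mulg_continuous G (x, y))).
by apply: cvg_pair; [exact: cvg_cst | exact: cvg_id].
Qed.

Lemma open_lmul (x : G) (A : set G) : open A -> open [set z | A (x * z)%g].
Proof. move=> oA; apply: (@open_comp _ _ (fun z => (x * z)%g)) => // y _. exact: mulg_cvgr. Qed.

Lemma closed_lmul (x : G) (A : set G) : closed A -> closed [set z | A (x * z)%g].
Proof.
by apply: (@preimage_closed _ _ (fun z => (x * z)%g)) => y _; exact: mulg_cvgr.
Qed.

Lemma open_subgroup_nbhs H : subgroup H -> nbhs (1%g : G) H -> open H.
Proof.
move=> [H1 HM HV] nH; rewrite openE => x Hx; rewrite /interior.
have nx : nbhs (x^-1 * x)%g H by rewrite mulVg.
have hx : nbhs x [set y | H (x^-1 * y)%g] := @mulg_cvgr x^-1%g x H nx.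
apply: (filterS _ hx) => y /= Hy.
by rewrite -(mulKVg x y); exact: HM.
Qed.

Lemma open_subgroup_closed H : open H -> subgroup H -> closed H.
Proof.
move=> oH [H1 HM HV]; rewrite -[H]setCK; apply: open_closedC.
rewrite openE => x Hx; rewrite /interior.
have oU : open [set z | H (x^-1 * z)%g] by exact: open_lmul.
have nx : nbhs x [set z | H (x^-1 * z)%g].
  by apply: open_nbhs_nbhs; split => //=; rewrite mulVg.
apply: (filterS _ nx) => y /= Hxy Hy; apply: Hx.
have -> : x = (y * (x^-1 * y)^-1)%g by rewrite invgM invgK mulKVg.
by apply: HM => //; exact: HV.
Qed.

(** Tube lemma: compactness of [X] lets one neighbourhood of 1 serve all [x] at once. *)
Lemma tube_nbhs (X : topologicalType) (P : X -> G -> Prop) :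
  compact [set: X] ->
  (forall x : X, \forall y \near x & n \near (1%g : G), P y n) ->
  \forall n \near (1%g : G), forall x, P x n.
Proof.
move=> /compact_near_coveringP cX h.
have hc := @cX G (nbhs (1%g : G)) (fun n x => P x n) (nbhs_filter _) (fun x _ => h x).
by apply: (@filterS _ _ (nbhs_filter (1%g : G)) _ _ _ hc) => n hn x; apply: hn.
Qed.

Hypothesis cG : compact [set: G].

(** The normal core of [H]. Its openness is the tube lemma applied to conjugation. *)
Lemma opn_core H : open H -> subgroup H -> exists2 N, opn N & N `<=` H.
Proof.
move=> oH [H1 HM HV].
pose N : set G := [set n | forall g, H (n ^ g)%g].
have sN : subgroup N.
  split => [g|x y Nx Ny g|x Nx g]; first by rewrite conj1g.
    by rewrite conjMg; apply: HM.
  by rewrite conjVg; apply: HV.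
exists N; last by move=> n /(_ 1%g); rewrite conjg1.
split; last first.
  by split => // x g Nx h; rewrite -conjgM; apply: Nx.
apply: open_subgroup_nbhs => //.
apply: (@tube_nbhs G (fun g n => H (n ^ g)%g)) => // g.
have h : (fun z : G * G => (z.2 ^ z.1)%g) @ (g, 1%g) --> (1 ^ g)%g.
  rewrite /conjg.
  apply: (cvg_comp (fun z : G * G => ((z.1)^-1, z.2 * z.1)%g)
    (fun u : G * G => (u.1 * u.2)%g) _ (@mulg_continuous G (_, _))).
  apply: cvg_pair => /=.
    exact: (cvg_comp (fun z : G * G => z.1) (fun u : G => u^-1)%g (@cvg_fst _ _ _ _ _)
      (@invg_continuous G g)).
  apply: (cvg_comp (fun z : G * G => (z.2, z.1)%g)
    (fun u : G * G => (u.1 * u.2)%g) _ (@mulg_continuous G (_, _))).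
  by apply: cvg_pair; [exact: cvg_snd | exact: cvg_fst].
have := h H; rewrite conj1g; apply.
exact: open_nbhs_nbhs.
Qed.

(** Cantor's intersection theorem, used to pass from all terms of a filtration to their
    intersection. *)
Lemma compact_decreasing (F : nat -> set G) :
  (forall i, closed (F i)) -> (forall i, F i.+1 `<=` F i) ->
  (forall i, F i !=set0) -> (\bigcap_i F i) !=set0.
Proof.
move=> cF dF nF.
have mono i j : (i <= j)%N -> F j `<=` F i.
  by move=> /subnK <-; elim: (j - i)%N => [//|k IH]; rewrite addSn; apply: subset_trans IH.
apply: contrapT => hno.
have hc : \forall i \near \oo, [set: G] `<=` [set x | ~ F i x].
  apply: (iffLR (@compact_near_coveringP G setT) cG) => x _.
  have [i nFi] : exists i, ~ F i x.
    apply: contrapT => h; apply: hno; exists x => i _.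
    by apply: contrapT => h'; apply: h; exists i.
  exists (~` F i, [set j | (i <= j)%N]) => /=.
    split; last by exists i.
    by apply: open_nbhs_nbhs; split => //; exact: closed_openC.
  by move=> [y j] /= [nFy ij] Fy; apply: nFy; exact: mono ij _ Fy.
case: hc => i _ /(_ i (leqnn i)) h.
by have [x Fx] := nF i; exact: (h x).
Qed.

End OpenNormal.

Lemma morph1g (G H : groupType) (f : G -> H) :
  {morph f : x y / (x * y)%g} -> f 1%g = 1%g.
Proof. by move=> fM; apply: (mulgI (f 1%g)); rewrite -fM !mulg1. Qed.

Lemma morphVg (G H : groupType) (f : G -> H) :
  {morph f : x y / (x * y)%g} -> {morph f : x / (x^-1)%g}.
Proof.
by move=> fM x; apply: (mulgI (f x)); rewrite -fM !mulgV (morph1g fM).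
Qed.

Lemma morphXg (G H : groupType) (f : G -> H) n :
  {morph f : x y / (x * y)%g} -> {morph f : x / (x ^+ n)%g}.
Proof.
move=> fM x; elim: n => [|n IH]; first by rewrite !expg0 (morph1g fM).
by rewrite !expgS fM IH.
Qed.

Section FiniteQuotient.
Variables (p : nat) (p_pr : prime p) (G : topGroupType).
Implicit Types (N A U : set G).

(** The quotient by [N] is presented by any epimorphism with kernel [N] onto an abstract finite
    [p]-group, so that the theory of finite groups applies to [Q]; subgroups of [G] are seen through
    their images [imq f A]. *)
Definition fquot N (Q : finGroupType) (f : G -> Q) : Prop :=
  [/\ {morph f : x y / (x * y)%g}, forall q, exists g, f g = q,
      p.-group [set: Q]%G & forall g, f g = 1%g <-> N g].

Definition imq (Q : finGroupType) (f : G -> Q) (A : set G) : {set Q} :=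
  [set q | `[< exists2 g, A g & f g = q >]]%SET.

Lemma imqP (Q : finGroupType) (f : G -> Q) A q :
  reflect (exists2 g, A g & f g = q) (q \in imq f A).
Proof. by rewrite inE; exact: asboolP. Qed.

Lemma mem_imq (Q : finGroupType) (f : G -> Q) A g : A g -> f g \in imq f A.
Proof. by move=> Ag; apply/imqP; exists g. Qed.

Lemma imqS (Q : finGroupType) (f : G -> Q) A U : A `<=` U -> imq f A \subset imq f U.
Proof. by move=> AU; apply/fintype.subsetP => q /imqP[g /AU Ug <-]; exact: mem_imq. Qed.

Lemma index_imq_aux N (Q : finGroupType) (f : G -> Q) A :
  {morph f : x y / (x * y)%g} -> (forall g, f g = 1%g <-> N g) -> subgroup A ->
  subgroup_index (setprod A N) N = #|imq f A|.
Proof.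
move=> fM fN [A1 AM AV].
pose fib (q : Q) : set G := [set g | f g = q].
have fibE x : setprod [set x] N = fib (f x).
  apply/seteqP; split => [y [_ -> [n Nn <-]]|y /= fy].
    by rewrite /fib /= fM (fN n).2 // mulg1.
  exists x => //; exists (x^-1 * y)%g; last by rewrite mulKVg.
  by apply/fN; rewrite fM (morphVg fM) fy mulVg.
have fin : finite_set [set` imq f A] by exact: finite_finset.
rewrite /subgroup_index.
have -> : [set setprod [set x] N | x in setprod A N] = fib @` [set` imq f A].
  apply/seteqP; split => [_ [_ [a Aa [n Nn <-]] <-]|_ [q /imqP[a Aa <-] <-]].
    exists (f a); first by exact: mem_imq.
    by rewrite fibE fM (fN n).2 // mulg1.
  exists a; last by rewrite fibE.
  exists a => //; exists 1%g; last by rewrite mulg1.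
  by apply/fN; exact: morph1g.
rewrite fset_set_image // card_in_imfset /=; last first.
  move=> q1 q2; rewrite !in_fset_set // !inE => /imqP[a Aa <-] _ e.
  by have : fib q2 a by rewrite -e.
rewrite -[RHS]card_finset; congr #|` _|.
by apply/fsetP => q; rewrite in_fset_set // mem_setE in_fset.
Qed.

(** The finitely many cosets form only a finite type; the group structure comes from the
    permutations that [G] induces on them. The kernel of this action is [N] because [N] is
    normal. *)
Lemma normal_finite_quotient N : normal_subgroup N ->
  finite_set [set setprod [set x] N | x in [set: G]] ->
  exists (Q : finGroupType) (f : G -> Q),
    [/\ {morph f : x y / (x * y)%g}, forall q, exists g, f g = q &
        forall g, f g = 1%g <-> N g].
Proof.
move=> [[N1 NM NV] NJ] fin.
pose cst x := setprod [set x] N.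
pose F := fset_set [set cst x | x in [set: G]].
have cstF x : cst x \in F by rewrite in_fset_set // inE; exists x.
have cstE x y : cst x = cst y <-> N (x^-1 * y)%g.
  split=> [e|Nxy].
    have : cst y y by exists y => //; exists 1%g; rewrite ?mulg1.
    by rewrite -e => -[_ -> [n Nn <-]]; rewrite mulKg.
  apply/seteqP; split => z [_ -> [n Nn <-]].
    exists y => //; exists (y^-1 * x * n)%g; last by rewrite !mulgA mulgV mul1g.
    by apply: NM => //; rewrite -[x]invgK -invgM; exact: NV.
  exists x => //; exists (x^-1 * y * n)%g; last by rewrite !mulgA mulgV mul1g.
  exact: NM.
pose C : finType := F.
pose cs x : C := [` cstF x]%fset.
have csP (c : C) : exists x, cs x = c.
  have : val c \in F by exact: valP.
  rewrite in_fset_set // inE => -[x _ e]; exists x; exact/val_inj.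
have csE x y : cs x = cs y <-> N (x^-1 * y)%g.
  rewrite -cstE; split => [/(congr1 val)//|e]; exact/val_inj.
pose rep (c : C) : G := xget 1%g [set x | cs x = c].
have repK c : cs (rep c) = c.
  rewrite /rep; case: xgetP => [x _ //|h].
  by have [x e] := csP c; case: (h x).
have csM g x y : cs x = cs y -> cs (g * x)%g = cs (g * y)%g.
  by rewrite !csE invgM -mulgA mulKg.
(* The inverse turns left translation into a right action, in agreement with the left-to-right
   product of permutations. *)
pose act g (c : C) : C := cs (g^-1 * rep c)%g.
have actE g x : act g (cs x) = cs (g^-1 * x)%g by apply: csM; rewrite repK.
have actM g h c : act (g * h)%g c = act h (act g c).
  by have [x <-] := csP c; rewrite !actE invgM mulgA.
have act_inj g : injective (act g).
  apply: (can_inj (g := act g^-1%g)) => c; rewrite -actM mulgV.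
  by have [x <-] := csP c; rewrite actE invg1 mul1g.
pose th g : {perm C} := perm (@act_inj g).
have thM : {morph th : x y / (x * y)%g}.
  by move=> x y; apply/permP => c; rewrite permM !permE actM.
have gI : group_set [set s | `[< exists g, th g = s >]]%SET.
  apply/group_setP; split; first by rewrite inE; apply/asboolP; exists 1%g; exact: morph1g.
  move=> s t; rewrite !inE => -[g <-] [h <-].
  by exists (g * h)%g; rewrite thM.
pose I : {group {perm C}} := Group gI.
have thI g : th g \in I by rewrite inE; apply/asboolP; exists g.
exists (subg_of I), (fun g => subg I (th g)); split.
- by move=> x y; rewrite thM subgM.
- move=> q; move: (subgP q); rewrite /I /= inE => /asboolP[g e].
  by exists g; rewrite e sgvalK.
move=> g; split => [e|Ng].
  have : th g = 1%g by rewrite -(@subgK _ I _ (thI g)) e.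
  move/permP/(_ (cs 1%g)); rewrite permE perm1 actE mulg1 csE invgK mulg1.
  by [].
apply: val_inj; rewrite /= subgK //; apply/permP => c.
have [x <-] := csP c; rewrite permE perm1 actE; apply/csE.
by rewrite invgM invgK -mulgA; apply: (NJ _ x).
Qed.

Lemma pro_p_quotient N : pro_p p G -> opn N ->
  exists (Q : finGroupType) (f : G -> Q), fquot N f.
Proof.
move=> [_ _ _ hN] [oN nN]; have [k ik] := hN N oN nN.
(* An infinite index would be read as 0, which is not a power of [p]. *)
have fin : finite_set [set setprod [set x] N | x in [set: G]].
  apply: contrapT => nf; move: ik; rewrite /subgroup_index /fset_set.
  case: pselect => // _; rewrite cardfs0 => /esym/eqP.
  by rewrite expn_eq0 -leqn0 leqNgt prime_gt0.
have [Q [f [fM fS fN]]] := normal_finite_quotient nN fin.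
exists Q, f; split => //.
have sT : subgroup [set: G] by [].
have : subgroup_index (setprod [set: G] N) N = #|imq f setT|.
  exact: index_imq_aux.
have -> : setprod [set: G] N = setT.
  apply/seteqP; split => // x _; exists x => //; exists 1%g; last by rewrite mulg1.
  by case: nN => -[].
rewrite ik => e; rewrite /pgroup.
have -> : #|[set: Q]%G| = #|imq f setT|.
  apply: eq_card => q; rewrite finset.in_setT; apply/esym/imqP.
  by have [g <-] := fS q; exists g.
by rewrite -e pnatX pnat_id.
Qed.

End FiniteQuotient.

(** * Linear algebra of functions with values in F_p *)

Section FunctionSpaces.
Variable F : fieldType.
Local Open Scope ring_scope.

Definition lin_closed (T : Type) (P : (T -> F) -> Prop) : Prop :=
  P (fun=> 0) /\ forall a x y, P x -> P y -> P (fun t => a * x t + y t).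

Definition lin_fun (T : Type) (P : (T -> F) -> Prop) (l : (T -> F) -> F) : Prop :=
  forall a x y, P x -> P y -> l (fun t => a * x t + y t) = a * l x + l y.

Definition lin_map (T T' : Type) (f : (T -> F) -> T' -> F) : Prop :=
  forall a x y, f (fun t => a * x t + y t) = (fun t => a * f x t + f y t).

(** A lower bound for the dimension of the space of restrictions to [D] of the members of [P].
    Cochains on a subgroup are total functions on the group of which only the values on that
    subgroup count; hence independence is tested on [D]. *)
Definition dimge (T : Type) (D : set T) (P : (T -> F) -> Prop) (d : nat) : Prop :=
  exists w : 'I_d -> T -> F, (forall i, P (w i)) /\
    forall c : 'I_d -> F,
      (forall t, D t -> \sum_i c i * w i t = 0) -> forall i, c i = 0.

Lemma lin_closed_sum (T : Type) (P : (T -> F) -> Prop) n (c : 'I_n -> F)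
  (w : 'I_n -> T -> F) : lin_closed P -> (forall i, P (w i)) ->
  P (fun t => \sum_i c i * w i t).
Proof.
move=> [P0 PD] Pw.
elim: n c w Pw => [|n IH] c w Pw.
  have -> : (fun t => \sum_(i < 0) c i * w i t) = fun=> 0.
    by apply: funext => t; rewrite big_ord0.
  by [].
have -> : (fun t => \sum_(i < n.+1) c i * w i t) =
    (fun t => c ord0 * w ord0 t + \sum_(i < n) c (lift ord0 i) * w (lift ord0 i) t).
  by apply: funext => t; rewrite big_ord_recl.
by apply: PD => //; apply: IH => i.
Qed.

Lemma lin_fun0 (T : Type) (P : (T -> F) -> Prop) l :
  lin_closed P -> lin_fun P l -> l (fun=> 0) = 0.
Proof.
move=> [P0 _] hl; have := hl 1 _ _ P0 P0.
have -> : (fun _ : T => 1 * 0 + 0 : F) = fun=> 0 by apply: funext => t; rewrite mulr0 addr0.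
by rewrite mul1r => /eqP; rewrite -subr_eq subrr eq_sym => /eqP.
Qed.

Lemma lin_fun_sum (T : Type) (P : (T -> F) -> Prop) l n (c : 'I_n -> F)
  (w : 'I_n -> T -> F) : lin_closed P -> lin_fun P l -> (forall i, P (w i)) ->
  l (fun t => \sum_i c i * w i t) = \sum_i c i * l (w i).
Proof.
move=> PL hl Pw.
elim: n c w Pw => [|n IH] c w Pw.
  rewrite big_ord0 -[RHS](lin_fun0 PL hl); congr l.
  by apply: funext => t; rewrite big_ord0.
have -> : (fun t => \sum_(i < n.+1) c i * w i t) =
    (fun t => c ord0 * w ord0 t + \sum_(i < n) c (lift ord0 i) * w (lift ord0 i) t).
  by apply: funext => t; rewrite big_ord_recl.
rewrite hl //; last exact: (lin_closed_sum _ PL).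
by rewrite big_ord_recl IH.
Qed.

Lemma lin_map_sum (T T' : Type) (f : (T -> F) -> T' -> F) n (c : 'I_n -> F)
  (w : 'I_n -> T -> F) t : lin_map f ->
  f (fun t => \sum_i c i * w i t) t = \sum_i c i * f (w i) t.
Proof.
move=> hf.
have PL : lin_closed (fun _ : T -> F => True) by [].
by apply: (lin_fun_sum (P := fun=> True) (l := fun x => f x t)) => // a x y _ _; rewrite hf.
Qed.

(** The coefficient vectors orthogonal to [l] form a space of dimension at least [d], and a basis of
    it yields the new family. Dropping a member, restricting to the kernel of a functional and
    passing to a hyperplane are all instances. *)
Lemma dimge_combi (T : Type) (D : set T) d (w : 'I_d.+1 -> T -> F) (l : 'I_d.+1 -> F) :
  (forall c : 'I_d.+1 -> F,
      (forall t, D t -> \sum_i c i * w i t = 0) -> forall i, c i = 0) ->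
  exists A : 'I_d -> 'I_d.+1 -> F, (forall k, \sum_i A k i * l i = 0) /\
    forall c : 'I_d -> F,
      (forall t, D t -> \sum_k c k * (\sum_i A k i * w i t) = 0) -> forall k, c k = 0.
Proof.
move=> iw; pose L : 'M[F]_(d.+1, 1) := \matrix_(i, j) l i.
pose K := kermx L; have rK : (d <= \rank K)%N.
  by rewrite mxrank_ker; have := rank_leq_col L; lia.
pose B := row_base K; exists (fun k i => B (widen_ord rK k) i); split=> [k|c hc k].
  have : B *m L = 0 by apply/sub_kermxP; rewrite eq_row_base.
  move=> /matrixP/(_ (widen_ord rK k) 0); rewrite !mxE => e; apply: etrans e.
  by apply: eq_bigr => i _; rewrite !mxE.
pose c' : 'rV[F]_(\rank K) := \row_j (if insub (val j) is Some k then c k else 0).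
have c'E m : c' 0 (widen_ord rK m) = c m.
  by rewrite mxE insubT //= => hm; congr c; exact: val_inj.
have c'B i : (c' *m B) 0 i = \sum_k c k * B (widen_ord rK k) i.
  rewrite mxE (bigID (fun j : 'I_(\rank K) => (j < d)%N)) /= [X in _ + X]big1 ?addr0; last first.
    by move=> j /negbTE hj; rewrite mxE insubF ?mul0r.
  rewrite (big_ord_narrow rK); apply: eq_bigr => m _; by rewrite c'E.
have c'0 : c' *m B = 0.
  apply/rowP => i; rewrite c'B mxE.
  apply: (iw (fun i => \sum_k c k * B (widen_ord rK k) i)) => t /hc e; apply: etrans e.
  under eq_bigr do rewrite big_distrl /=.
  rewrite exchange_big /=; apply: eq_bigr => j _; rewrite big_distrr /=.
  by apply: eq_bigr => m _; rewrite mulrA.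
have : c' = 0 by apply: (row_free_inj (row_base_free K)); rewrite c'0 mul0mx.
by move=> /rowP/(_ (widen_ord rK k)); rewrite c'E mxE.
Qed.

Lemma dimge_pred (T : Type) (D : set T) (P : (T -> F) -> Prop) d :
  lin_closed P -> dimge D P d.+1 -> dimge D P d.
Proof.
move=> PL [w [Pw iw]]; have [A [_ iA]] := dimge_combi (fun=> 0) iw.
exists (fun k t => \sum_i A k i * w i t); split=> // k.
exact: (lin_closed_sum (A k) PL Pw).
Qed.

Lemma dimge_leq (T : Type) (D : set T) P d d' :
  lin_closed P -> (d' <= d)%N -> dimge D P d -> dimge D P d'.
Proof.
move=> PL /subnK <-; elim: (d - d')%N => [//|k IH]; rewrite addSn.
by move/(dimge_pred PL).
Qed.

Lemma dimge_sub (T : Type) (D : set T) (P Q : (T -> F) -> Prop) d :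
  (forall x, P x -> Q x) -> dimge D P d -> dimge D Q d.
Proof. by move=> PQ [w [Pw iw]]; exists w; split=> // i; exact: PQ. Qed.

Lemma dimge_ker (T : Type) (D : set T) (P : (T -> F) -> Prop) l d :
  lin_closed P -> lin_fun P l -> dimge D P d.+1 ->
  dimge D (fun x => P x /\ l x = 0) d.
Proof.
move=> PL hl [w [Pw iw]]; have [A [lA iA]] := dimge_combi (fun i => l (w i)) iw.
exists (fun k t => \sum_i A k i * w i t); split=> // k; split.
  exact: (lin_closed_sum (A k) PL Pw).
by rewrite (lin_fun_sum _ PL hl Pw) lA.
Qed.

Lemma lin_closed_ker (T : Type) (P : (T -> F) -> Prop) l :
  lin_closed P -> lin_fun P l -> lin_closed (fun x => P x /\ l x = 0).
Proof.
move=> PL hl; split; first by split; [exact: PL.1 | exact: lin_fun0 PL hl].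
move=> a x y [Px lx] [Py ly]; split; first exact: PL.2.
by rewrite hl // lx ly mulr0 addr0.
Qed.

Lemma dimge_hyperplane (T : Type) (D : set T) (P Q : (T -> F) -> Prop) z d :
  lin_closed Q -> (forall x, P x -> exists c : F, Q (fun t => x t - c * z t)) ->
  dimge D P d.+1 -> dimge D Q d.
Proof.
move=> QL hQ [w [Pw iw]].
have /choice [c hc] : forall i, exists c, Q (fun t => w i t - c * z t) by move=> i; exact: hQ.
have [A [lA iA]] := dimge_combi c iw.
exists (fun k t => \sum_i A k i * w i t); split=> // k.
have -> : (fun t => \sum_i A k i * w i t) =
          (fun t => \sum_i A k i * (w i t - c i * z t)).
  apply: funext => t; under [RHS]eq_bigr do rewrite mulrBr mulrA.
  by rewrite sumrB -big_distrl /= lA mul0r subr0.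
exact: (lin_closed_sum (A k) QL hc).
Qed.

(** Rank and nullity, for lower bounds: independent elements of the kernel of [f] together with
    preimages of independent elements of the image. *)
Lemma dimge_extension (T T' : Type) (D : set T) (D' : set T') (f : (T -> F) -> T' -> F)
  (P : (T -> F) -> Prop) (Q : (T' -> F) -> Prop) a b :
  lin_map f ->
  (forall x, (forall t, D t -> x t = 0) -> forall t, D' t -> f x t = 0) ->
  dimge D (fun x => P x /\ forall t, D' t -> f x t = 0) a -> dimge D' Q b ->
  (forall y, Q y -> exists2 x, P x & forall t, D' t -> f x t = y t) ->
  dimge D P (a + b).
Proof.
move=> hf f0 [v [Pv iv]] [y [Qy iy]] hl.
have /choice [x hx] : forall j, exists x, P x /\ forall t, D' t -> f x t = y j t.
  by move=> j; have [x] := hl _ (Qy j); exists x.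
pose w (i : 'I_(a + b)) := match fintype.split i with inl j => v j | inr j => x j end.
have wl j : w (lshift b j) = v j.
  by rewrite /w; case: split_ordP => k; [move/lshift_inj -> | move/eqP; rewrite eq_lrshift].
have wr j : w (rshift a j) = x j.
  by rewrite /w; case: split_ordP => k; [move/eqP; rewrite eq_rlshift | move/rshift_inj ->].
exists w; split=> [i|c hc].
  by rewrite /w; case: fintype.split => j; [exact: (Pv j).1 | exact: (hx j).1].
have cr j : c (rshift a j) = 0.
  apply: (iy (fun j => c (rshift a j))) => t D't.
  have := f0 _ hc t D't; rewrite (lin_map_sum c w t hf) big_split_ord /= big1 ?add0r.
    by move=> e; apply: etrans e; apply: eq_bigr => k _; rewrite wr (hx k).2.
  by move=> k _; rewrite wl (Pv k).2 // mulr0.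
have cl j : c (lshift b j) = 0.
  apply: (iv (fun j => c (lshift b j))) => t Dt.
  have := hc t Dt; rewrite big_split_ord /= [X in _ + X]big1 ?addr0 => [e|k _].
    by apply: etrans e; apply: eq_bigr => k _; rewrite wl.
  by rewrite cr mul0r.
by move=> i; case: (split_ordP i) => j ->.
Qed.

Lemma dimge_inj (T T' : Type) (D : set T) (D' : set T') (f : (T -> F) -> T' -> F)
  (P : (T -> F) -> Prop) (Q : (T' -> F) -> Prop) d :
  lin_map f -> lin_closed P -> (forall x, P x -> Q (f x)) ->
  (forall x, P x -> (forall t, D' t -> f x t = 0) -> forall t, D t -> x t = 0) ->
  dimge D P d -> dimge D' Q d.
Proof.
move=> hf PL PQ f0 [w [Pw iw]]; exists (fun i => f (w i)); split=> [i|c hc].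
  exact: PQ.
apply: iw; apply: (f0 _ (lin_closed_sum c PL Pw)) => t D't.
by rewrite (lin_map_sum c w t hf) hc.
Qed.

Lemma dimge_common_zero (T : Type) (D : set T) (P : (T -> F) -> Prop) d r
  (l : 'I_r -> (T -> F) -> F) : lin_closed P -> (forall k, lin_fun P (l k)) ->
  dimge D P (r + d) -> dimge D (fun x => P x /\ forall k, l k x = 0) d.
Proof.
elim: r P l => [|r IH] P l PL hl hd.
  by apply: dimge_sub hd => x Px; split=> // -[].
have h1 := dimge_ker PL (hl ord0) (eq_rect _ _ hd _ (addSn _ _)).
have PL1 := lin_closed_ker PL (hl ord0).
have := IH _ (fun k => l (lift ord0 k)) PL1 _ h1.
case=> [k a x y [Px _] [Py _]|w [Pw iw]]; first exact: hl.
exists w; split=> // i; have [[Pi l0] li] := Pw i; split=> // k.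
by case: (unliftP ord0 k) => [j ->|->].
Qed.

Lemma dimge1_neq0 (T : Type) (D : set T) (P : (T -> F) -> Prop) :
  dimge D P 1 -> exists x, P x /\ exists2 t, D t & x t != 0.
Proof.
move=> [w [Pw iw]]; exists (w ord0); split=> //; apply: contrapT => h.
have : (1 : F) = 0.
  apply: (iw (fun=> 1) _ ord0) => t Dt; rewrite big_ord1 mul1r.
  by apply/eqP; apply: contrapT => /negP n; apply: h; exists t.
by move/eqP; rewrite oner_eq0.
Qed.

End FunctionSpaces.

(** * Finite differences of functions on F_p *)

Section Differences.
Variables (p : nat) (p_pr : prime p).
Local Notation Fp := 'F_p.
Local Open Scope ring_scope.
Implicit Types (m : Fp -> Fp) (i c : Fp).

Lemma Fp_pnat0 : p%:R = 0 :> Fp.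
Proof. exact: pchar_Fp_0. Qed.

Lemma Fp_card : (Zp_trunc (pdiv p)).+2 = p.
Proof. exact: Fp_cast. Qed.

Lemma ltn_Fp i : (i < p)%N.
Proof. by rewrite -[X in (_ < X)%N]Fp_card ltn_ord. Qed.

Lemma Fp_natK i : (i : nat)%:R = i.
Proof. exact: natr_Zp. Qed.

Lemma Fp_nat_val k : (k < p)%N -> (k%:R : Fp) = k :> nat.
Proof. by move=> kp; rewrite /= val_Fp_nat // modn_small. Qed.

Lemma Fp_natr_eq0 k : ((k%:R : Fp) == 0) = (p %| k)%N.
Proof. by rewrite (dvdn_pcharf (pchar_Fp p_pr)). Qed.

Lemma Fp_sum m : \sum_i m i = \sum_(k < p) m k%:R.
Proof.
have h n : n = (Zp_trunc (pdiv p)).+2 -> \sum_i m i = \sum_(k < n) m k%:R.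
  by move=> ->; apply: eq_bigr => i _; rewrite Fp_natK.
exact/h/esym/Fp_card.
Qed.

(** This is sigma - 1 in the group algebra of Z/p acting by translation; the kernels of its powers
    are the submodules of dimensions 0, 1, ..., p. *)
Definition diff m : Fp -> Fp := fun i => m (i + 1) - m i.

Lemma iter_diff_lin k a m m' :
  iter k diff (fun i => a * m i + m' i) = (fun i => a * iter k diff m i + iter k diff m' i).
Proof.
by elim: k => [//|k IH]; rewrite !iterS IH; apply: funext => i; rewrite /diff; ring.
Qed.

Lemma iter_diff_shift k m c :
  iter k diff (fun i => m (i + c)) = (fun i => iter k diff m (i + c)).
Proof.
by elim: k => [//|k IH]; rewrite !iterS IH; apply: funext => i; rewrite /diff addrAC.
Qed.

Lemma iter_diff0 k : iter k diff (fun=> 0) = fun=> 0.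
Proof.
by elim: k => [//|k IH]; rewrite !iterS IH; apply: funext => i; rewrite /diff subrr.
Qed.

Lemma diff_const m : diff m = (fun=> 0) -> forall i, m i = m 0.
Proof.
move=> d i; rewrite -(Fp_natK i); elim: (i : nat) => [//|k IH].
have /eqP := congr1 (@^~ k%:R) d; rewrite /diff subr_eq0 => /eqP.
by rewrite -natr1 => ->.
Qed.

Lemma newton k m : m k%:R = \sum_(j < k.+1) ('C(k, j)%:R * iter j diff m 0).
Proof.
elim: k m => [|k IH] m; first by rewrite big_ord1 bin0 mul1r.
have -> : m k.+1%:R = m k%:R + diff m k%:R by rewrite /diff -natr1 [RHS]addrC subrK.
rewrite !IH [RHS]big_ord_recl /= bin0 mul1r.
have -> : \sum_(j < k.+1) 'C(k, j)%:R * iter j diff m 0 =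
          m 0 + \sum_(j < k.+1) 'C(k, j.+1)%:R * iter j.+1 diff m 0.
  have -> : \sum_(j < k.+1) 'C(k, j)%:R * iter j diff m 0 =
            \sum_(j < k.+2) 'C(k, j)%:R * iter j diff m 0.
    by rewrite [RHS]big_ord_recr /= bin_small // mul0r addr0.
  by rewrite big_ord_recl /= bin0 mul1r; congr (_ + _); apply: eq_bigr.
rewrite -addrA -big_split /=; congr (_ + _); apply: eq_bigr => j _.
by rewrite -iterSr /bump add1n binS natrD mulrDl.
Qed.

Lemma sum_first_last (a : nat -> Fp) n : (0 < n)%N ->
  \sum_(j < n.+1) a j = a 0 + \sum_(j < n.-1) a j.+1 + a n.
Proof.
case: n => // n _; rewrite big_ord_recl big_ord_recr /= addrA.
by congr (_ + _); congr (_ + _); apply: eq_bigr.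
Qed.

Lemma sum_last (a : nat -> Fp) n : (0 < n)%N ->
  \sum_(j < n) a j = \sum_(j < n.-1) a j + a n.-1.
Proof. by case: n => // n _; rewrite big_ord_recr. Qed.

Lemma bin_p0 j : (j < p.-1)%N -> 'C(p, j.+1)%:R = 0 :> Fp.
Proof.
move=> jp; have p0 := prime_gt0 p_pr.
apply/eqP; rewrite Fp_natr_eq0; apply: prime_dvd_bin => //; lia.
Qed.

(** In characteristic p, (sigma - 1)^p = sigma^p - 1 = 0; here it is read off from Newton's
    formula. *)
Lemma iter_diff_p m : iter p diff m = fun=> 0.
Proof.
have base m' : iter p diff m' 0 = 0.
  have := newton p m'; rewrite Fp_pnat0.
  rewrite (sum_first_last (fun j => 'C(p, j)%:R * iter j diff m' 0)) ?prime_gt0 //.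
  rewrite bin0 binn !mul1r big1 => [|j _]; last by rewrite bin_p0 ?mul0r.
  by rewrite addr0 => e; apply: (addrI (m' 0)); rewrite addr0 -e.
by apply: funext => i; have := base (fun j => m (j + i)); rewrite iter_diff_shift add0r.
Qed.

Lemma sum_bin_column k n : (\sum_(i < n) 'C(i, k) = 'C(n, k.+1))%N.
Proof.
by elim: n => [|n IH]; [rewrite big_ord0 | rewrite big_ord_recr /= IH binS addnC].
Qed.

(** (sigma - 1)^(p-1) is the norm 1 + sigma + ... + sigma^(p-1). Thus summation over F_p is the
    projection of the coinduced module to its top quotient. *)
Lemma iter_diff_pred m : iter p.-1 diff m 0 = \sum_i m i.
Proof.
rewrite Fp_sum.
have -> : \sum_(k < p) m k%:R = \sum_(k < p) \sum_(j < p) 'C(k, j)%:R * iter j diff m 0.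
  apply: eq_bigr => k _; rewrite newton (big_ord_widen p (fun j => 'C(k, j)%:R * iter j diff m 0)) //.
  rewrite big_mkcond /=; apply: eq_bigr => j _; case: ifP => // /negbT.
  by rewrite -leqNgt => kj; rewrite bin_small ?mul0r.
rewrite exchange_big /=.
have -> : \sum_(j < p) \sum_(k < p) 'C(k, j)%:R * iter j diff m 0 =
          \sum_(j < p) 'C(p, j.+1)%:R * iter j diff m 0.
  by apply: eq_bigr => j _; rewrite -big_distrl /= -sum_bin_column natr_sum.
rewrite (sum_last (fun j => 'C(p, j.+1)%:R * iter j diff m 0)) ?prime_gt0 //.
rewrite prednK ?prime_gt0 // binn mul1r big1 ?add0r // => j _.
by rewrite bin_p0 ?mul0r.
Qed.

(** For k < p this polynomial is killed by diff^(k+1) and sent to 1 by diff^k, so its multiples lift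
    elements of the top quotient F_p to the module. *)
Definition binf k : Fp -> Fp := fun i => 'C(i, k)%:R.

Lemma diff_binf k : (k.+1 < p)%N -> diff (binf k.+1) = binf k.
Proof.
move=> kp; apply: funext => i; rewrite /diff /binf.
have ip := ltn_Fp i.
have -> : i + 1 = (i : nat).+1%:R by rewrite -natr1 Fp_natK.
have [ip'|ip'] := ltnP (i : nat).+1 p.
  by rewrite Fp_nat_val // binS natrD addrAC subrr add0r.
(* Here i + 1 wraps around to 0; the identity survives because p divides the binomial coefficient of
   p over k + 1. *)
have e : (i : nat).+1 = p by apply/eqP; rewrite eqn_leq ip ip'.
rewrite e Fp_pnat0 /= bin0n /= sub0r; apply/eqP; rewrite eq_sym -subr_eq0 opprK -natrD addnC -binS e.
by rewrite Fp_natr_eq0; apply: prime_dvd_bin.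
Qed.

Lemma binf0 : binf 0 = fun=> 1.
Proof. by apply: funext => i; rewrite /binf bin0. Qed.

Lemma iter_diff_binf k j : (k + j < p)%N -> iter k diff (binf (k + j)) = binf j.
Proof.
elim: k => [//|k IH] kj.
by rewrite iterSr addSn diff_binf // IH // ltnW.
Qed.

Lemma iter_diff_binf0 k : (k < p)%N -> iter k diff (binf k) = fun=> 1.
Proof. by move=> kp; rewrite -{2}[k]addn0 iter_diff_binf ?addn0 // binf0. Qed.

Lemma sum_Fp_shift m c : \sum_i m (i + c) = \sum_i m i.
Proof. by rewrite [RHS](reindex_inj (addIr c)). Qed.

End Differences.

(** * Cocycles, coboundaries and duality *)

Section Cochains.
Variables (p : nat) (p_pr : prime p) (G : topGroupType).
Hypothesis cG : compact [set: G].
Local Notation Fp := 'F_p.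
Implicit Types (U N : set G).

Definition open_subgroup U : Prop := open U /\ subgroup U.

(** Local constancy on [U] in the uniform form that continuity takes on a compact group: one open
    normal subgroup inside [U] works at all points. *)
Definition smooth U (X : Type) (f : G -> X) : Prop :=
  exists2 N, opn N /\ N `<=` U & forall g n, U g -> N n -> f (g * n)%g = f g.

Definition smooth2 U (X : Type) (f : G -> G -> X) : Prop :=
  exists2 N, opn N /\ N `<=` U &
    forall g h m n, U g -> U h -> N m -> N n -> f (g * m)%g (h * n)%g = f g h.

Definition hom1 U (x : G -> Fp) : Prop :=
  smooth U x /\ forall g h, U g -> U h -> x (g * h)%g = (x g + x h)%R.

Definition Z2 U (f : G -> G -> Fp) : Prop :=
  smooth2 U f /\ forall a b c, U a -> U b -> U c ->
    (f b c - f (a * b)%g c + f a (b * c)%g - f a b = 0)%R.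

Definition B2 U (f : G -> G -> Fp) : Prop :=
  exists2 b : G -> Fp, smooth U b &
    forall g h, U g -> U h -> f g h = (b g + b h - b (g * h)%g)%R.

Definition cp (x y : G -> Fp) : G -> G -> Fp := fun g h => (x g * y h)%R.

Definition nonzero_on U (x : G -> Fp) : Prop := exists2 u, U u & x u != 0%R.

(** The trace embeds H^2 in F_p. In the first alternative H^2 = 0; in the second only the left
    kernel of the cup product is excluded, and the right one follows by anticommutativity. *)
Definition pd_trace U (tr : (G -> G -> Fp) -> Fp) : Prop :=
  [/\ forall a f f', Z2 U f -> Z2 U f' ->
        tr (fun g h => a * f g h + f' g h)%R = (a * tr f + tr f')%R,
      forall f, Z2 U f -> (tr f = 0%R <-> B2 U f) &
      (forall f, Z2 U f -> tr f = 0%R) \/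
      (forall x, hom1 U x -> nonzero_on U x ->
         exists2 y, hom1 U y & tr (cp x y) <> 0%R)].

Section Smooth.
Variable U : set G.
Hypothesis U_open : open_subgroup U.

Lemma osub1 : U 1%g. Proof. by case: U_open => _ []. Qed.
Lemma osubM x y : U x -> U y -> U (x * y)%g. Proof. by case: U_open => _ []; auto. Qed.
Lemma osubV x : U x -> U x^-1%g. Proof. by case: U_open => _ []; auto. Qed.

Lemma smooth_cst (X : Type) (a : X) : smooth U (fun=> a).
Proof.
by have [N oN NU] := opn_core cG U_open.1 U_open.2; exists N.
Qed.

Lemma smooth_comp (X Y : Type) (o : X -> Y) f : smooth U f -> smooth U (fun g => o (f g)).
Proof. by move=> [N oN h]; exists N => // g n Ug Nn; rewrite h. Qed.

Lemma smooth_op (X Y W : Type) (o : X -> Y -> W) f f' :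
  smooth U f -> smooth U f' -> smooth U (fun g => o (f g) (f' g)).
Proof.
move=> [N [oN NU] h] [N' [oN' NU'] h']; exists (N `&` N').
  by split; [exact: opnI | move=> x [/NU]].
by move=> g n Ug [Nn N'n]; rewrite h // h'.
Qed.

Lemma smooth_ext (X : Type) (f f' : G -> X) :
  (forall g, U g -> f g = f' g) -> smooth U f -> smooth U f'.
Proof.
move=> e [N [oN NU] h]; exists N => // g n Ug Nn.
by rewrite -!e ?h //; apply: osubM => //; exact: NU.
Qed.

Lemma smooth2_op (X Y W : Type) (o : X -> Y -> W) f f' :
  smooth2 U f -> smooth2 U f' -> smooth2 U (fun g h => o (f g h) (f' g h)).
Proof.
move=> [N [oN NU] h] [N' [oN' NU'] h']; exists (N `&` N').
  by split; [exact: opnI | move=> x [/NU]].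
by move=> g k m n Ug Uk [Nm N'm] [Nn N'n]; rewrite h // h'.
Qed.

Lemma smooth2_comp (X Y : Type) (o : X -> Y) f :
  smooth2 U f -> smooth2 U (fun g h => o (f g h)).
Proof. by move=> [N oN h]; exists N => // g k m n *; rewrite h. Qed.

Lemma smooth2_l (X : Type) (f : G -> X) : smooth U f -> smooth2 U (fun g h => f g).
Proof. by move=> [N oN h]; exists N => // g k m n *; rewrite h. Qed.

Lemma smooth2_r (X : Type) (f : G -> X) : smooth U f -> smooth2 U (fun g h => f h).
Proof. by move=> [N oN h]; exists N => // g k m n *; rewrite h. Qed.

Lemma smooth2_mul (X : Type) (f : G -> X) : smooth U f -> smooth2 U (fun g h => f (g * h)%g).
Proof.
move=> [N [oN NU] h]; exists N => // g k m n Ug Uk Nm Nn.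
case: oN => _ [[_ NM _] NJ].
have -> : (g * m * (k * n) = g * k * (m ^ k * n))%g by rewrite conjgE !mulgA mulgK.
by apply: h; [exact: osubM | apply: NM => //; exact: NJ].
Qed.

Lemma hom1_1 x : hom1 U x -> x 1%g = 0%R.
Proof.
move=> [_ xM]; have := xM 1%g 1%g osub1 osub1; rewrite mulg1 => e.
by apply: (addrI (x 1%g)); rewrite addr0 -e.
Qed.

Lemma hom1V x g : hom1 U x -> U g -> x g^-1%g = (- x g)%R.
Proof.
move=> hx Ug; apply/eqP; rewrite -addr_eq0 -hx.2 ?mulVg ?(hom1_1 hx) //.
exact: osubV.
Qed.

Lemma hom1X x g n : hom1 U x -> U g -> x (g ^+ n)%g = (x g *+ n)%R.
Proof.
move=> hx Ug; elim: n => [|n IH]; first by rewrite expg0 (hom1_1 hx).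
rewrite expgS hx.2 ?IH ?mulrS //.
by elim: {IH} n => [|n IH]; rewrite ?expg0 ?expgS; [exact: osub1 | exact: osubM].
Qed.

Lemma osubX g n : U g -> U (g ^+ n)%g.
Proof.
by move=> Ug; elim: n => [|n IH]; rewrite ?expg0 ?expgS; [exact: osub1 | exact: osubM].
Qed.

Lemma lin_closed_hom1 : lin_closed (hom1 U).
Proof.
split=> [|a x y hx hy].
  by split=> [|g h _ _]; [exact: smooth_cst | rewrite addr0].
split=> [|g h Ug Uh].
  by apply: (smooth_op (fun u v => a * u + v)%R); [exact: hx.1 | exact: hy.1].
by rewrite hx.2 // hy.2 // mulrDr addrACA.
Qed.

Lemma Z2_lin a f f' : Z2 U f -> Z2 U f' -> Z2 U (fun g h => a * f g h + f' g h)%R.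
Proof.
move=> [sf cf] [sf' cf']; split=> [|x y z Ux Uy Uz].
  exact: (smooth2_op (fun u v => a * u + v)%R).
have := cf x y z Ux Uy Uz; have := cf' x y z Ux Uy Uz.
set A := f' _ _; set B := f' _ _; set C := f' _ _; set D := f' _ _ => e'.
set A' := f _ _; set B' := f _ _; set C' := f _ _; set D' := f _ _ => e.
transitivity (a * (A' - B' + C' - D') + (A - B + C - D))%R; first by ring.
by rewrite e e' mulr0 addr0.
Qed.

Lemma cp_Z2 x y : hom1 U x -> hom1 U y -> Z2 U (cp x y).
Proof.
move=> [sx xM] [sy yM]; split=> [|a b c Ua Ub Uc]; rewrite /cp.
  by apply: (smooth2_op (fun u v => u * v)%R); [exact: smooth2_l | exact: smooth2_r].
by rewrite xM // yM //; ring.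
Qed.

Lemma B2_ext f f' : (forall g h, U g -> U h -> f g h = f' g h) -> B2 U f -> B2 U f'.
Proof. by move=> e [b sb eb]; exists b => // g h Ug Uh; rewrite -e // eb. Qed.

Variables (tr : (G -> G -> Fp) -> Fp).
Hypothesis htr : pd_trace U tr.

Lemma Z2_0 : Z2 U (fun _ _ => 0%R).
Proof.
split=> [|*]; last by ring.
exact/smooth2_l/smooth_cst.
Qed.

Lemma trL a f f' : Z2 U f -> Z2 U f' ->
  tr (fun g h => a * f g h + f' g h)%R = (a * tr f + tr f')%R.
Proof. by case: htr => h _ _; exact: h. Qed.

Lemma tr0 f : Z2 U f -> (tr f = 0%R <-> B2 U f).
Proof. by case: htr => _ h _; exact: h. Qed.

Lemma tr_eq f f' : Z2 U f -> Z2 U f' ->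
  B2 U (fun g h => f g h - f' g h)%R -> tr f = tr f'.
Proof.
move=> zf zf' b.
have e : (fun g h => f g h - f' g h)%R = (fun g h => -1 * f' g h + f g h)%R.
  by apply: funext => g; apply: funext => h; rewrite mulN1r addrC.
have /tr0 : Z2 U (fun g h => f g h - f' g h)%R by rewrite e; exact: Z2_lin.
move=> /iffRL/(_ b); rewrite e trL // mulN1r addrC => /eqP.
by rewrite subr_eq0 => /eqP.
Qed.

Lemma tr_ext f f' : Z2 U f -> Z2 U f' -> (forall g h, U g -> U h -> f g h = f' g h) ->
  tr f = tr f'.
Proof.
move=> zf zf' e; apply: tr_eq => //; exists (fun=> 0%R); first exact: smooth_cst.
by move=> g h Ug Uh; rewrite e // subrr; ring.
Qed.

Lemma trZ a f : Z2 U f -> tr (fun g h => a * f g h)%R = (a * tr f)%R.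
Proof.
move=> zf; have t0 : tr (fun _ _ => 0%R) = 0%R.
  apply/(tr0 Z2_0); exists (fun=> 0%R); first exact: smooth_cst.
  by move=> *; ring.
have := trL a zf Z2_0; rewrite t0 addr0 => <-; congr tr.
by apply: funext => g; apply: funext => h; rewrite addr0.
Qed.

Lemma lin_fun_cpr x : hom1 U x -> lin_fun (hom1 U) (fun y => tr (cp x y)).
Proof.
move=> hx a y z hy hz; rewrite -trL; [|exact: cp_Z2|exact: cp_Z2].
by congr tr; apply: funext => g; apply: funext => h; rewrite /cp; ring.
Qed.

Lemma lin_fun_cpl y : hom1 U y -> lin_fun (hom1 U) (fun x => tr (cp x y)).
Proof.
move=> hy a x z hx hz; rewrite -trL; [|exact: cp_Z2|exact: cp_Z2].
by congr tr; apply: funext => g; apply: funext => h; rewrite /cp; ring.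
Qed.

(** The coboundary of -x y is x(g) y(h) + y(g) x(h). *)
Lemma cp_anti x y : hom1 U x -> hom1 U y -> tr (cp x y) = (- tr (cp y x))%R.
Proof.
move=> hx hy; rewrite -mulN1r -trZ; last exact: cp_Z2.
apply: tr_eq; first exact: cp_Z2.
  have -> : (fun g h => -1 * cp y x g h)%R = (fun g h => (-1) * cp y x g h + 0)%R.
    by apply: funext => g; apply: funext => h; rewrite addr0.
  apply: Z2_lin; [exact: cp_Z2 | exact: Z2_0].
exists (fun g => - (x g * y g))%R.
  by apply: (smooth_op (fun u v => - (u * v))%R); [exact: hx.1 | exact: hy.1].
by move=> g h Ug Uh; rewrite /cp hx.2 // hy.2 //; ring.
Qed.

(** Nondegeneracy in the form in which obstructions are cancelled. When H^2 = 0 both traces are 0,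
    so that callers need no case distinction. *)
Lemma cp_surj x f : hom1 U x -> nonzero_on U x -> Z2 U f ->
  exists2 y, hom1 U y & tr (cp x y) = tr f.
Proof.
move=> hx nx zf; case: htr => _ _ [h|h].
  exists (fun=> 0%R); first exact: lin_closed_hom1.1.
  by rewrite !h //; apply: cp_Z2 => //; exact: lin_closed_hom1.1.
have [y hy ny] := h x hx nx.
exists (fun g => (tr f / tr (cp x y)) * y g + 0)%R.
  by apply: lin_closed_hom1.2 => //; exact: lin_closed_hom1.1.
rewrite (lin_fun_cpr hx) //; last exact: lin_closed_hom1.1.
rewrite (lin_fun0 lin_closed_hom1 (lin_fun_cpr hx)) addr0 divfK //; exact/eqP.
Qed.

End Smooth.
End Cochains.

(** * Duality in subgroups of index p *)

Section IndexStep.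
Variables (p : nat) (p_pr : prime p) (G : topGroupType).
Hypothesis cG : compact [set: G].
Local Notation Fp := 'F_p.
Local Notation D := (@diff p).
Variables (U : set G) (tr : (G -> G -> Fp) -> Fp) (chi : G -> Fp) (s : G).
Hypotheses (U_open : open_subgroup U) (htr : pd_trace U tr).
Hypotheses (hchi : hom1 U chi) (Us : U s) (chis : chi s = 1%R).

(* Cochains with values in the U-module of functions on F_p, on which g acts by
   (g m) i = m (i + chi g). *)
Definition Z1M (X : G -> Fp -> Fp) : Prop :=
  smooth U X /\ forall g h, U g -> U h ->
    forall i, X (g * h)%g i = (X g i + X h (i + chi g))%R.

Definition Z2M (F : G -> G -> Fp -> Fp) : Prop :=
  smooth2 U F /\ forall g h k, U g -> U h -> U k -> forall i,
    (F h k (i + chi g) - F (g * h)%g k i + F g (h * k)%g i - F g h i = 0)%R.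

Definition dM (B : G -> Fp -> Fp) : G -> G -> Fp -> Fp :=
  fun g h i => (B h (i + chi g) - B (g * h)%g i + B g i)%R.

Lemma chi_nz : nonzero_on U chi.
Proof. by exists s => //; rewrite chis oner_neq0. Qed.

Lemma dM_smooth B : smooth U B -> smooth2 U (dM B).
Proof.
move=> sB; rewrite /dM.
have h1 := smooth2_op (fun (c : Fp) (m : Fp -> Fp) i => m (i + c)%R)
  (smooth2_l hchi.1) (smooth2_r sB).
have h2 := smooth2_op (fun (m m' : Fp -> Fp) i => m i - m' i)%R h1 (smooth2_mul U_open sB).
exact: (smooth2_op (fun (m m' : Fp -> Fp) i => m i + m' i)%R h2 (smooth2_l sB)).
Qed.

Lemma dM_Z2M B : smooth U B -> Z2M (dM B).
Proof.
move=> sB; split; first exact: dM_smooth.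
move=> g h k Ug Uh Uk i; rewrite /dM hchi.2 // mulgA [(i + (chi g + chi h))%R]addrA; ring.
Qed.

Lemma Z2M_sub F F' : Z2M F -> Z2M F' -> Z2M (fun g h i => F g h i - F' g h i)%R.
Proof.
move=> [sF cF] [sF' cF']; split.
  exact: (smooth2_op (fun (m m' : Fp -> Fp) i => m i - m' i)%R sF sF').
move=> g h k Ug Uh Uk i; have := cF g h k Ug Uh Uk i; have := cF' g h k Ug Uh Uk i.
set A := F' _ _ _; set B := F' _ _ _; set C := F' _ _ _; set E := F' _ _ _ => e'.
set A' := F _ _ _; set B' := F _ _ _; set C' := F _ _ _; set E' := F _ _ _ => e.
transitivity ((A' - B' + C' - E') - (A - B + C - E))%R; first by ring.
by rewrite e e' subr0.
Qed.

Lemma iter_diff_sub k (m m' : Fp -> Fp) :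
  iter k D (fun i => m i - m' i)%R = (fun i => iter k D m i - iter k D m' i)%R.
Proof.
have -> : (fun i => m i - m' i)%R = (fun i => -1 * m' i + m i)%R.
  by apply: funext => i; rewrite mulN1r addrC.
by rewrite iter_diff_lin; apply: funext => i; rewrite mulN1r addrC.
Qed.

Lemma iter_diff_add k (m m' : Fp -> Fp) :
  iter k D (fun i => m i + m' i)%R = (fun i => iter k D m i + iter k D m' i)%R.
Proof.
have -> : (fun i => m i + m' i)%R = (fun i => 1 * m i + m' i)%R.
  by apply: funext => i; rewrite mul1r.
by rewrite iter_diff_lin; apply: funext => i; rewrite mul1r.
Qed.

Lemma iter_diff_scale k a (m : Fp -> Fp) :
  iter k D (fun i => a * m i)%R = (fun i => a * iter k D m i)%R.
Proof.
have -> : (fun i => a * m i)%R = (fun i => a * m i + (fun=> 0) i)%R.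
  by apply: funext => i; rewrite addr0.
by rewrite iter_diff_lin iter_diff0; apply: funext => i; rewrite addr0.
Qed.

Lemma iter_diff_dM k B g h :
  iter k D (dM B g h) = dM (fun g => iter k D (B g)) g h.
Proof. by rewrite /dM iter_diff_add iter_diff_sub iter_diff_shift. Qed.

Lemma iter_diff_const k (m : Fp -> Fp) i :
  iter k.+1 D m = (fun=> 0%R) -> iter k D m i = iter k D m 0%R.
Proof. by move=> e; exact: (diff_const (m := iter k D m) e). Qed.

(** A function killed by [diff] is constant, and the action on constants is trivial; so the top
    coefficient of a cocycle with values in the kernel of diff^(k+1) is a cocycle with values in
    F_p. *)
Lemma Z2M_top F k : Z2M F ->
  (forall g h, U g -> U h -> iter k.+1 D (F g h) = fun=> 0%R) ->
  Z2 U (fun g h => iter k D (F g h) 0%R).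
Proof.
move=> [sF cF] top; split.
  exact: (smooth2_comp (fun m : Fp -> Fp => iter k D m 0%R) sF).
move=> a b c Ua Ub Uc.
have hc m : iter k.+1 D m = (fun=> 0%R) -> iter k D m 0%R = iter k D m (0 + chi a)%R.
  by move=> e; rewrite [RHS]iter_diff_const.
rewrite (hc (F b c)) ?top //.
have := congr1 (fun m => iter k D m 0%R) (funext (cF a b c Ua Ub Uc)).
by rewrite iter_diff_sub iter_diff_add iter_diff_sub iter_diff_shift iter_diff0.
Qed.

(* With [k] one less than the length of the module ker (diff^(k+1)): a class of
   degree two vanishes as soon as its image in the top quotient F_p does, because
   the connecting map from the top quotient is the cup product with chi. *)
Lemma Z2M_trace_eq0 k F : (k < p)%N -> Z2M F ->
  (forall g h, U g -> U h -> iter k.+1 D (F g h) = fun=> 0%R) ->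
  tr (fun g h => iter k D (F g h) 0%R) = 0%R ->
  exists2 B, smooth U B /\ (forall g, U g -> iter k.+1 D (B g) = fun=> 0%R) &
    forall g h, U g -> U h -> F g h = dM B g h.
Proof.
elim: k F => [|k IH] F kp zF top t0.
  have [b sb eb] := iffLR (tr0 htr (Z2M_top zF top)) t0.
  exists (fun g _ => b g).
    split; first exact: (smooth_comp (fun c (_ : Fp) => c) sb).
    by move=> g Ug; apply: funext => i; rewrite /= /diff /= subrr.
  move=> g h Ug Uh; apply: funext => i.
  rewrite (diff_const (top g h Ug Uh) i) /dM /=; have /= -> := eb g h Ug Uh; ring.
have [b sb eb] : B2 U (fun g h => iter k.+1 D (F g h) 0%R).
  exact/(tr0 htr (Z2M_top zF top)).
(* Lifts a cochain from the top quotient to the module, by the binomial of degree k + 1. *)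
pose lift (e : G -> Fp) g (i : Fp) := (e g * binf k.+1 i)%R.
have slift e : smooth U e -> smooth U (lift e).
  by move=> se; apply: (smooth_comp (fun c i => c * binf k.+1 i)%R se).
have lift_top e g : iter k.+1 D (lift e g) = fun=> e g.
  by rewrite iter_diff_scale iter_diff_binf0 //; apply: funext => i; rewrite mulr1.
have main e : smooth U e ->
    (forall g h, U g -> U h -> iter k.+1 D (F g h) 0%R = e g + e h - e (g * h)%g)%R ->
    let F' := fun g h i => (F g h i - dM (lift e) g h i)%R in
    Z2M F' /\ forall g h, U g -> U h -> iter k.+1 D (F' g h) = fun=> 0%R.
  move=> se ee F'; split; first by apply: Z2M_sub => //; apply/dM_Z2M/slift.
  move=> g h Ug Uh; rewrite /F' iter_diff_sub iter_diff_dM; apply: funext => i.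
  rewrite (iter_diff_const _ (top g h Ug Uh)) ee // /dM !lift_top; ring.
have [zF1 top1] := main b sb eb.
(* The primitive [b] of the top class is determined only up to a character [y] of [U]. Adding [y] to
   it subtracts chi cup y from the next top class, and [y] is chosen to make the trace of the latter
   0. *)
have [y hy ty] := cp_surj cG U_open htr hchi chi_nz (Z2M_top zF1 top1).
pose e := (fun g => b g + y g)%R.
have se : smooth U e by exact: (smooth_op (fun u v => u + v)%R sb hy.1).
have ee g h : U g -> U h ->
    iter k.+1 D (F g h) 0%R = (e g + e h - e (g * h)%g)%R.
  by move=> Ug Uh; rewrite eb // /e hy.2 //; ring.
have [zF2 top2] := main e se ee.
have [|B [sB topB] eB] := IH _ (ltnW kp) zF2 top2.
  have -> : (fun g h => iter k D (fun i => F g h i - dM (lift e) g h i)%R 0%R) =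
            (fun g h => iter k D (fun i => F g h i - dM (lift b) g h i)%R 0%R
                - iter k D (dM (lift y) g h) 0%R)%R.
    apply: funext => g; apply: funext => h.
    rewrite !iter_diff_sub !iter_diff_dM /dM.
    have l u : iter k D (lift e u) =
        (fun i => iter k D (lift b u) i + iter k D (lift y u) i)%R.
      rewrite -iter_diff_add; congr (iter _ _ _); apply: funext => i.
      by rewrite /lift /e mulrDl.
    rewrite !l; ring.
  have zcp : Z2 U (cp chi y) by exact: cp_Z2.
  have ecp g h : U g -> U h -> iter k D (dM (lift y) g h) 0%R = cp chi y g h.
    move=> Ug Uh; rewrite iter_diff_dM /dM.
    have l u : iter k D (lift y u) = (fun i => y u * i)%R.
      rewrite iter_diff_scale -[k.+1]addn1 iter_diff_binf ?addn1 //.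
      by apply: funext => i; rewrite /binf bin1 Fp_natK.
    by rewrite !l /cp hy.2 //; ring.
  have zy : Z2 U (fun g h => iter k D (dM (lift y) g h) 0%R).
    split; last first.
      by move=> u v w Uu Uv Uw; rewrite !ecp ?zcp.2 //; exact: (osubM U_open).
    apply: (smooth2_comp (fun m : Fp -> Fp => iter k D m 0%R)).
    by apply: dM_smooth; apply: slift; exact: hy.1.
  have -> : (fun g h => iter k D (fun i => F g h i - dM (lift b) g h i)%R 0%R
                - iter k D (dM (lift y) g h) 0%R)%R =
            (fun g h => -1 * iter k D (dM (lift y) g h) 0%R +
               iter k D (fun i => F g h i - dM (lift b) g h i)%R 0%R)%R.
    by apply: funext => g; apply: funext => h; rewrite mulN1r addrC.
  rewrite (trL htr) //; last exact: Z2M_top.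
  by rewrite -ty (tr_ext cG U_open htr zy zcp ecp) mulN1r addNr.
exists (fun g i => B g i + lift e g i)%R.
  split.
    exact: (smooth_op (fun (m m' : Fp -> Fp) i => m i + m' i)%R sB (slift _ se)).
  move=> g Ug; rewrite iter_diff_add iterS topB //.
  rewrite [iter k.+2 D (lift e g)]iterS lift_top; apply: funext => i.
  by rewrite /diff /= !subrr addr0.
move=> g h Ug Uh; apply: funext => i; have := congr1 (@^~ i) (eB g h Ug Uh).
by move=> /= e1; rewrite -[LHS](subrK (dM (lift e) g h i)) e1 /dM; ring.
Qed.

End IndexStep.

(** * Shapiro's lemma and corestriction from the kernel of a character *)

Section IndexStepTransfer.
Variables (p : nat) (p_pr : prime p) (G : topGroupType).
Hypothesis cG : compact [set: G].
Local Notation Fp := 'F_p.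
Local Notation D := (@diff p).
Variables (U : set G) (tr : (G -> G -> Fp) -> Fp) (chi : G -> Fp) (s : G).
Hypotheses (U_open : open_subgroup U) (htr : pd_trace U tr).
Hypotheses (hchi : hom1 U chi) (Us : U s) (chis : chi s = 1%R).
Local Notation Z1M := (Z1M U chi).
Local Notation Z2M := (Z2M U chi).
Local Notation dM := (dM chi).

Definition chi_ker : set G := [set g | U g /\ chi g = 0%R].
Local Notation V := chi_ker.

(* The cocycle G -> V of the transversal (s^i): it carries cochains on V to cochains
   on U with coefficients in the coinduced module (Shapiro). *)
Definition coset_cocycle (i : Fp) (g : G) : G :=
  (s ^+ (i : nat) * g * s ^- ((i + chi g)%R : nat))%g.
Local Notation a := coset_cocycle.

Lemma chi_ker_sub : V `<=` U. Proof. by move=> g []. Qed.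

Lemma chi_pow n : chi (s ^+ n)%g = (n%:R)%R.
Proof. by rewrite (hom1X U_open) // chis. Qed.

Lemma chi_ker_open : open_subgroup V.
Proof.
have sV : subgroup V.
  split=> [|x y [Ux cx] [Uy cy]|x [Ux cx]].
  - by split; [exact: osub1 | exact: (hom1_1 U_open)].
  - by split; [exact: osubM | rewrite hchi.2 // cx cy addr0].
  - by split; [exact: osubV | rewrite (hom1V U_open) // cx oppr0].
split=> //; apply: open_subgroup_nbhs => //.
have [[N [[oN [[N1 _ _] _]] NU] h] _] := hchi.
have nN : nbhs (1%g : G) N by exact: open_nbhs_nbhs.
apply: (@filterS _ _ (nbhs_filter (1%g : G)) _ _ _ nN) => n Nn; split; first exact: NU.
have := h 1%g n (osub1 U_open) Nn; rewrite mul1g => ->.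
exact: (hom1_1 U_open).
Qed.
Let V_open := chi_ker_open.

Lemma coset_cocycle_in i g : U g -> V (a i g).
Proof.
move=> Ug; rewrite /a; split.
  by apply: osubM => //; [apply: osubM => //; exact: osubX | apply: osubV => //; exact: osubX].
rewrite !hchi.2 //; last 3 first.
- exact: osubX.
- by apply: osubM => //; exact: osubX.
- by apply: osubV => //; exact: osubX.
rewrite (hom1V U_open) //; last exact: osubX.
by rewrite !chi_pow !Fp_natK subrr.
Qed.

Lemma coset_cocycleM i g h : U g -> U h -> a i (g * h)%g = (a i g * a (i + chi g)%R h)%g.
Proof. by move=> Ug Uh; rewrite /a hchi.2 // addrA !mulgA mulgKV. Qed.

Lemma coset_cocycle0 u : V u -> a 0%R u = u.
Proof. by move=> [Uu cu]; rewrite /a cu addr0 /= expg0 mul1g invg1 mulg1. Qed.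

Lemma coset_cocycle_normal N i n : opn N -> N `<=` V -> N n -> N (a i n).
Proof.
move=> [oN [_ NJ]] NV Nn; rewrite /a (NV _ Nn).2 addr0.
by rewrite -[X in (X * n)%g]invgK -mulgA; exact: NJ.
Qed.

Lemma smooth_ind (X : Type) (x : G -> X) : smooth V x -> smooth U (fun g i => x (a i g)).
Proof.
move=> [N [oN NV] h]; exists N; first by split=> // y /NV; exact: chi_ker_sub.
move=> g n Ug Nn; apply: funext => i; rewrite coset_cocycleM //; last exact: (NV _ Nn).1.
by apply: h; [exact: coset_cocycle_in | exact: coset_cocycle_normal].
Qed.

Definition ind2 (f : G -> G -> Fp) : G -> G -> Fp -> Fp :=
  fun g h i => f (a i g) (a (i + chi g)%R h).

Lemma smooth_ind2 (f : G -> G -> Fp) : smooth2 V f -> smooth2 U (ind2 f).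
Proof.
move=> [N [oN NV] h]; exists N; first by split=> // y /NV; exact: chi_ker_sub.
move=> g k m n Ug Uk Nm Nn; apply: funext => i; rewrite /ind2.
have [Um cm] := NV _ Nm; have [Un cn] := NV _ Nn.
rewrite hchi.2 // cm addr0 !coset_cocycleM //.
by apply: h; [exact: coset_cocycle_in.. | exact: coset_cocycle_normal | exact: coset_cocycle_normal].
Qed.

Lemma smooth_res (X : Type) (x : G -> X) : smooth U x -> smooth V x.
Proof.
move=> [N [oN NU] h]; have [M oM MV] := opn_core cG V_open.1 V_open.2.
exists (N `&` M); first by split; [exact: opnI | move=> y [_ /MV]].
by move=> g n [Ug _] [Nn _]; exact: h.
Qed.

Lemma hom1_res (x : G -> Fp) : hom1 U x -> hom1 V x.
Proof. by move=> [sx xM]; split=> [|g h [Ug _] [Uh _]]; [exact: smooth_res | exact: xM]. Qed.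

Lemma ind2_Z2M (f : G -> G -> Fp) : Z2 V f -> Z2M (ind2 f).
Proof.
move=> [sf cf]; split; first exact: smooth_ind2.
move=> g h k Ug Uh Uk i; rewrite /ind2 !coset_cocycleM // hchi.2 // addrA.
by apply: cf; exact: coset_cocycle_in.
Qed.

Lemma Z2M_sum F : Z2M F -> Z2 U (fun g h => \sum_i F g h i)%R.
Proof.
move=> [sF cF]; split; first exact: (smooth2_comp (fun m : Fp -> Fp => \sum_i m i)%R).
move=> x y z Ux Uy Uz; rewrite -(sum_Fp_shift (F y z) (chi x)) -!sumrB -big_split /= -sumrB.
by apply: big1 => i _; exact: cF.
Qed.

(** Summing the values of the induced cocycle [ind2 f] is corestriction; so this is the trace of [U]
    after corestriction. *)
Definition tr_ker (f : G -> G -> Fp) : Fp := tr (fun g h => \sum_i ind2 f g h i)%R.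

(** The functions on F_p are the whole kernel of diff^p, with summation as projection to the top
    quotient. Trace 0 therefore makes the induced cocycle a coboundary in the module, and evaluation
    at 0 brings its primitive back to [V]. *)
Lemma tr_ker_eq0 (f : G -> G -> Fp) : Z2 V f -> (tr_ker f = 0%R <-> B2 V f).
Proof.
move=> zf; have p1 : (p.-1 < p)%N by rewrite prednK ?prime_gt0.
split=> [t0|[b sb eb]].
  have top g h : U g -> U h -> iter p.-1.+1 D (ind2 f g h) = fun=> 0%R.
    by move=> _ _; rewrite prednK ?prime_gt0 // iter_diff_p.
  have t1 : tr (fun g h => iter p.-1 D (ind2 f g h) 0%R) = 0%R.
    rewrite -[RHS]t0 /tr_ker; congr tr; apply: funext => g; apply: funext => h.
    by rewrite iter_diff_pred.
  have [B [sB _] eB] :=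
    Z2M_trace_eq0 p_pr cG U_open htr hchi Us chis p1 (ind2_Z2M zf) top t1.
  exists (fun u => B u 0%R); first exact/smooth_res/(smooth_comp (fun m : Fp -> Fp => m 0%R) sB).
  move=> g h Vg Vh; have := congr1 (@^~ 0%R) (eB g h Vg.1 Vh.1).
  by rewrite /ind2 /dM !Vg.2 !addr0 !coset_cocycle0 // => ->; ring.
apply/(tr0 htr); first exact/Z2M_sum/ind2_Z2M.
exists (fun g => \sum_i b (a i g))%R.
  exact: (smooth_comp (fun m : Fp -> Fp => \sum_i m i)%R (smooth_ind sb)).
move=> g h Ug Uh; rewrite -[X in (_ + X - _)%R](sum_Fp_shift _ (chi g)).
rewrite -big_split -sumrB /=; apply: eq_bigr => i _.
by rewrite /ind2 eb ?coset_cocycleM //; exact: coset_cocycle_in.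
Qed.

Lemma tr_kerL c f f' : Z2 V f -> Z2 V f' ->
  tr_ker (fun g h => c * f g h + f' g h)%R = (c * tr_ker f + tr_ker f')%R.
Proof.
move=> zf zf'; rewrite /tr_ker -(trL htr); [|exact/Z2M_sum/ind2_Z2M..].
congr tr; apply: funext => g; apply: funext => h.
by rewrite big_distrr -big_split.
Qed.

Lemma tr_ker_ext f f' : Z2 V f -> Z2 V f' ->
  (forall g h, V g -> V h -> f g h = f' g h) -> tr_ker f = tr_ker f'.
Proof.
move=> zf zf' e; apply: (tr_ext cG U_open htr); [exact/Z2M_sum/ind2_Z2M..|].
move=> g h Ug Uh; apply: eq_bigr => i _.
by apply: e; exact: coset_cocycle_in.
Qed.

(** Cup product followed by the invariant pairing on functions on F_p, the sum of the products of
    values. *)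
Definition prM (X Y : G -> Fp -> Fp) : G -> G -> Fp :=
  fun g h => (\sum_i X g i * Y h (i + chi g))%R.

Lemma prM_Z2 X Y : Z1M X -> Z1M Y -> Z2 U (prM X Y).
Proof.
move=> [sX cX] [sY cY].
apply: (@Z2M_sum (fun g h i => X g i * Y h (i + chi g))%R); split.
  have h1 := smooth2_op (fun (c : Fp) (m : Fp -> Fp) i => m (i + c)%R)
    (smooth2_l hchi.1) (smooth2_r sY).
  exact: (smooth2_op (fun (m m' : Fp -> Fp) i => m i * m' i)%R (smooth2_l sX) h1).
move=> g h k Ug Uh Uk i; rewrite cX // cY // hchi.2 // !addrA; ring.
Qed.

Definition d0M (t : Fp -> Fp) : G -> Fp -> Fp := fun g i => (t (i + chi g) - t i)%R.

Lemma smooth_sumM (X : G -> Fp -> Fp) (t : Fp -> Fp) : smooth U X ->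
  smooth U (fun g => \sum_i X g i * t (i + chi g))%R.
Proof.
move=> sX; exact: (smooth_op (fun (m : Fp -> Fp) (c : Fp) => \sum_i m i * t (i + c))%R sX hchi.1).
Qed.

Lemma prM_d0r X t : Z1M X -> B2 U (prM X (d0M t)).
Proof.
move=> [sX cX]; exists (fun g => - (\sum_i X g i * t (i + chi g)))%R.
  exact: (smooth_comp (fun c => - c)%R (smooth_sumM t sX)).
move=> g h Ug Uh.
have -> : (\sum_i X (g * h)%g i * t (i + chi (g * h)%g) =
  \sum_i X g i * t (i + chi g + chi h) + \sum_i X h i * t (i + chi h))%R.
  rewrite -[X in (_ = _ + X)%R](sum_Fp_shift _ (chi g)) -big_split /=.
  by apply: eq_bigr => i _; rewrite cX // hchi.2 // addrA mulrDl.
have -> : prM X (d0M t) g h =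
  (\sum_i X g i * t (i + chi g + chi h)%R - \sum_i X g i * t (i + chi g)%R)%R.
  by rewrite -sumrB; apply: eq_bigr => i _; rewrite /d0M mulrBr.
ring.
Qed.

Lemma prM_d0l Y t : Z1M Y -> B2 U (prM (d0M t) Y).
Proof.
move=> [sY cY]; exists (fun g => \sum_i t i * Y g i)%R.
  exact: (smooth_comp (fun m : Fp -> Fp => \sum_i t i * m i)%R sY).
move=> g h Ug Uh; rewrite -(sum_Fp_shift (fun i => t i * Y h i)%R (chi g)).
have -> : (\sum_i t i * Y (g * h)%g i =
           \sum_i t i * Y g i + \sum_i t i * Y h (i + chi g)%R)%R.
  by rewrite -big_split; apply: eq_bigr => i _; rewrite cY // mulrDr.
have -> : prM (d0M t) Y g h = (\sum_i t (i + chi g)%R * Y h (i + chi g)%R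
                               - \sum_i t i * Y h (i + chi g)%R)%R.
  by rewrite -sumrB; apply: eq_bigr => i _; rewrite /d0M mulrBl.
ring.
Qed.

(** Apply the cocycle identity to both sides of a i g * s^(i + chi g) = s^i * g and evaluate at 0.
    The last two terms are the coboundary of a 0-cochain: a module-valued cocycle is cohomologous to
    the one induced from its restriction to [V]. *)
Lemma Z1M_coset Y i g : Z1M Y -> U g ->
  Y (a i g) 0%R = (Y g i + Y (s ^+ (i : nat))%g 0 - Y (s ^+ ((i + chi g)%R : nat))%g 0)%R.
Proof.
move=> [sY cY] Ug.
have Usn n : U (s ^+ n)%g by exact: osubX.
have e : (a i g * s ^+ ((i + chi g)%R : nat) = s ^+ (i : nat) * g)%g.
  by rewrite /a mulgKV.
have := congr1 (fun x => Y x 0%R) e.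
have [Ua ca] := coset_cocycle_in i Ug.
rewrite cY // [X in _ = X -> _]cY // ca chi_pow Fp_natK addr0 add0r => e'.
by rewrite -[LHS](addrK (Y (s ^+ ((i + chi g)%R : nat))%g 0%R)) e'; ring.
Qed.

Lemma Z1M_ind (x : G -> Fp) : hom1 V x -> Z1M (fun g i => x (a i g)).
Proof.
move=> [sx xM]; split; first exact: smooth_ind.
by move=> g h Ug Uh i; rewrite coset_cocycleM // xM //; exact: coset_cocycle_in.
Qed.

Lemma Z1M_res X : Z1M X -> hom1 V (fun u => X u 0%R).
Proof.
move=> [sX cX]; split.
  exact/smooth_res/(smooth_comp (fun m : Fp -> Fp => m 0%R) sX).
by move=> g h [Ug cg] [Uh ch]; rewrite cX // cg addr0.
Qed.

(** Any module-valued cocycles restricting to [x] and [y] compute the trace of their cup product,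
    since replacing them by the induced ones changes [prM] by coboundaries. The projection formulas
    below are special choices of [X] and [Y]. *)
Lemma tr_ker_prM x y X Y : Z1M X -> Z1M Y ->
  (forall u, V u -> x u = X u 0%R) -> (forall u, V u -> y u = Y u 0%R) ->
  tr_ker (cp x y) = tr (prM X Y).
Proof.
move=> zX zY ex ey.
pose indX (X : G -> Fp -> Fp) g i := X (a i g) 0%R.
have zI Z : Z1M Z -> Z1M (indX Z) by move=> zZ; exact: (Z1M_ind (Z1M_res zZ)).
pose th (Z : G -> Fp -> Fp) i := (- Z (s ^+ ((i : Fp) : nat))%g 0)%R.
have eI Z g i : Z1M Z -> U g -> indX Z g i = (Z g i + d0M (th Z) g i)%R.
  by move=> zZ Ug; rewrite /indX Z1M_coset // /d0M /th; ring.
have -> : tr_ker (cp x y) = tr (prM (indX X) (indX Y)).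
  apply: (tr_ext cG U_open htr).
  - apply: Z2M_sum; apply: ind2_Z2M.
    have hx := Z1M_res zX; have hy := Z1M_res zY.
    have [s2 c2] := cp_Z2 hx hy; split.
      have [N oN hN] := s2; exists N => // g h m n Vg Vh Nm Nn.
      have NV := oN.2.
      by rewrite /cp !ex ?ey //; [exact: hN | apply: (osubM V_open) => //; exact: NV..].
    move=> u v w Vu Vv Vw; rewrite /cp !ex ?ey //;
      by [exact: c2 | exact: (osubM V_open)].
  - exact: prM_Z2 (zI _ zX) (zI _ zY).
  move=> g h Ug Uh; apply: eq_bigr => i _.
  by rewrite /ind2 /cp ex ?ey //; exact: coset_cocycle_in.
transitivity (tr (prM X (indX Y))).
  apply: (tr_eq htr); [exact: prM_Z2 (zI _ zX) (zI _ zY) | exact: prM_Z2 zX (zI _ zY)|].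
  apply: B2_ext (prM_d0l (th X) (zI _ zY)) => g h Ug Uh.
  by rewrite /prM -sumrB; apply: eq_bigr => i _; rewrite (eI X) //; ring.
apply: (tr_eq htr); [exact: prM_Z2 zX (zI _ zY) | exact: prM_Z2 zX zY|].
apply: B2_ext (prM_d0r (th Y) zX) => g h Ug Uh.
by rewrite /prM -sumrB; apply: eq_bigr => i _; rewrite (eI Y) //; ring.
Qed.

Lemma Z1M_const y : hom1 U y -> Z1M (fun g _ => y g).
Proof.
move=> [sy yM]; split; first exact: (smooth_comp (fun c (_ : Fp) => c) sy).
by move=> g h Ug Uh i; exact: yM.
Qed.

Definition cor1 (x : G -> Fp) : G -> Fp := fun g => (\sum_i x (a i g))%R.

Lemma Z1M_sum X : Z1M X -> hom1 U (fun g => \sum_i X g i)%R.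
Proof.
move=> [sX cX]; split; first exact: (smooth_comp (fun m : Fp -> Fp => \sum_i m i)%R sX).
move=> g h Ug Uh; rewrite -(sum_Fp_shift (X h) (chi g)) -big_split.
by apply: eq_bigr => i _; rewrite cX.
Qed.

(** Projection formula: cor(x cup res y) = cor x cup y. *)
Lemma tr_ker_cor1 (x y : G -> Fp) : hom1 V x -> hom1 U y -> tr_ker (cp x y) = tr (cp (cor1 x) y).
Proof.
move=> hx hy; rewrite (tr_ker_prM (Z1M_ind hx) (Z1M_const hy)) //.
  by congr tr; apply: funext => g; apply: funext => h; rewrite /prM /cp -big_distrl.
by move=> u Vu; rewrite coset_cocycle0.
Qed.

Lemma tr_ker_sum x Y : hom1 U x -> Z1M Y ->
  tr_ker (cp x (fun u => Y u 0%R)) = tr (cp x (fun g => \sum_i Y g i)%R).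
Proof.
move=> hx zY; rewrite (tr_ker_prM (Z1M_const hx) zY) //.
congr tr; apply: funext => g; apply: funext => h.
by rewrite /prM /cp -(sum_Fp_shift (Y h) (chi g)) big_distrr.
Qed.

(** The obstruction to lifting [y] from the top quotient is its image under the connecting map,
    which is chi cup y. *)
Lemma Z1M_lift k y : (k.+1 < p)%N -> hom1 U y -> tr (cp chi y) = 0%R ->
  exists2 Y, Z1M Y /\ (forall g, U g -> iter k.+2 D (Y g) = fun=> 0%R) &
    forall g, U g -> iter k.+1 D (Y g) = fun=> y g.
Proof.
move=> kp hy t0.
pose Y0 g (i : Fp) := (y g * binf k.+1 i)%R.
have sY0 : smooth U Y0 by apply: (smooth_comp (fun c i => c * binf k.+1 i)%R hy.1).
have top0 g : iter k.+1 D (Y0 g) = fun=> y g.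
  by rewrite iter_diff_scale iter_diff_binf0 //; apply: funext => i; rewrite mulr1.
have top1 g h : U g -> U h -> iter k.+1 D (dM Y0 g h) = fun=> 0%R.
  move=> Ug Uh; rewrite iter_diff_dM; apply: funext => i.
  by rewrite /dM !top0 hy.2 //; ring.
have ecp g h : U g -> U h -> iter k D (dM Y0 g h) 0%R = cp chi y g h.
  move=> Ug Uh; rewrite iter_diff_dM /dM.
  have l u : iter k D (Y0 u) = (fun i => y u * i)%R.
    rewrite iter_diff_scale -[k.+1]addn1 iter_diff_binf ?addn1 //.
    by apply: funext => i; rewrite /binf bin1 Fp_natK.
  by rewrite !l /cp hy.2 //; ring.
have zY0 := dM_Z2M U_open hchi sY0.
have t1 : tr (fun g h => iter k D (dM Y0 g h) 0%R) = 0%R.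
  rewrite -[RHS]t0; apply: (tr_ext cG U_open htr _ _ ecp); last exact: cp_Z2.
  exact: Z2M_top zY0 top1.
have [B [sB topB] eB] :=
  Z2M_trace_eq0 p_pr cG U_open htr hchi Us chis (ltnW kp) zY0 top1 t1.
exists (fun g i => Y0 g i - B g i)%R; last first.
  by move=> g Ug; rewrite iter_diff_sub top0 topB //; apply: funext => i; rewrite subr0.
split; last first.
  move=> g Ug; rewrite iterS iter_diff_sub top0 topB //; apply: funext => i.
  by rewrite /diff !subr0 subrr.
split; first exact: (smooth_op (fun (m m' : Fp -> Fp) i => m i - m' i)%R sY0 sB).
move=> g h Ug Uh i; have := congr1 (@^~ i) (eB g h Ug Uh); rewrite /dM => e.
set A := Y0 (g * h)%g i in e *; set B' := B (g * h)%g i in e *.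
rewrite -[LHS]addr0 -(subrr (Y0 h (i + chi g) - A + Y0 g i)%R) {2}e; ring.
Qed.

Definition conj1 (x : G -> Fp) : G -> Fp := fun u => x (s * u * s^-1)%g.
Definition dconj (x : G -> Fp) : G -> Fp := fun u => (conj1 x u - x u)%R.

Lemma conj_ker u : V u -> V (s * u * s^-1)%g.
Proof.
move=> [Uu cu]; have UsV := osubV U_open Us; split.
  by apply: osubM => //; exact: osubM.
rewrite !hchi.2 //; last exact: osubM.
by rewrite cu (hom1V U_open) // addr0 subrr.
Qed.

Lemma smooth_conj (X : Type) (x : G -> X) : smooth V x -> smooth V (fun u => x (s * u * s^-1)%g).
Proof.
move=> [N [oN NV] h]; exists N => // g n Vg Nn.
have -> : (s * (g * n) * s^-1 = (s * g * s^-1) * (n ^ s^-1))%g.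
  by rewrite conjgE invgK !mulgA mulgKV.
by apply: h; [exact: conj_ker | case: oN => _ [_ NJ]; exact: NJ].
Qed.

Lemma conj1_hom (x : G -> Fp) : hom1 V x -> hom1 V (conj1 x).
Proof.
move=> [sx xM]; split; first exact: smooth_conj.
move=> g h Vg Vh; rewrite /conj1 -xM; [|exact: conj_ker..].
by congr x; rewrite !mulgA mulgKV.
Qed.

Lemma dconj_hom (x : G -> Fp) : hom1 V x -> hom1 V (dconj x).
Proof.
move=> hx; have [P0 PD] := lin_closed_hom1 p cG V_open.
have -> : dconj x = (fun u => -1 * x u + conj1 x u)%R.
  by apply: funext => u; rewrite mulN1r addrC.
by apply: PD => //; exact: conj1_hom.
Qed.

Lemma coset_cocycle1 u : V u -> a 1%R u = (s * u * s^-1)%g.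
Proof.
move=> [Uu cu]; rewrite /a cu addr0.
have -> : ((1%R : Fp) : nat) = 1%N by exact: (Fp_nat_val p_pr (prime_gt1 p_pr)).
by rewrite expg1.
Qed.

Lemma Z1M_shift X : Z1M X -> Z1M (fun g i => X g (i + 1)%R).
Proof.
move=> [sX cX]; split; first exact: (smooth_comp (fun (m : Fp -> Fp) i => m (i + 1)%R) sX).
by move=> g h Ug Uh i; rewrite cX // addrAC.
Qed.

(** Conjugation by [s] translates the argument in F_p by 1, which only permutes the terms of the sum
    in the pairing. *)
Lemma tr_ker_conj (x y : G -> Fp) : hom1 V x -> hom1 V y ->
  tr_ker (cp (conj1 x) (conj1 y)) = tr_ker (cp x y).
Proof.
move=> hx hy; have zX := Z1M_ind hx; have zY := Z1M_ind hy.
have e (z : G -> Fp) u : V u -> z (s * u * s^-1)%g = z (a (0 + 1)%R u).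
  by move=> Vu; rewrite add0r coset_cocycle1.
rewrite (tr_ker_prM (Z1M_shift zX) (Z1M_shift zY)); [|by move=> u Vu; rewrite /conj1 e..].
rewrite (tr_ker_prM zX zY); [|by move=> u Vu; rewrite coset_cocycle0..].
congr tr; apply: funext => g; apply: funext => h.
rewrite /prM -(sum_Fp_shift (fun i => x (a i g) * y (a (i + chi g) h))%R 1%R).
by apply: eq_bigr => i _; rewrite addrAC.
Qed.

End IndexStepTransfer.

(** * Nondegeneracy of the cup product on the kernel *)

Section IndexStepDuality.
Variables (p : nat) (p_pr : prime p) (G : topGroupType).
Hypothesis cG : compact [set: G].
Local Notation Fp := 'F_p.
Local Notation D := (@diff p).
Variables (U : set G) (tr : (G -> G -> Fp) -> Fp) (chi : G -> Fp) (s : G).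
Hypotheses (U_open : open_subgroup U) (htr : pd_trace U tr).
Hypotheses (hchi : hom1 U chi) (Us : U s) (chis : chi s = 1%R).
Local Notation Z1M := (Z1M U chi).
Local Notation V := (chi_ker U chi).
Local Notation a := (coset_cocycle chi s).
Local Notation trV := (tr_ker tr chi s).
Local Notation conj1 := (conj1 s).
Local Notation dconj := (dconj s).

Let V_open : open_subgroup V := chi_ker_open U_open hchi.
Let UPL := lin_closed_hom1 p cG U_open.

Definition cup_radical (x : G -> Fp) : Prop :=
  hom1 V x /\ forall y : G -> Fp, hom1 V y -> trV (cp x y) = 0%R.

Lemma tr_ker_lin (y : G -> Fp) : hom1 V y -> lin_fun (hom1 V) (fun x => trV (cp x y)).
Proof.
move=> hy c x z hx hz; rewrite -(tr_kerL U_open htr hchi Us chis); [|exact: cp_Z2..].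
by congr trV; apply: funext => g; apply: funext => h; rewrite /cp; ring.
Qed.

Lemma cup_radical_conj x : cup_radical x -> cup_radical (conj1 x).
Proof.
move=> [hx rx]; split; first exact: (conj1_hom U_open).
move=> y hy.
pose y' u := y (s^-1 * u * s)%g.
have UsV := osubV U_open Us.
have VJ u : V u -> V (s^-1 * u * s)%g.
  move=> [Uu cu]; split; first by apply: osubM => //; exact: osubM.
  rewrite !hchi.2 //; last exact: osubM.
  by rewrite cu (hom1V U_open) // addr0 addNr.
have hy' : hom1 V y'.
  split.
    have [N [oN NV] h] := hy.1; exists N => // g n Vg Nn; rewrite /y'.
    have -> : (s^-1 * (g * n) * s = (s^-1 * g * s) * (n ^ s))%g.
      by rewrite conjgE !mulgA mulgK.
    by apply: h; [exact: VJ | case: oN => _ [_ NJ]; exact: NJ].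
  move=> g h Vg Vh; rewrite /y' -hy.2; [|exact: VJ..].
  by congr y; rewrite !mulgA mulgK.
have -> : y = conj1 y' by apply: funext => u; rewrite /conj1 /y' !mulgA mulVg mul1g mulgKV.
by rewrite (tr_ker_conj p_pr cG U_open htr hchi Us chis) // rx.
Qed.

Lemma cup_radical_dconj x : cup_radical x -> cup_radical (dconj x).
Proof.
move=> rx; have [hx r1] := rx; have [hx' r2] := cup_radical_conj rx.
split; first exact: (dconj_hom cG U_open).
move=> y hy.
have -> : dconj x = (fun u => -1 * x u + conj1 x u)%R.
  by apply: funext => u; rewrite mulN1r addrC.
by rewrite (tr_ker_lin hy) // r1 // r2 // mulr0 addr0.
Qed.

Lemma coset_cocycle_s i : V (s ^+ p)%g -> a 1%R (s ^+ ((i : Fp) : nat))%g = 1%g \/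
  a 1%R (s ^+ ((i : Fp) : nat))%g = (s ^+ p)%g.
Proof.
move=> _; rewrite /coset_cocycle (chi_pow U_open) // Fp_natK.
have -> : ((1%R : Fp) : nat) = 1%N by exact: (Fp_nat_val p_pr (prime_gt1 p_pr)).
have -> : (1 + i = (i : nat).+1%:R)%R by rewrite -natr1 Fp_natK addrC.
rewrite expg1 -expgS.
have [ip|ip] := ltnP (i : nat).+1 p.
  by left; rewrite Fp_nat_val // mulgV.
have e : (i : nat).+1 = p by apply/eqP; rewrite eqn_leq ip ltn_Fp.
by right; rewrite e (Fp_pnat0 p_pr) /= invg1 mulg1.
Qed.

(** The transfer of [s] is s^p: all factors are trivial except the one that wraps around at i = p -
    1. *)
Lemma cor1_s (x : G -> Fp) : hom1 V x -> cor1 chi s x s = x (s ^+ p)%g.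
Proof.
move=> hx; rewrite /cor1 Fp_sum //.
rewrite (sum_last (fun k => x (a k%:R%R s))) ?prime_gt0 //.
rewrite big1 ?add0r => [|j _].
  rewrite /coset_cocycle chis natr1 prednK ?prime_gt0 // Fp_pnat0 // invg1 mulg1.
  by rewrite Fp_nat_val ?prednK ?prime_gt0 // -expgSr prednK ?prime_gt0.
have jp := ltn_ord j; have p0 := prime_gt0 p_pr.
rewrite /coset_cocycle chis natr1 !Fp_nat_val //; [|lia..].
by rewrite -expgSr mulgV (hom1_1 V_open).
Qed.

Lemma s_pow_ker : V (s ^+ p)%g.
Proof. by split; [exact: osubX | rewrite (chi_pow U_open) // Fp_pnat0]. Qed.

(** An [s]-invariant character of [V] that vanishes at s^p extends to [U]: the induced cocycle is
    constant along F_p, and its value is the extension. *)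
Lemma ind_invariant (x : G -> Fp) g i : hom1 V x -> x (s ^+ p)%g = 0%R ->
  (forall u, V u -> conj1 x u = x u) -> U g -> x (a i g) = x (a 0%R g).
Proof.
move=> hx xp inv Ug; have zX := Z1M_ind U_open hchi Us chis hx.
have zS := Z1M_shift zX.
have x1 j : x (a 1%R (s ^+ ((j : Fp) : nat))%g) = 0%R.
  have [->|->] := coset_cocycle_s j s_pow_ker; last by [].
  exact: (hom1_1 V_open).
have st j : x (a (j + 1)%R g) = x (a j g).
  have := Z1M_coset U_open hchi Us chis j zS Ug; cbv beta; rewrite !add0r !x1 subr0 addr0.
  have Va := coset_cocycle_in U_open hchi Us chis j Ug.
  rewrite (coset_cocycle1 p_pr s Va) => <-; exact: inv.
rewrite -(Fp_natK i); elim: (i : nat) => [//|k IH].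
by rewrite -natr1 st.
Qed.

Hypothesis nondeg : forall x : G -> Fp, hom1 U x -> nonzero_on U x ->
  exists2 y, hom1 U y & tr (cp x y) <> 0%R.

Lemma radical_U (x : G -> Fp) : hom1 U x -> (forall y, hom1 U y -> tr (cp x y) = 0%R) ->
  forall u, U u -> x u = 0%R.
Proof.
move=> hx r u Uu; apply/eqP; apply: contrapT => /negP nx.
have [|y hy] := nondeg hx; first by exists u.
by rewrite r.
Qed.

(** The corestriction of [x] is orthogonal to H^1(U), hence zero; its value at [s] is x(s^p), so [x]
    extends to a character x' of [U]. Any [y] orthogonal to chi is a corestriction from [V], whence
    x' is orthogonal to all such [y] and is a multiple of chi, which vanishes on [V]. *)
Lemma cup_radical_invariant x : cup_radical x -> (forall u, V u -> conj1 x u = x u) ->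
  forall u, V u -> x u = 0%R.
Proof.
move=> [hx rx] inv.
have zX := Z1M_ind U_open hchi Us chis hx.
have cor0 : forall u, U u -> cor1 chi s x u = 0%R.
  apply: radical_U; first exact: (Z1M_sum zX).
  move=> y hy; rewrite -(tr_ker_cor1 cG U_open htr hchi Us chis) // rx //.
  exact: (hom1_res cG U_open).
have xp : x (s ^+ p)%g = 0%R by rewrite -cor1_s // cor0.
pose x' g := x (a 0%R g).
have xinv g i : U g -> x (a i g) = x' g by move=> Ug; exact: ind_invariant.
have hx' : hom1 U x'.
  split; first exact: (smooth_comp (fun m : Fp -> Fp => m 0%R) zX.1).
  by move=> g h Ug Uh; have := zX.2 g h Ug Uh 0%R; rewrite /= (xinv h).
have x'V u : V u -> x' u = x u by move=> Vu; rewrite /x' (coset_cocycle0 _ Vu).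
have perp y : hom1 U y -> tr (cp chi y) = 0%R -> tr (cp x' y) = 0%R.
  move=> hy t0.
  have [Y zY eY] : exists2 Y, Z1M Y & forall g, U g -> (\sum_i Y g i)%R = y g.
    have [k ek] : exists k, p = k.+2 by exists p.-2; have := prime_gt1 p_pr; lia.
    have kp : (k.+1 < p)%N by rewrite ek.
    have [Y [zY _] eY] := Z1M_lift p_pr cG U_open htr hchi Us chis kp hy t0.
    exists Y => // g Ug; rewrite -(iter_diff_pred p_pr).
    have -> : p.-1 = k.+1 by rewrite ek.
    by rewrite eY.
  rewrite -[RHS](rx _ (Z1M_res cG U_open hchi zY)).
  have := tr_ker_sum cG U_open htr hchi Us chis hx' zY.
  have -> : trV (cp x' (fun u => Y u 0%R)) = trV (cp x (fun u => Y u 0%R)).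
    have hY := Z1M_res cG U_open hchi zY.
    apply: (tr_ker_ext cG U_open htr hchi Us chis).
    - exact: (cp_Z2 (hom1_res cG U_open hchi hx') hY).
    - exact: (cp_Z2 hx hY).
    by move=> g h Vg Vh; rewrite /cp x'V.
  move=> ->; apply: (tr_ext cG U_open htr); [exact: cp_Z2 | |].
    exact: cp_Z2 hx' (Z1M_sum zY).
  by move=> g h Ug Uh; rewrite /cp eY.
have [y0 hy0 ty0] := nondeg hchi (chi_nz Us chis).
pose c := (tr (cp x' y0) / tr (cp chi y0))%R.
have c0 : forall u, U u -> (- c * chi u + x' u = 0)%R.
  apply: radical_U; first exact: UPL.2.
  move=> y hy; pose t := (tr (cp chi y) / tr (cp chi y0))%R.
  have hz : hom1 U (fun g => - t * y0 g + y g)%R by exact: UPL.2.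
  have tz : tr (cp chi (fun g => - t * y0 g + y g)%R) = 0%R.
    rewrite (lin_fun_cpr htr hchi) // mulNr divfK ?addNr //; exact/eqP.
  have := perp _ hz tz; rewrite (lin_fun_cpr htr hx') // => e.
  rewrite (lin_fun_cpl htr hy) //.
  apply/eqP; rewrite addrC mulNr subr_eq0; apply/eqP.
  move/eqP: e; rewrite addrC mulNr subr_eq0 => /eqP ->.
  by rewrite /c /t; ring.
have c_0 : c = 0%R.
  have := c0 s Us; rewrite chis mulr1 /x' /coset_cocycle chis add0r expg0 mul1g.
  have -> : ((1%R : Fp) : nat) = 1%N by exact: (Fp_nat_val p_pr (prime_gt1 p_pr)).
  by rewrite expg1 mulgV (hom1_1 V_open) // addr0 => /eqP; rewrite oppr_eq0 => /eqP.
move=> u Vu; rewrite -x'V //; have := c0 u Vu.1.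
by rewrite c_0 oppr0 mul0r add0r.
Qed.

(** Along F_p conjugation by [s] is translation, so iterating sigma - 1 on characters of [V] is
    iterating finite differences. *)
Lemma iter_dconj n (x : G -> Fp) : hom1 V x ->
  hom1 V (iter n dconj x) /\
  forall u, V u -> forall i, iter n dconj x (a i u) = iter n D (fun i => x (a i u)) i.
Proof.
move=> hx; elim: n => [|n [IH1 IH2]]; first by [].
rewrite !iterS; split; first exact: (dconj_hom cG U_open).
move=> u Vu i; pose m := iter n D (fun j => x (a j u)).
transitivity (m (i + 1) - m i)%R; last by [].
rewrite /m -!IH2 // /dconj /conj1; congr (_ - _)%R.
set z := iter n dconj x in IH1 *.
have ap j : a j u = (s ^+ (j : nat) * u * s ^- (j : nat))%g.
  by rewrite /coset_cocycle Vu.2 addr0.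
have -> : (s * a i u * s^-1 = s ^+ (i : nat).+1 * u * s ^- (i : nat).+1)%g.
  by rewrite ap expgS invgM !mulgA.
have e : (i + 1 = (i : nat).+1%:R)%R by rewrite -natr1 Fp_natK.
have [ip|ip] := ltnP (i : nat).+1 p; first by rewrite ap e Fp_nat_val.
(* At the wrap-around, conjugation by s^p appears; it acts trivially on characters because s^p lies
   in [V]. *)
have ip' : (i : nat).+1 = p by apply/eqP; rewrite eqn_leq ip ltn_Fp.
rewrite e ip' Fp_pnat0 // (coset_cocycle0 _ Vu).
have Vp := s_pow_ker.
have VpV := osubV V_open Vp; have Vpu := osubM V_open Vp Vu.
rewrite (IH1.2 _ _ Vpu VpV) (IH1.2 _ _ Vp Vu).
by rewrite (hom1V V_open) //; ring.
Qed.

(** The radical of the cup product is stable under sigma - 1, which is nilpotent on characters of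
    [V]; a nonzero radical would contain a nonzero invariant character. *)
Lemma cup_nondegenerate_ker (x : G -> Fp) : hom1 V x -> nonzero_on V x ->
  exists2 y : G -> Fp, hom1 V y & trV (cp x y) <> 0%R.
Proof.
move=> hx [u Vu nx]; apply: contrapT => h.
have rx : cup_radical x.
  by split=> // y hy; apply: contrapT => ny; apply: h; exists y.
have claim n y : cup_radical y -> (forall u, V u -> iter n dconj y u = 0%R) ->
    forall u, V u -> y u = 0%R.
  elim: n y => [//|n IH] y ry yn; apply: cup_radical_invariant => // v Vv.
  apply/eqP; rewrite -subr_eq0; apply/eqP.
  apply: (IH _ (cup_radical_dconj ry)) Vv => w Vw.
  by rewrite -iterSr yn.
move/eqP: nx; apply; apply: (claim p) Vu => // v Vv.
by rewrite -[in LHS](coset_cocycle0 s Vv) (iter_dconj p hx).2 // iter_diff_p.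
Qed.

End IndexStepDuality.

(** * Growth of H^1 in a subgroup of index p *)

Section IndexStep.
Variables (p : nat) (p_pr : prime p) (G : topGroupType).
Hypothesis cG : compact [set: G].
Local Notation Fp := 'F_p.
Local Notation D := (@diff p).
Variables (U : set G) (tr : (G -> G -> Fp) -> Fp) (chi : G -> Fp) (s : G).
Hypotheses (U_open : open_subgroup U) (htr : pd_trace U tr).
Hypotheses (hchi : hom1 U chi) (Us : U s) (chis : chi s = 1%R).
Local Notation Z1M := (Z1M U chi).
Local Notation V := (chi_ker U chi).
Let V_open : open_subgroup V := chi_ker_open U_open hchi.
Let UPL := lin_closed_hom1 p cG U_open.

Lemma pd_trace_ker : pd_trace V (tr_ker tr chi s).
Proof.
split.
- by move=> c f f' zf zf'; exact: (tr_kerL U_open htr hchi Us chis).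
- by move=> f zf; exact: (tr_ker_eq0 p_pr cG U_open htr hchi Us chis).
case: htr => _ _ [h|h]; [left | right].
  move=> f zf; apply: h; apply: Z2M_sum; exact: ind2_Z2M.
exact: (cup_nondegenerate_ker p_pr cG U_open htr hchi Us chis h).
Qed.

(** Module-valued cocycles are written as functions on pairs so that [dimge] can count them. *)
Definition Z1_level (k : nat) (x : G * Fp -> Fp) : Prop :=
  Z1M (fun g i => x (g, i)) /\ forall g, U g -> iter k D (fun i => x (g, i)) = fun=> 0%R.

Lemma Z1_level_closed k : lin_closed (Z1_level k).
Proof.
split.
  split; last by move=> g Ug; rewrite iter_diff0.
  split; first exact: (smooth_cst cG U_open).
  by move=> g h Ug Uh i; rewrite addr0.
move=> c x y [[sx cx] tx] [[sy cy] ty]; split; last first.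
  by move=> g Ug; rewrite iter_diff_lin tx // ty //; apply: funext => i; rewrite mulr0 addr0.
split.
  exact: (smooth_op (fun (m m' : Fp -> Fp) i => c * m i + m' i)%R sx sy).
by move=> g h Ug Uh i; rewrite cx // cy // mulrDr addrACA.
Qed.

Let DU : set (G * Fp) := [set t | U t.1].

(** Each further level adds the characters orthogonal to chi, which are the ones that lift; they
    form at least a hyperplane. *)
Lemma dimge_level e k : dimge U (hom1 (p := p) U) e.+1 -> (k < p)%N ->
  dimge DU (Z1_level k.+1) (k * e + e.+1).
Proof.
move=> de; elim: k => [|k IH] kp.
  have f_lin : lin_map (fun (x : G -> Fp) (t : G * Fp) => x t.1) by [].
  apply: (dimge_inj f_lin UPL _ _ de).
    move=> x hx; split; first exact: (Z1M_const chi hx).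
    by move=> g Ug; apply: funext => i; rewrite /= /diff subrr.
  by move=> x hx x0 u Uu; exact: (x0 (u, 0%R)).
pose f (x : G * Fp -> Fp) (g : G) := iter k.+1 D (fun i => x (g, i)) 0%R.
have f_lin : lin_map f.
  by move=> c x y; apply: funext => g; rewrite /f iter_diff_lin.
have dQ := dimge_ker UPL (lin_fun_cpr htr hchi) de.
have -> : (k.+1 * e + e.+1 = (k * e + e.+1) + e)%N by rewrite mulSn; lia.
apply: (dimge_extension f_lin _ _ dQ).
- move=> x x0 g Ug; rewrite /f.
  have -> : (fun i => x (g, i)) = fun=> 0%R by apply: funext => i; exact: x0.
  by rewrite iter_diff0.
- apply: dimge_sub (IH (ltnW kp)) => x [zx tx]; split; last by move=> g Ug; rewrite /f tx.
  split=> // g Ug; rewrite iterS tx //; apply: funext => i; by rewrite /diff subrr.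
move=> y [hy ty].
have [Y [zY tY] eY] := Z1M_lift p_pr cG U_open htr hchi Us chis kp hy ty.
exists (fun t => Y t.1 t.2); first by split.
by move=> g Ug; exact: (congr1 (@^~ 0%R) (eY g Ug)).
Qed.

(** Prescribing X(s, k) = 0 for k < p - 1 removes the coboundaries, after which restriction to [V]
    is injective by Shapiro. The count is (p - 1)(e + 1) + (e + 2) - (p - 1) = p e + 2. *)
Lemma dimge_ker_step e : dimge U (hom1 (p := p) U) e.+2 -> dimge V (hom1 (p := p) V) (p * e + 2).
Proof.
move=> de; have p0 := prime_gt0 p_pr.
have pp : (p.-1 < p)%N by rewrite prednK.
have := dimge_level de pp; rewrite prednK //.
have -> : (p.-1 * e.+1 + e.+2 = p.-1 + (p * e + 2))%N by have := prednK p0; nia.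
pose l (k : 'I_p.-1) (x : G * Fp -> Fp) := x (s, (k : nat)%:R%R).
move/(@dimge_common_zero _ _ _ _ _ _ l (Z1_level_closed p)) => h.
have {}h := h (fun k c x y _ _ => erefl).
have f_lin : lin_map (fun (x : G * Fp -> Fp) (u : G) => x (u, 0%R)) by [].
have PL : lin_closed (fun x => Z1_level p x /\ forall k, l k x = 0%R).
  have [P0 PD] := Z1_level_closed p; split=> // c x y [Px lx] [Py ly]; split; first exact: PD.
  by move=> k; rewrite /l; move: (lx k) (ly k); rewrite /l => -> ->; rewrite mulr0 addr0.
apply: (dimge_inj f_lin PL _ _ h) => x [[zx _] lx].
  exact: (Z1M_res cG U_open hchi zx).
move=> x0 [g i] /= Ug.
have xs n : (n < p)%N -> x ((s ^+ n)%g, 0%R) = 0%R.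
  elim: n => [|n IH] np; first by apply: x0; rewrite expg0; exact: osub1.
  have np' : (n < p.-1)%N by rewrite -ltnS prednK.
  rewrite expgSr; have := zx.2 (s ^+ n)%g s (osubX U_open n Us) Us 0%R => /= ->.
  rewrite IH ?(ltnW np) // add0r (chi_pow U_open) // add0r.
  exact: (lx (Ordinal np')).
have := Z1M_coset U_open hchi Us chis i zx Ug; cbv beta.
rewrite x0; last exact: coset_cocycle_in.
by rewrite !xs ?ltn_Fp // addr0 subr0.
Qed.

End IndexStep.

(** A maximal subgroup of a [p]-group is normal of index p; [l] is the discrete logarithm in the
    quotient. *)
Lemma pgroup_maximal_hom (p : nat) (gT : finGroupType) (P M : {group gT}) :
  prime p -> p.-group P -> maximal M P ->
  exists l : gT -> 'F_p,
    [/\ {in P &, forall x y, l (x * y)%g = (l x + l y)%R},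
        {in P, forall x, l x = 0%R <-> x \in M} &
        exists2 s, s \in P & l s = 1%R].
Proof.
move=> p_pr pP maxM.
have nMP := p_maximal_normal pP maxM; have iMP := p_maximal_index pP maxM.
have oPM : #|P / M| = p by rewrite card_quotient ?normal_norm.
have nP x : x \in P -> x \in 'N(M) by apply/fintype.subsetP; exact: normal_norm.
have [c gc] : exists c, (P / M = <[c]>)%g.
  by apply/cyclicP; apply: prime_cyclic; rewrite oPM.
have oc : #[c] = p by rewrite orderE -gc.
pose l x : 'F_p := ((xget 0%N [set k | coset M x = (c ^+ k)%g])%:R)%R.
have lE x k : coset M x = (c ^+ k)%g -> l x = (k%:R)%R.
  move=> e; rewrite /l; case: xgetP => [j _ /= ej|/(_ k)/(_ e)//].
  have /eqP := etrans (esym ej) e; rewrite eq_expg_mod_order oc => /eqP jk.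
  by rewrite -(Fp_nat_mod p_pr) jk Fp_nat_mod.
have lex x : x \in P -> exists k, coset M x = (c ^+ k)%g.
  by move=> Px; apply/cycleP; rewrite -gc mem_quotient.
exists l; split.
- move=> x y Px Py; have [i ei] := lex x Px; have [j ej] := lex y Py.
  rewrite (lE _ _ ei) (lE _ _ ej) -natrD; apply: lE.
  by rewrite coset_morphM ?nP // ei ej expgD.
- move=> x Px; have [i ei] := lex x Px; rewrite (lE _ _ ei).
  split=> [/eqP|Mx].
    rewrite (Fp_natr_eq0 p_pr) -oc order_dvdn -ei => /eqP e.
    by apply: coset_idr => //; exact: nP.
  by have /eqP := ei; rewrite coset_id // eq_sym -order_dvdn oc -(Fp_natr_eq0 p_pr) => /eqP.
have : (c \in P / M)%g by rewrite gc cycle_id.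
move=> /morphimP[s _ Ps es]; exists s => //.
by rewrite (lE s 1%N) // expg1 es.
Qed.

(** * Duality and growth in arbitrary open subgroups *)

Section OpenChain.
Variables (p : nat) (p_pr : prime p) (G : topGroupType).
Hypothesis Gp : pro_p p G.
Local Notation Fp := 'F_p.

Let cG : compact [set: G]. Proof. by case: Gp. Qed.

Lemma imq_group_set (Q : finGroupType) (f : G -> Q) (U : set G) :
  {morph f : x y / (x * y)%g} -> subgroup U -> group_set (imq f U).
Proof.
move=> fM [U1 UM _]; apply/group_setP; split.
  by apply/imqP; exists 1%g => //; exact: morph1g.
move=> _ _ /imqP[g Ug <-] /imqP[h Uh <-]; apply/imqP; exists (g * h)%g; last exact: fM.
exact: UM.
Qed.

Lemma imq_sat N (Q : finGroupType) (f : G -> Q) (U : set G) g :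
  fquot p N f -> subgroup U -> N `<=` U -> f g \in imq f U -> U g.
Proof.
move=> [fM _ _ fN] [U1 UM UV] NU /imqP[u Uu e].
rewrite -(mulKVg u g); apply: (UM _ _ Uu); apply: NU; apply/fN.
by rewrite fM (morphVg fM) e mulVg.
Qed.

(** In the finite [p]-group [imq f U] a maximal subgroup containing the image of [V] has index p and
    is the kernel of a character. So [V] is reached by steps of index p, each multiplying the excess
    of dim H^1 over 2 by p; [n] only bounds the induction. *)
Lemma pd_open_aux N (Q : finGroupType) (f : G -> Q) n (U V : set G)
  (tr : (G -> G -> Fp) -> Fp) :
  opn N -> fquot p N f -> open_subgroup U -> open_subgroup V -> V `<=` U -> N `<=` V ->
  (#|imq f U| <= n)%N -> pd_trace U tr ->
  exists2 tr', @pd_trace p G V tr' & forall e, dimge U (hom1 (p := p) U) e.+2 ->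
    dimge V (hom1 (p := p) V) ((#|imq f U| %/ #|imq f V|) * e + 2).
Proof.
move=> oN qf; have [fM fS pQ fN] := qf.
elim: n U tr => [|n IH] U tr oU oV VU NV le htr.
  by move: le; rewrite leqNgt => /negP; case; apply/card_gt0P; exists (f 1%g);
    exact: mem_imq (osub1 oU).
pose Ub := Group (imq_group_set fM oU.2); pose Vb := Group (imq_group_set fM oV.2).
have VUb : Vb \subset Ub by exact: imqS.
have NU : N `<=` U by move=> x /NV/VU.
have pU : p.-group Ub by exact: pgroupS (finset.subsetT _) pQ.
case: (maximal_exists VUb) => [eVU|[M maxM VM]].
  have eUV : U = V.
    apply/seteqP; split=> // g Ug; apply: (imq_sat qf oV.2 NV).
    have -> : imq f V = Ub by exact: eVU.
    exact: mem_imq.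
  exists tr; first by rewrite -eUV.
  move=> e; rewrite eUV divnn.
  have -> : (0 < #|imq f V|)%N by apply/card_gt0P; exists (f 1%g); apply: mem_imq; exact: osub1.
  by rewrite mul1n addn2.
have [l [lM lK [sb Usb lsb]]] := pgroup_maximal_hom p_pr pU maxM.
have sMU : M \subset Ub := proper_sub (maxgroupp maxM).
pose chi g := l (f g).
have hchi : hom1 U chi.
  split.
    exists N => // g m Ug Nm; rewrite /chi fM (fN m).2 ?mulg1 //.
  by move=> g h Ug Uh; rewrite /chi fM lM //; exact: mem_imq.
have /imqP[s Us es] := Usb.
have chis : chi s = 1%R by rewrite /chi es.
have oU1 := chi_ker_open oU hchi.
have e1 : imq f (chi_ker U chi) = M.
  apply/setP => q; apply/imqP/idP => [[g [Ug cg] <-]|Mq].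
    by apply/lK => //; exact: mem_imq.
  have /imqP[g Ug eg] : q \in Ub by exact: fintype.subsetP sMU _ Mq.
  exists g => //; split=> //; rewrite /chi eg; apply/lK => //.
  by rewrite -eg; exact: mem_imq.
have VU1 : V `<=` chi_ker U chi.
  move=> g Vg; split; first exact: VU.
  apply/lK; first exact/mem_imq/VU.
  by apply: (fintype.subsetP VM); exact: mem_imq.
have iM := p_maximal_index pU maxM.
have oUM : (#|imq f U| = #|M| * p)%N by rewrite -iM -[LHS](Lagrange sMU).
have le1 : (#|imq f (chi_ker U chi)| <= n)%N.
  rewrite e1 -ltnS; apply: leq_trans le; rewrite oUM -{1}[#|M|]muln1.
  by rewrite ltn_pmul2l ?prime_gt1 // cardG_gt0.
have [tr' htr' dtr'] := IH _ _ oU1 oV VU1 NV le1 (pd_trace_ker p_pr cG oU htr hchi Us chis).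
exists tr' => // e de.
have := dimge_ker_step p_pr cG oU htr hchi Us chis de.
rewrite addn2 => /dtr'; rewrite e1 oUM.
have /dvdnP[m em] : (#|imq f V| %| #|M|)%N by exact: cardSg VM.
have V0 : (0 < #|imq f V|)%N by exact: (cardG_gt0 Vb).
rewrite em mulnAC !mulnK //.
by rewrite mulnA.
Qed.

End OpenChain.

(** * Characters modulo powers of p *)

Lemma dependent_sequence (T : choiceType) (P : nat -> T -> Prop) (R : nat -> T -> T -> Prop) w0 :
  P 0%N w0 -> (forall n w, P n w -> exists w', P n.+1 w' /\ R n w w') ->
  exists ws : nat -> T, ws 0%N = w0 /\ forall n, P n (ws n) /\ R n (ws n) (ws n.+1).
Proof.
move=> P0 PS.
pose nx n w := xget w [set w' | P n.+1 w' /\ R n w w'].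
have nxP n w : P n w -> P n.+1 (nx n w) /\ R n w (nx n w).
  move=> Pw; rewrite /nx; case: xgetP => [w' _ //|h].
  by have [w' hw'] := PS n w Pw; case: (h w').
exists (fix ws n := if n is m.+1 then nx m (ws m) else w0); split=> // n.
have Pn : P n ((fix ws n := if n is m.+1 then nx m (ws m) else w0) n).
  by elim: n => [//|n IH]; exact: (nxP _ _ IH).1.
by split=> //; exact: (nxP _ _ Pn).2.
Qed.

Section Bockstein.
Variables (p : nat) (p_pr : prime p) (G : topGroupType).
Hypothesis cG : compact [set: G].
Local Notation Fp := 'F_p.
Variables (U : set G) (tr : (G -> G -> Fp) -> Fp).
Hypotheses (U_open : open_subgroup U) (htr : pd_trace U tr).
Implicit Types (x y z : G -> int).
Local Open Scope ring_scope.

(** A homomorphism from [U] to Z/p^K, carried by integer representatives so that reduction and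
    division by powers of p need no change of type. *)
Definition hom_mod (K : nat) x : Prop :=
  smooth U x /\ forall g h, U g -> U h -> ((p ^ K)%N%:Z %| x g + x h - x (g * h)%g)%Z.

(** The Bockstein cocycle: the failure of additivity of the representatives, divided by p^K. It is
    the obstruction to lifting [x] modulo p^(K+1). *)
Definition bock (K : nat) x : G -> G -> Fp :=
  fun g h => ((x g + x h - x (g * h)%g) %/ (p ^ K)%N%:Z)%Z%:~R.

Lemma pK_neq0 K : (p ^ K)%N%:Z != 0.
Proof. by rewrite eqz_nat expn_eq0 -leqn0 leqNgt prime_gt0. Qed.

Lemma intr_Fp_eq0 (m : int) : ((m%:~R : Fp) == 0) = (p%:Z %| m)%Z.
Proof.
have h (k : nat) : ((k%:Z%:~R : Fp) == 0) = (p%:Z %| k%:Z)%Z.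
  by rewrite -pmulrn (Fp_natr_eq0 p_pr) dvdzE.
case: (intP m) => [|k|k]; [exact: (h 0%N) | exact: h|].
by rewrite mulrNz oppr_eq0 h !dvdzE abszN.
Qed.

Lemma hom_mod_weaken K L x : (K <= L)%N -> hom_mod L x -> hom_mod K x.
Proof.
move=> KL [sx hx]; split=> // g h Ug Uh; apply: dvdz_trans (hx g h Ug Uh).
by rewrite dvdzE /= dvdn_exp2l.
Qed.

Lemma hom_mod_lin K (c : int) x y : hom_mod K x -> hom_mod K y ->
  hom_mod K (fun g => x g - c * y g).
Proof.
move=> [sx hx] [sy hy]; split.
  exact: (smooth_op (fun u v : int => u - c * v) sx sy).
move=> g h Ug Uh.
have -> : x g - c * y g + (x h - c * y h) - (x (g * h)%g - c * y (g * h)%g) =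
  (x g + x h - x (g * h)%g) - c * (y g + y h - y (g * h)%g) by ring.
by apply: rpredB; [exact: hx | apply: dvdz_mull; exact: hy].
Qed.

Lemma hom_mod_scale K n x : hom_mod K x -> hom_mod (n + K) (fun g => (p ^ n)%N%:Z * x g).
Proof.
move=> [sx hx]; split; first exact: (smooth_comp (fun u : int => (p ^ n)%N%:Z * u) sx).
move=> g h Ug Uh; rewrite -mulrDr -mulrBr expnD PoszM.
by apply: dvdz_mul => //; exact: hx.
Qed.

Lemma bockE K x g h : hom_mod K x -> U g -> U h ->
  exists2 m : int, x g + x h - x (g * h)%g = m * (p ^ K)%N%:Z & bock K x g h = m%:~R.
Proof.
move=> [_ hx] Ug Uh; exists ((x g + x h - x (g * h)%g) %/ (p ^ K)%N%:Z)%Z => //.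
by rewrite divzK //; exact: hx.
Qed.

Lemma bock_Z2 K x : hom_mod K x -> Z2 U (bock K x).
Proof.
move=> hx; split.
  have s1 := smooth2_op (fun u v : int => u + v) (smooth2_l hx.1) (smooth2_r hx.1).
  exact: (smooth2_op (fun u v : int => ((u - v) %/ (p ^ K)%N%:Z)%Z%:~R : Fp) s1
    (smooth2_mul U_open hx.1)).
move=> a b c Ua Ub Uc.
have Uab := osubM U_open Ua Ub; have Ubc := osubM U_open Ub Uc.
have [m1 e1 ->] := bockE hx Ub Uc; have [m2 e2 ->] := bockE hx Uab Uc.
have [m3 e3 ->] := bockE hx Ua Ubc; have [m4 e4 ->] := bockE hx Ua Ub.
rewrite -!(intrB, intrD).
suff -> : m1 - m2 + m3 - m4 = 0 by [].
apply: (mulIf (pK_neq0 K)); rewrite mul0r !(mulrBl, mulrDl) -e1 -e2 -e3 -e4 mulgA; ring.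
Qed.

Lemma bock_lin K (c : int) x y g h : hom_mod K x -> hom_mod K y -> U g -> U h ->
  bock K (fun g => x g - c * y g) g h = - c%:~R * bock K y g h + bock K x g h.
Proof.
move=> hx hy Ug Uh; have [m e ->] := bockE (hom_mod_lin c hx hy) Ug Uh.
have [m1 e1 ->] := bockE hx Ug Uh; have [m2 e2 ->] := bockE hy Ug Uh.
rewrite -intrN -intrM -intrD; congr _%:~R; apply: (mulIf (pK_neq0 K)).
by rewrite -e mulrDl mulNr mulNr -mulrA -e1 -e2; ring.
Qed.

Lemma bock_scale K n x g h : hom_mod K x -> U g -> U h ->
  bock (n + K) (fun g => (p ^ n)%N%:Z * x g) g h = bock K x g h.
Proof.
move=> hx Ug Uh; have [m e ->] := bockE (hom_mod_scale n hx) Ug Uh.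
have [m1 e1 ->] := bockE hx Ug Uh; congr _%:~R; apply: (mulIf (pK_neq0 (n + K))).
by rewrite -e -mulrDr -mulrBr e1 expnD PoszM; ring.
Qed.

Lemma hom_mod_lift K x : hom_mod K x -> tr (bock K x) = 0 ->
  exists2 x', hom_mod K.+1 x' & forall g, ((p ^ K)%N%:Z %| x' g - x g)%Z.
Proof.
move=> hx /(tr0 htr (bock_Z2 hx)) [b sb eb].
pose x' g : int := x g - (p ^ K)%N%:Z * (b g : nat)%:Z.
exists x'; last first.
  by move=> g; rewrite /x' addrAC subrr add0r dvdzE abszN -dvdzE dvdz_mulr.
split.
  exact: (smooth_op (fun (u : int) (c : Fp) => u - (p ^ K)%N%:Z * (c : nat)%:Z) hx.1 sb).
move=> g h Ug Uh; have [m e em] := bockE hx Ug Uh.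
have -> : x' g + x' h - x' (g * h)%g = (x g + x h - x (g * h)%g) - (p ^ K)%N%:Z *
  ((b g : nat)%:Z + (b h : nat)%:Z - (b (g * h)%g : nat)%:Z) by rewrite /x'; ring.
rewrite e [m * _]mulrC -mulrBr expnSr PoszM; apply: dvdz_mul => //.
rewrite -intr_Fp_eq0 !(intrB, intrD) -!pmulrn !Fp_natK -em eb // subrr //.
Qed.

Definition reduces_to x (y : G -> Fp) : Prop := forall g, U g -> (x g)%:~R = y g.

Lemma hom_mod_hom1 K x : hom_mod K.+1 x -> hom1 U (fun g => (x g)%:~R : Fp).
Proof.
move=> [sx hx]; split; first exact: (smooth_comp (fun u : int => u%:~R : Fp) sx).
move=> g h Ug Uh; apply/eqP; rewrite eq_sym -subr_eq0 -intrD -intrB intr_Fp_eq0.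
by apply: dvdz_trans (hx g h Ug Uh); rewrite dvdzE /= expnS dvdn_mulr.
Qed.

Lemma hom1_hom_mod (y : G -> Fp) : hom1 U y ->
  hom_mod 1 (fun g => (y g : nat)%:Z) /\ reduces_to (fun g => (y g : nat)%:Z) y.
Proof.
move=> [sy hy]; split; last by move=> g _; rewrite -pmulrn Fp_natK.
split; first exact: (smooth_comp (fun c : Fp => (c : nat)%:Z) sy).
move=> g h Ug Uh; rewrite expn1 -intr_Fp_eq0 intrB intrD -!pmulrn !Fp_natK.
by rewrite hy // subrr.
Qed.

(* [y] is the reduction of a homomorphism from [U] to the p-adic integers. *)
Definition Zp_liftable (y : G -> Fp) : Prop :=
  exists xs : nat -> G -> int, [/\ forall n, hom_mod n.+1 (xs n),
    forall n g, U g -> ((p ^ n.+1)%N%:Z %| xs n.+1 g - xs n g)%Z & reduces_to (xs 0%N) y].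

Lemma reduces_cong K x x' (y : G -> Fp) : (forall g, ((p ^ K.+1)%N%:Z %| x' g - x g)%Z) ->
  reduces_to x y -> reduces_to x' y.
Proof.
move=> c r g Ug; rewrite -(r g Ug); apply/eqP; rewrite -subr_eq0 -intrB intr_Fp_eq0.
by apply: dvdz_trans (c g); rewrite dvdzE /= expnS dvdn_mulr.
Qed.

(** Either no obstruction ever occurs, or some [z] modulo p^(k+1) has nonzero Bockstein trace, with
    k minimal. Below that level everything lifts; from there on each obstruction is cancelled by a
    multiple of p^n z, which has the Bockstein of [z]. Only the correction with n = 0 is visible
    modulo p. *)
Lemma Zp_liftable_codim1 : exists2 z : G -> Fp, hom1 U z &
  forall y : G -> Fp, hom1 U y -> exists c : Fp, Zp_liftable (fun g => y g - c * z g).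
Proof.
have [hall|] := pselect (forall k x, hom_mod k.+1 x -> tr (bock k.+1 x) = 0).
  exists (fun=> 0); first exact: (lin_closed_hom1 p cG U_open).1.
  move=> y hy; exists 0; have [h1 r1] := hom1_hom_mod hy.
  have [] := dependent_sequence (P := fun n x => hom_mod n.+1 x)
    (R := fun n x x' => forall g, ((p ^ n.+1)%N%:Z %| x' g - x g)%Z) h1.
    by move=> n w hw; have [w' h c] := hom_mod_lift hw (hall _ _ hw); exists w'.
  move=> xs [e0 h]; exists xs; split=> [n|n g _|]; [exact: (h n).1 | exact: (h n).2|].
  by rewrite e0 => g Ug; rewrite mul0r subr0; exact: r1.
move=> /existsNP[k0 /existsNP[x0 /not_implyP[hx0 tx0]]].
pose bad k := `[< exists x, hom_mod k.+1 x /\ tr (bock k.+1 x) <> 0 >].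
have exbad : exists k, bad k by exists k0; apply/asboolP; exists x0.
case: (ex_minnP exbad) => k /asboolP[z [hz tz]] kmin.
have good j x : (j < k)%N -> hom_mod j.+1 x -> tr (bock j.+1 x) = 0.
  move=> jk hx; apply: contrapT => tx.
  have bj : bad j by apply/asboolP; exists x.
  by have := kmin j bj; rewrite leqNgt jk.
exists (fun g => (z g)%:~R); first exact: (hom_mod_hom1 hz).
move=> y hy.
have [y0 hy0 ry0] : exists2 y0, hom_mod k.+1 y0 & reduces_to y0 y.
  have : forall j, (j <= k)%N -> exists2 y0, hom_mod j.+1 y0 & reduces_to y0 y.
    elim=> [_|j IH jk]; first by have [h1 r1] := hom1_hom_mod hy; eexists; [exact: h1|].
    have [w hw rw] := IH (ltnW jk).
    have [w' hw' c] := hom_mod_lift hw (good _ _ jk hw).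
    by exists w' => //; exact: reduces_cong c rw.
  by apply.
have step n w : hom_mod (n + k.+1) w -> exists c : Fp, exists2 w', hom_mod (n + k.+1).+1 w' &
    forall g, ((p ^ (n + k.+1))%N%:Z %| w' g - (w g - (c : nat)%:Z * ((p ^ n)%N%:Z * z g)))%Z.
  move=> hw; pose c : Fp := tr (bock (n + k.+1) w) / tr (bock k.+1 z).
  have hpz := hom_mod_scale n hz; have hl := hom_mod_lin (c : nat)%:Z hw hpz.
  exists c; apply: (hom_mod_lift hl).
  have zz := bock_Z2 hz; have zw := bock_Z2 hw; have zl := bock_Z2 hl.
  rewrite (tr_ext cG U_open htr zl (Z2_lin (- c) zz zw)).
    by rewrite (trL htr) // mulNr divfK ?addNr //; exact/eqP.
  by move=> g h Ug Uh; rewrite bock_lin // bock_scale // -pmulrn Fp_natK.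
have [c [w0 hw0 cw0]] := step 0%N y0 hy0.
exists c.
(* The sequence keeps k + 1 digits of precision in reserve; the correction by p^(n+1) z respects the
   congruence modulo p^(n+1). *)
have [] := dependent_sequence (P := fun n x => hom_mod (n.+1 + k.+1) x)
    (R := fun n x x' => forall g, ((p ^ n.+1)%N%:Z %| x' g - x g)%Z) hw0.
  move=> n w hw; have [d [w' hw' cw']] := step _ w hw; exists w'; split=> // g.
  have -> : w' g - w g = (w' g - (w g - (d : nat)%:Z * ((p ^ n.+1)%N%:Z * z g)))
     + (- ((d : nat)%:Z * z g)) * (p ^ n.+1)%N%:Z by ring.
  apply: rpredD; last exact: dvdz_mull.
  by apply: dvdz_trans (cw' g); rewrite dvdzE /= dvdn_exp2l // leq_addr.
move=> xs [e0 h]; exists xs; split=> [n|n g _|]; [|exact: (h n).2|].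
  by apply: hom_mod_weaken (h n).1; rewrite leq_addr.
rewrite e0; apply: (reduces_cong (K := k) cw0) => g Ug.
by rewrite mul1r intrB intrM (ry0 g Ug) -pmulrn Fp_natK.
Qed.

End Bockstein.

(** * Isotropic families of liftable characters *)

Section HyperbolicFamily.
Variables (p : nat) (p_pr : prime p) (G : topGroupType).
Hypothesis cG : compact [set: G].
Local Notation Fp := 'F_p.
Variables (U : set G) (tr : (G -> G -> Fp) -> Fp).
Hypotheses (U_open : open_subgroup U) (htr : pd_trace U tr).
Local Open Scope ring_scope.

(** Natural representatives, because the values will be exponents of group elements. *)
Definition nat_hom_mod (K : nat) (x : G -> nat) : Prop :=
  smooth U x /\ forall g h, U g -> U h -> x (g * h)%g = (x g + x h)%N %[mod p ^ K].

Definition mod_p (x : G -> nat) : G -> Fp := fun g => (x g)%:R.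

(* A surjection from [U] onto any p-group generated by m elements is built from such
   a family: the [x i] span an isotropic subspace, and any class of degree two can be
   cupped off against one chosen [x j] without disturbing the others. *)
Definition isotropic_family (K m : nat) (x : 'I_m -> G -> nat) : Prop :=
  [/\ forall i, nat_hom_mod K (x i),
      forall i j, i != j -> B2 U (cp (mod_p (x i)) (mod_p (x j))),
      forall f j, Z2 U f -> exists2 c, nat_hom_mod K c &
        B2 U (fun g h => cp (mod_p c) (mod_p (x j)) g h - f g h) /\
        forall i, i != j -> B2 U (cp (mod_p c) (mod_p (x i))) &
      forall c : 'I_m -> Fp, (forall u, U u -> \sum_i c i * mod_p (x i) u = 0) ->
        forall i, c i = 0].

Definition liftable (y : G -> Fp) : Prop := hom1 U y /\ Zp_liftable U y.

Lemma lin_closed_liftable : lin_closed liftable.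
Proof.
have UPL := lin_closed_hom1 p cG U_open.
split.
  split; first exact: UPL.1.
  exists (fun _ _ => 0); split=> [n|n g Ug|g Ug] //.
  split; first exact: (smooth_cst cG U_open).
  by move=> g h _ _; rewrite addr0 subrr dvdz0.
move=> a x y [hx [xs [xs1 xs2 xs3]]] [hy [ys [ys1 ys2 ys3]]].
split; first exact: UPL.2.
exists (fun n g => ys n g - (- (a : nat)%:Z) * xs n g); split=> [n|n g Ug|g Ug].
- exact: hom_mod_lin.
- have -> : ys n.+1 g - (- (a : nat)%:Z) * xs n.+1 g - (ys n g - (- (a : nat)%:Z) * xs n g) =
    (ys n.+1 g - ys n g) + (a : nat)%:Z * (xs n.+1 g - xs n g) by ring.
  by apply: rpredD; [exact: ys2 | apply: dvdz_mull; exact: xs2].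
by rewrite mulNr opprK intrD intrM xs3 // ys3 // -pmulrn Fp_natK addrC.
Qed.

Lemma liftable_nat K y : liftable y -> exists2 x : G -> nat, nat_hom_mod K.+1 x &
  forall g, U g -> mod_p x g = y g.
Proof.
move=> [hy [xs [xs1 xs2 xs3]]].
have red n g : U g -> (xs n g)%:~R = y g.
  move=> Ug; elim: n => [|n IH]; first exact: xs3.
  rewrite -IH; apply/eqP; rewrite -subr_eq0 -intrB (intr_Fp_eq0 p_pr).
  by apply: dvdz_trans (xs2 n g Ug); rewrite dvdzE /= expnS dvdn_mulr.
have pK : (p ^ K.+1)%N%:Z != 0 by exact: pK_neq0.
exists (fun g => `|(xs K g %% (p ^ K.+1)%N%:Z)%Z|%N).
  split.
    exact: (smooth_comp (fun u : int => `|(u %% (p ^ K.+1)%N%:Z)%Z|%N) (xs1 K).1).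
  move=> g h Ug Uh; apply/eqP; rewrite -eqz_nat -!modz_nat PoszD !gez0_abs ?modz_ge0 //.
  by rewrite modz_mod modzDml modzDmr eq_sym eqz_mod_dvd; exact: (xs1 K).2.
move=> g Ug; rewrite /mod_p -(red K g Ug) pmulrn gez0_abs ?modz_ge0 //.
apply/eqP; rewrite eq_sym -subr_eq0 -intrB (intr_Fp_eq0 p_pr).
have -> : xs K g - (xs K g %% (p ^ K.+1)%N%:Z)%Z = (xs K g %/ (p ^ K.+1)%N%:Z)%Z * (p ^ K.+1)%N%:Z.
  by rewrite {1}(divz_eq (xs K g) (p ^ K.+1)%N%:Z) addrK.
by apply: dvdz_mull; rewrite dvdzE /= expnS dvdn_mulr.
Qed.

Lemma nat_hom_mod_hom1 K x : nat_hom_mod K.+1 x -> hom1 U (mod_p x).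
Proof.
move=> [sx hx]; split; first exact: (smooth_comp (fun u : nat => u%:R : Fp) sx).
move=> g h Ug Uh; rewrite /mod_p -natrD; apply/eqP; rewrite -(Fp_nat_mod p_pr) eq_sym.
rewrite -(Fp_nat_mod p_pr); have := congr1 (modn^~ p) (hx g h Ug Uh).
by rewrite !modn_dvdm ?expnS ?dvdn_mulr // => ->.
Qed.

Lemma dimge_liftable d : dimge U (hom1 (p := p) U) d.+1 -> dimge U liftable d.
Proof.
move=> hd; have [z hz hc] := Zp_liftable_codim1 p_pr cG U_open htr.
apply: (dimge_hyperplane (z := z) lin_closed_liftable _ hd) => y hy.
have [c lc] := hc y hy; exists c; split=> //.
have UPL := lin_closed_hom1 p cG U_open.
have -> : (fun t => y t - c * z t) = (fun t => - c * z t + y t).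
  by apply: funext => t; rewrite mulNr addrC.
exact: UPL.2.
Qed.

(** The next [y] is a liftable character orthogonal to all earlier ones and to a complement [z] of
    the liftable ones. Orthogonality to [z] allows its dual partner to be made liftable without
    changing the pairing; the earlier [c i] then make it orthogonal to the earlier [x i]. The
    condition i != j matters for p = 2, where anticommutativity does not force x cup x to be 0. *)
Lemma hyperbolic_pairs m : (forall x : G -> Fp, hom1 U x -> nonzero_on U x ->
    exists2 y, hom1 U y & tr (cp x y) <> 0) ->
  dimge U (hom1 (p := p) U) (m.*2).+1 ->
  exists x c : nat -> G -> Fp, forall i, (i < m)%N -> [/\ liftable (x i), liftable (c i) &
    forall j, (j < m)%N -> (i != j -> tr (cp (x i) (x j)) = 0) /\
                           tr (cp (c i) (x j)) = (i == j)%:R].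
Proof.
move=> nd; have UPL := lin_closed_hom1 p cG U_open; have LPL := lin_closed_liftable.
elim: m => [_|m IH hd]; first by exists (fun _ _ => 0), (fun _ _ => 0).
have hd' : dimge U (hom1 (p := p) U) (m.*2).+1.
  by apply: dimge_leq UPL _ hd; rewrite doubleS; lia.
have [x [c xc]] := IH hd'.
have [z hz hzc] := Zp_liftable_codim1 p_pr cG U_open htr.
(* There are 2m + 1 linear conditions, and one dimension is left for [y]. *)
have dl : dimge U liftable (m.*2.+1 + 1).
  by apply: dimge_liftable; rewrite addn1 -doubleS.
pose fam (k : 'I_(m.*2.+1)) : G -> Fp :=
  if (k < m)%N then x k else if (k < m.*2)%N then c (k - m)%N else z.
have hfam k : hom1 U (fam k).
  rewrite /fam; case: ifP => [km|km]; first by have [[]] := xc k km.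
  case: ifP => // km2; have km' : (k - m < m)%N by move: km km2; lia.
  by have [_ []] := xc _ km'.
have lf k : lin_fun liftable (fun y => tr (cp (fam k) y)).
  move=> b y y' [hy _] [hy' _]; exact: (lin_fun_cpr htr (hfam k)).
have [y [[ly fy] ny]] := dimge1_neq0 (dimge_common_zero LPL lf dl).
have [hy _] := ly.
have xy i : (i < m)%N -> tr (cp (x i) y) = 0.
  move=> im; have im2 : (i < m.*2.+1)%N by lia.
  by have := fy (Ordinal im2); rewrite /fam /= im.
have cy i : (i < m)%N -> tr (cp (c i) y) = 0.
  move=> im; have im2 : (i + m < m.*2.+1)%N by lia.
  have := fy (Ordinal im2); rewrite /fam /= ltnNge leq_addl /= addnK.
  by have -> : (i + m < m.*2)%N by lia.
have zy : tr (cp z y) = 0.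
  have := fy ord_max; rewrite /fam /= ltnn.
  by have -> : (m.*2 < m)%N = false by lia.
have [w hw tw] := nd y hy ny.
have [d ld] := hzc w hw.
pose w' t := w t - d * z t.
have lw' : liftable w'.
  split=> //; have -> : w' = (fun t => - d * z t + w t).
    by apply: funext => t; rewrite mulNr addrC.
  exact: UPL.2.
have tw' : tr (cp w' y) = tr (cp w y).
  have -> : w' = (fun t => - d * z t + w t) by apply: funext => t; rewrite mulNr addrC.
  by rewrite (lin_fun_cpl htr hy) // zy mulr0 add0r.
pose e := tr (cp w y).
have e0 : e != 0.
  by apply/eqP => e0; apply: tw; rewrite (cp_anti cG U_open htr) // -/e e0 oppr0.
pose s t := \sum_(i < m) (- (tr (cp w' (x i)) / e)) * c i t.
have ls : liftable s.
  by apply: lin_closed_sum => // i; have [] := xc i (ltn_ord i).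
pose c' t := e^-1 * w' t + s t.
have lc' : liftable c' by exact: LPL.2.
have tc' v : liftable v ->
    tr (cp c' v) = e^-1 * tr (cp w' v) + \sum_(i < m) (- (tr (cp w' (x i)) / e)) * tr (cp (c i) v).
  move=> [hv _]; have ll := lin_fun_cpl htr hv.
  rewrite (ll e^-1 w' s lw'.1 ls.1); congr (_ + _).
  apply: (lin_fun_sum _ UPL ll) => i; by have [_ []] := xc i (ltn_ord i).
exists (fun i => if i == m then y else x i), (fun i => if i == m then c' else c i).
have mm i : (i < m.+1)%N -> i != m -> (i < m)%N by rewrite ltnS ltn_neqAle => -> ->.
move=> i im; split.
- by case: eqP => // /eqP /(mm _ im) im'; have [] := xc i im'.
- by case: eqP => // /eqP /(mm _ im) im'; have [] := xc i im'.
move=> j jm; case: (eqVneq i m) => [ei|im0]; case: (eqVneq j m) => [ej|jm0].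
- rewrite ei ej eqxx; split=> //; rewrite tc' // tw' -/e mulVf // big1 ?addr0 // => k _.
  by rewrite cy ?mulr0.
- have jm' := mm _ jm jm0; have [lxj _ _] := xc j jm'.
  rewrite ei eq_sym (negbTE jm0); split=> [_|].
    by rewrite (cp_anti cG U_open htr) ?xy ?oppr0 //; exact: lxj.1.
  rewrite tc' // (bigD1 (Ordinal jm')) //= big1 ?addr0 => [|k /negP kj].
    have [_ _ /(_ j jm')[_ ->]] := xc j jm'.
    by rewrite eqxx mulr1 [X in X + _]mulrC subrr.
  have [_ _ /(_ j jm')[_ ->]] := xc k (ltn_ord k).
  by case: eqP => [kj'|_]; [case: kj; apply/eqP/val_inj | rewrite mulr0].
- have im' := mm _ im im0; rewrite ej (negbTE im0); split=> [_|]; [exact: xy | exact: cy].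
have im' := mm _ im im0; have jm' := mm _ jm jm0.
by have [_ _ /(_ j jm')] := xc i im'.
Qed.

(** One dimension is lost to liftability and half of the rest to isotropy. If H^2 = 0, any
    independent liftable family will do. Otherwise the dual characters both cancel classes and prove
    independence. *)
Lemma isotropic_family_exists K m : dimge U (hom1 (p := p) U) (m.*2).+1 ->
  exists x : 'I_m -> G -> nat, isotropic_family K.+1 x.
Proof.
move=> hd; have UPL := lin_closed_hom1 p cG U_open.
case: (htr) => _ _ [t0|nd].
  have := dimge_liftable hd; rewrite -addnn.
  move/(dimge_leq lin_closed_liftable (leq_addr m m)) => [w [lw iw]].
  have /choice [x hx] : forall i, exists x, nat_hom_mod K.+1 x /\ forall g, U g -> mod_p x g = w i g.
    by move=> i; have [x] := liftable_nat K (lw i); exists x.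
  have b0 (f : G -> G -> Fp) : Z2 U f -> B2 U f by move=> zf; apply/(tr0 htr zf); exact: t0.
  have h1 i := nat_hom_mod_hom1 (hx i).1.
  exists x; split=> [i|i j _|f j zf|c hc].
  - exact: (hx i).1.
  - by apply: b0; exact: cp_Z2.
  - exists (fun=> 0%N).
      by split; [exact: (smooth_cst cG U_open) | move=> *; rewrite addn0].
    have zz : Z2 U (fun _ _ => 0 : Fp) by exact: (Z2_0 p cG U_open).
    split.
      have -> : (fun g h => cp (mod_p (fun=> 0%N)) (mod_p (x j)) g h - f g h) =
                (fun g h => - 1 * f g h + 0).
        by apply: funext => g; apply: funext => h; rewrite /cp /mod_p mul0r sub0r mulN1r addr0.
      by apply: b0; exact: Z2_lin.
    move=> i _; apply: b0.
    have -> : cp (mod_p (fun=> 0%N)) (mod_p (x i)) = (fun _ _ => 0).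
      by apply: funext => g; apply: funext => h; rewrite /cp /mod_p mul0r.
    by [].
  apply: iw => u Uu; rewrite -[RHS](hc u Uu); apply: eq_bigr => i _.
  by rewrite (hx i).2.
have [x [c xc]] := hyperbolic_pairs nd hd.
have /choice [xt hxt] : forall i : 'I_m, exists y, nat_hom_mod K.+1 y /\ forall g, U g -> mod_p y g = x i g.
  move=> i; have [lx _ _] := xc i (ltn_ord i).
  by have [y] := liftable_nat K lx; exists y.
have hx i : hom1 U (mod_p (xt i)) by exact: (nat_hom_mod_hom1 (hxt i).1).
have hxi (i : 'I_m) : hom1 U (x i) by have [[]] := xc i (ltn_ord i).
have hci (i : 'I_m) : hom1 U (c i) by have [_ []] := xc i (ltn_ord i).
exists xt; split=> [i|i j ij|f j zf|b hb j].
- exact: (hxt i).1.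
- apply/(tr0 htr); first exact: cp_Z2.
  rewrite (tr_ext cG U_open htr (cp_Z2 (hx i) (hx j)) (cp_Z2 (hxi i) (hxi j))).
    by have [_ _ /(_ j (ltn_ord j))[h _]] := xc i (ltn_ord i); exact: h.
  by move=> g h Ug Uh; rewrite /cp (hxt i).2 // (hxt j).2.
- have [_ lc _] := xc j (ltn_ord j).
  have lfc : liftable (fun t => tr f * c j t + 0).
    by apply: lin_closed_liftable.2 => //; exact: lin_closed_liftable.1.
  have [y hy ey] := liftable_nat K lfc.
  have hy1 := nat_hom_mod_hom1 hy.
  have tcy i : tr (cp (mod_p y) (mod_p (xt i))) = tr f * (j == i)%:R.
    rewrite (tr_ext cG U_open htr (cp_Z2 hy1 (hx i)) (cp_Z2 lfc.1 (hxi i))); last first.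
      by move=> g h Ug Uh; rewrite /cp ey // (hxt i).2.
    have ll := lin_fun_cpl htr (hxi i).
    rewrite (ll (tr f) (c j) (fun=> 0)) ?(lin_fun0 UPL ll) ?addr0 //; last exact: UPL.1.
    by have [_ _ /(_ i (ltn_ord i))[_ ->]] := xc j (ltn_ord j).
  exists y => //; split.
    have -> : (fun g h => cp (mod_p y) (mod_p (xt j)) g h - f g h) =
              (fun g h => -1 * f g h + cp (mod_p y) (mod_p (xt j)) g h).
      by apply: funext => g; apply: funext => h; rewrite mulN1r addrC.
    have zc := cp_Z2 hy1 (hx j).
    apply/(tr0 htr); first exact: Z2_lin.
    by rewrite (trL htr) // tcy eqxx mulr1 mulN1r addNr.
  move=> i ij; apply/(tr0 htr); first exact: cp_Z2.
  by rewrite tcy eq_sym (negbTE ij) mulr0.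
have hs : hom1 U (fun t => \sum_i b i * x i t).
  exact: (lin_closed_sum b UPL hxi).
have z0 : hom1 U (fun=> 0 : Fp) := UPL.1.
have e0 : tr (cp (c j) (fun t => \sum_i b i * x i t)) = 0.
  rewrite (tr_ext cG U_open htr (cp_Z2 (hci j) hs) (cp_Z2 (hci j) z0)).
    exact: (lin_fun0 UPL (lin_fun_cpr htr (hci j))).
  move=> g h Ug Uh; rewrite /cp; congr (_ * _); rewrite -[RHS](hb h Uh).
  by apply: eq_bigr => i _; rewrite (hxt i).2.
move: e0; rewrite (lin_fun_sum _ UPL (lin_fun_cpr htr (hci j)) hxi).
rewrite (bigD1 j) //= big1 ?addr0 => [|k kj].
  have [_ _ /(_ j (ltn_ord j))[_ ->]] := xc j (ltn_ord j).
  by rewrite eqxx mulr1.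
have [_ _ /(_ k (ltn_ord k))[_ ->]] := xc j (ltn_ord j).
by rewrite eq_sym -[(k == j :> nat)]/(k == j) (negbTE kj) mulr0.
Qed.

End HyperbolicFamily.

(** * The embedding theorem *)

Section PGroupFacts.
Variables (p : nat) (p_pr : prime p).
Local Notation Fp := 'F_p.

Lemma expg_Fp (gT : finGroupType) (c : gT) n : (c ^+ p = 1)%g ->
  (c ^+ ((n%:R : Fp)%R : nat) = c ^+ n)%g.
Proof. by move=> cp; rewrite /= val_Fp_nat // expg_mod. Qed.

Lemma expg_FpD (gT : finGroupType) (c : gT) (a b : Fp) : (c ^+ p = 1)%g ->
  (c ^+ ((a + b)%R : nat) = c ^+ (a : nat) * c ^+ (b : nat))%g.
Proof.
by move=> cp; rewrite -[a in LHS]Fp_natK -[b in LHS]Fp_natK -natrD expg_Fp // expgD.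
Qed.

Fixpoint span_group (gT : finGroupType) (e : nat -> gT) (n : nat) : {group gT} :=
  if n is k.+1 then (span_group e k <*> <[e k]>)%G else 1%G.

Lemma mem_span_group (gT : finGroupType) (e : nat -> gT) n i : (i < n)%N ->
  e i \in span_group e n.
Proof.
elim: n => // n IH; rewrite ltnS leq_eqVlt => /orP[/eqP ->|/IH h] /=.
  by apply: (fintype.subsetP (joing_subr _ _)); exact: cycle_id.
exact: (fintype.subsetP (joing_subl _ _)).
Qed.

Lemma span_group_sub (gT : finGroupType) (e : nat -> gT) n (H : {group gT}) :
  (forall i, (i < n)%N -> e i \in H) -> span_group e n \subset H.
Proof.
elim: n => [_|n IH he]; first exact: sub1G.
by rewrite /= join_subG cycle_subG he // IH // => i /ltnW; exact: he.
Qed.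

(** The generators may be dependent: a redundant one gets coordinate 0, and what survives is that
    coordinates are additive and reconstruct the element. *)
Lemma abelem_coordinates (gT : finGroupType) (e : nat -> gT) n :
  p.-abelem (span_group e n) ->
  exists l : nat -> gT -> Fp,
    (forall i, {in span_group e n &, forall x y, l i (x * y)%g = (l i x + l i y)%R}) /\
    {in span_group e n, forall y, y = (\prod_(i < n) e i ^+ (l i y : nat))%g}.
Proof.
elim: n => [_|n IH abE].
  exists (fun _ _ => 0%R); split=> [i x y _ _|y]; first by rewrite addr0.
  by rewrite big_ord0 => /set1P.
have sub : span_group e n \subset span_group e n.+1 by exact: joing_subl.
have [l [lM lE]] := IH (abelemS sub abE).
have ab : abelian (span_group e n.+1) := abelem_abelian abE.
have ene : e n \in span_group e n.+1 by exact: mem_span_group.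
have [en|en] := boolP (e n \in span_group e n).
  have eqS : span_group e n.+1 \subset span_group e n by rewrite /= join_subG cycle_subG en subxx.
  exists (fun i x => if (i < n)%N then l i x else 0%R); split.
    move=> i x y hx hy; case: ifP => _; last by rewrite addr0.
    by apply: lM; exact: (fintype.subsetP eqS).
  move=> y hy; rewrite big_ord_recr /= ltnn mulg1 {1}(lE y) ?(fintype.subsetP eqS) //.
  by apply: eq_bigr => i _; rewrite ltn_ord.
have en1 : e n != 1%g by apply: contraNneq en => ->; exact: group1.
have oe : #[e n] = p by exact: abelem_order_p abE ene en1.
have TI : (<[e n]> :&: span_group e n = 1)%g.
  by apply: prime_TIg; rewrite ?cycle_subG // -orderE oe.
have nrm : <[e n]> \subset 'N(span_group e n).
  apply: cents_norm; apply: sub_abelian_cent2 ab _ _ => //.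
  by rewrite cycle_subG.
have card : #|span_group e n.+1| = (#|span_group e n| * p)%N.
  rewrite /= norm_joinEr // TI_cardMg; first by rewrite -orderE oe.
  by rewrite finset.setIC.
have maxS : maximal (span_group e n) (span_group e n.+1).
  apply: p_index_maximal => //; rewrite -divgS // card mulKn ?cardG_gt0 //.
have pS := abelem_pgroup abE.
have [f [fM fK _]] := pgroup_maximal_hom p_pr pS maxS.
have fe0 : f (e n) != 0%R.
  by apply/eqP => /fK h; case/negP: en; exact: h.
have fX x k : x \in span_group e n.+1 -> f (x ^+ k)%g = (f x *+ k)%R.
  move=> hx; elim: k => [|k IHk].
    by rewrite expg0 mulr0n; apply/fK; [exact: group1 | exact: group1].
  by rewrite expgS fM ?groupX // IHk mulrS.
pose c x : Fp := (f x / f (e n))%R.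
have cM x y : x \in span_group e n.+1 -> y \in span_group e n.+1 ->
    c (x * y)%g = (c x + c y)%R by move=> hx hy; rewrite /c fM // mulrDl.
have enp : (e n ^+ p = 1)%g by rewrite -oe expg_order.
pose r x := (x * e n ^- (c x : nat))%g.
have rin x : x \in span_group e n.+1 -> r x \in span_group e n.
  move=> hx; have hr : r x \in span_group e n.+1 by rewrite groupM // groupV groupX.
  apply/fK => //; have : f (r x * e n ^+ (c x : nat))%g = f x by rewrite mulgKV.
  rewrite fM ?groupX // fX // -mulr_natr Fp_natK /c mulrCA divff // mulr1.
  by move=> e1; apply: (addIr (f x)); rewrite e1 add0r.
have com x y : x \in span_group e n.+1 -> y \in span_group e n.+1 -> (x * y = y * x)%g.
  by move=> hx hy; exact: (centsP ab).
have rM x y : x \in span_group e n.+1 -> y \in span_group e n.+1 -> r (x * y)%g = (r x * r y)%g.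
  move=> hx hy; rewrite /r cM // expg_FpD // invgM -!mulgA; congr (_ * _)%g.
  by rewrite mulgA com ?groupM ?groupV ?groupX.
exists (fun i x => if (i < n)%N then l i (r x) else c x); split.
  move=> i x y hx hy; case: ifP => _; last exact: cM.
  by rewrite rM // lM //; exact: rin.
move=> y hy; rewrite big_ord_recr /= ltnn -{1}(mulgKV (e n ^+ (c y : nat))%g y).
congr (_ * _)%g; rewrite -/(r y) {1}(lE (r y)) ?rin //.
by apply: eq_bigr => i _; rewrite ltn_ord.
Qed.

Lemma Phi_expg (gT : finGroupType) (T : {group gT}) x : p.-group T -> x \in T ->
  (x ^+ p)%g \in 'Phi(T).
Proof.
move=> pT Tx; have nx : x \in 'N('Phi(T)).
  by apply: (fintype.subsetP (normal_norm (Phi_normal T))).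
apply: coset_idr; first exact: groupX.
rewrite morphX //.
have abT := Phi_quotient_abelem pT.
have : coset 'Phi(T) x \in (T / 'Phi(T))%g by exact: mem_quotient.
by case/(abelemP p_pr): abT => _ h /h.
Qed.

Lemma der1_sub_Phi (gT : finGroupType) (T : {group gT}) : p.-group T ->
  (T^`(1))%g \subset 'Phi(T).
Proof.
move=> pT; apply: der1_min; first exact: normal_norm (Phi_normal T).
exact: abelem_abelian (Phi_quotient_abelem pT).
Qed.

Lemma hom_Phi_eq0 (gT : finGroupType) (T : {group gT}) (l : gT -> Fp) : p.-group T ->
  {in T &, forall x y, l (x * y)%g = (l x + l y)%R} ->
  {in 'Phi(T), forall x, l x = 0%R}.
Proof.
move=> pT lM x; have l1 : l 1%g = 0%R.
  by apply: (addrI (l 1%g)); rewrite -lM ?group1 // mulg1 addr0.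
have lV y : y \in T -> l y^-1%g = (- l y)%R.
  by move=> Ty; apply: (addrI (l y)); rewrite -lM ?groupV // mulgV l1 subrr.
have lX y k : y \in T -> l (y ^+ k)%g = (l y *+ k)%R.
  move=> Ty; elim: k => [|k IH]; first by rewrite expg0 mulr0n.
  by rewrite expgS lM ?groupX // IH mulrS.
have kg : group_set [set y in T | l y == 0%R]%SET.
  apply/group_setP; split; first by rewrite inE group1 l1 eqxx.
  move=> y z; rewrite !inE => /andP[Ty /eqP ly] /andP[Tz /eqP lz].
  by rewrite groupM // lM // ly lz addr0 eqxx.
suff : 'Phi(T) \subset Group kg by move=> /fintype.subsetP h /h; rewrite inE => /andP[_ /eqP].
rewrite (Phi_joing pT) join_subG; apply/andP; split.
  rewrite gen_subG; apply/fintype.subsetP => _ /imset2P[y z Ty Tz ->].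
  rewrite inE groupR //= /commg /conjg.
  rewrite !lM ?groupM ?groupV // !lV //.
  by apply/eqP; ring.
rewrite (MhoE 1 pT) gen_subG; apply/fintype.subsetP => _ /imsetP[y Ty ->].
by rewrite inE groupX //= lX // expn1 -mulr_natr (Fp_pnat0 p_pr) mulr0 eqxx.
Qed.

(** The image of Phi(T) in T/Z(T) meets the centre of that [p]-group, which gives an element of the
    second centre. Its last noncentral power among those with exponent p^k has commutators of order
    dividing p. *)
Lemma Phi_center_step (gT : finGroupType) (T : {group gT}) : p.-group T ->
  ~~ ('Phi(T) \subset 'Z(T)) ->
  exists a, [/\ a \in 'Phi(T), a \notin 'Z(T),
    {in T, forall y, [~ a, y]%g \in 'Z(T)} & {in T, forall y, ([~ a, y] ^+ p = 1)%g}].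
Proof.
move=> pT nPZ.
have nZ : T \subset 'N('Z(T)) := normal_norm (center_normal T).
have ntQ : ('Phi(T) / 'Z(T) != 1)%g.
  rewrite -subG1 quotient_sub1 //; exact: fintype.subset_trans (Phi_sub T) nZ.
have nilQ : nilpotent (T / 'Z(T)) := pgroup_nil (quotient_pgroup _ pT).
have := meet_center_nil nilQ (quotient_normal 'Z(T) (Phi_normal T)) ntQ.
case/trivgPn => q /setIP[/morphimP[a Na Pa eq] Zq] q1.
have Ta : a \in T by exact: (fintype.subsetP (Phi_sub T)).
have aZ2 : {in T, forall y, [~ a, y]%g \in 'Z(T)}.
  move=> y Ty; have Ny : y \in 'N('Z(T)) by exact: (fintype.subsetP nZ).
  apply: coset_idr; first by rewrite groupR.
  rewrite morphR //; apply/eqP/commgP.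
  have : coset 'Z(T) y \in (T / 'Z(T))%g by exact: mem_quotient.
  by move: Zq; rewrite eq => /centerP[_ h] /h.
have aZ : a \notin 'Z(T).
  by apply/negP => aZ; case/eqP: q1; rewrite eq; exact: coset_id.
have ZC z y : z \in 'Z(T) -> y \in T -> commute z y.
  by move=> /centerP[_ h] Ty; exact: h.
have aX k y : y \in T -> [~ (a ^+ k)%g, y]%g = ([~ a, y] ^+ k)%g.
  by move=> Ty; apply: commXg; apply/commute_sym; apply: ZC => //; exact: aZ2.
have exk : exists k, (a ^+ (p ^ k))%g \in 'Z(T).
  have [k ek] := p_natP (mem_p_elt pT Ta).
  by exists k; rewrite -ek expg_order group1.
case: (ex_minnP exk) => -[|k] hk kmin; first by rewrite expn0 expg1 (negbTE aZ) in hk.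
exists (a ^+ (p ^ k))%g; split.
- exact: groupX.
- by apply/negP => /kmin; rewrite ltnn.
- by move=> y Ty; rewrite aX // groupX // aZ2.
move=> y Ty; rewrite aX // -expgM -expnSr -aX //.
by apply/eqP; apply/commgP; exact: ZC.
Qed.

End PGroupFacts.

Section Embedding.
Variables (p : nat) (p_pr : prime p) (G : topGroupType).
Hypothesis cG : compact [set: G].
Local Notation Fp := 'F_p.
Variables (U : set G) (K m : nat) (x : 'I_m -> G -> nat).
Hypotheses (U_open : open_subgroup U) (hx : isotropic_family p U K.+1 x).
Local Notation xp i := (mod_p p (x i)).

Definition group_cob (gT : finGroupType) (A : {group gT}) (o : G -> G -> gT) : Prop :=
  exists2 b : G -> gT, smooth U b /\ (forall g, U g -> b g \in A) &
    forall g h, U g -> U h -> o g h = (b g * b h * (b (g * h)%g)^-1)%g.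

Lemma group_cob_pow (gT : finGroupType) (A : {group gT}) c (f : G -> G -> Fp) :
  c \in A -> (c ^+ p = 1)%g -> B2 U f -> group_cob A (fun g h => c ^+ (f g h : nat))%g.
Proof.
move=> Ac cp [b sb eb]; exists (fun g => c ^+ (b g : nat))%g.
  split; first exact: (smooth_comp (fun k : Fp => c ^+ (k : nat))%g sb).
  by move=> g Ug; exact: groupX.
move=> g h Ug Uh; have := eb g h Ug Uh => e.
have {}e : (f g h + b (g * h)%g = b g + b h)%R by rewrite e subrK.
apply: (mulIg (c ^+ (b (g * h)%g : nat))%g); rewrite mulgKV -!expg_FpD //.
by rewrite e.
Qed.

Lemma group_cob_mul (gT : finGroupType) (A : {group gT}) o o' : abelian A ->
  group_cob A o -> group_cob A o' -> group_cob A (fun g h => o g h * o' g h)%g.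
Proof.
move=> abA [b [sb Ab] eb] [b' [sb' Ab'] eb']; exists (fun g => b g * b' g)%g.
  split; first exact: (smooth_op (fun u v : gT => u * v)%g sb sb').
  by move=> g Ug; rewrite groupM ?Ab ?Ab'.
move=> g h Ug Uh; rewrite eb // eb' //.
have Ugh := osubM U_open Ug Uh.
have com u v : u \in A -> v \in A -> (u * v = v * u)%g by move=> Au Av; exact: (centsP abA).
move: (b g) (b h) (b (g * h)%g) (b' g) (b' h) (b' (g * h)%g)
  (Ab g Ug) (Ab h Uh) (Ab _ Ugh) (Ab' g Ug) (Ab' h Uh) (Ab' _ Ugh) => b1 b2 b3 c1 c2 c3 A1 A2 A3 B1 B2 B3.
rewrite invgM [(c3^-1 * b3^-1)%g]com ?groupV // -!mulgA; congr (_ * _)%g.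
rewrite !mulgA [(c1 * b2)%g]com // -!mulgA; congr (_ * _)%g.
rewrite !mulgA [(b3^-1 * c1)%g]com ?groupV // -!mulgA; congr (_ * _)%g.
by rewrite !mulgA [(b3^-1 * c2)%g]com ?groupV.
Qed.

Lemma group_cob1 (gT : finGroupType) (A : {group gT}) : group_cob A (fun _ _ => 1%g).
Proof.
exists (fun=> 1%g); first by split; [exact: (smooth_cst cG U_open) | move=> *; exact: group1].
by move=> *; rewrite mulg1 mulgV.
Qed.

Lemma group_cob_prod (gT : finGroupType) (A : {group gT}) n (o : nat -> G -> G -> gT) :
  abelian A -> (forall i, (i < n)%N -> group_cob A (o i)) ->
  group_cob A (fun g h => \prod_(i < n) o i g h)%g.
Proof.
move=> abA; elim: n => [_|n IH ho].
  have -> : (fun g h => \prod_(i < 0) o i g h)%g = (fun _ _ => 1%g).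
    by apply: funext => g; apply: funext => h; rewrite big_ord0.
  exact: group_cob1.
have -> : (fun g h => \prod_(i < n.+1) o i g h)%g =
          (fun g h => (\prod_(i < n) o i g h) * o n g h)%g.
  by apply: funext => g; apply: funext => h; rewrite big_ord_recr.
apply: group_cob_mul => //; last exact: ho.
by apply: IH => i /ltnW; exact: ho.
Qed.

Lemma group_cob_ext (gT : finGroupType) (A : {group gT}) o o' :
  (forall g h, U g -> U h -> o g h = o' g h) -> group_cob A o -> group_cob A o'.
Proof. by move=> e [b sb eb]; exists b => // g h Ug Uh; rewrite -e // eb. Qed.

(* The last clause fixes [phi] modulo the Frattini subgroup of [T], so that [phi] is
   onto as soon as the [t i] generate [T]. *)
Definition lifts_family (gT : finGroupType) (T : {group gT}) (t : 'I_m -> gT) (phi : G -> gT) :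
    Prop :=
  [/\ smooth U phi, forall g, U g -> phi g \in T,
      forall g h, U g -> U h -> phi (g * h)%g = (phi g * phi h)%g &
      forall l : gT -> Fp, {in T &, forall y z, l (y * z)%g = (l y + l z)%R} ->
        forall u, U u -> l (phi u) = (\sum_(i < m) xp i u * l (t i))%R].

Lemma smooth2_prodg (gT : finGroupType) n (o : nat -> G -> gT) :
  (forall i, (i < n)%N -> smooth U (o i)) -> smooth U (fun g => \prod_(i < n) o i g)%g.
Proof.
elim: n => [_|n IH ho].
  have -> : (fun g => \prod_(i < 0) o i g)%g = (fun=> 1%g).
    by apply: funext => g; rewrite big_ord0.
  exact: (smooth_cst cG U_open).
have -> : (fun g => \prod_(i < n.+1) o i g)%g = (fun g => (\prod_(i < n) o i g) * o n g)%g.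
  by apply: funext => g; rewrite big_ord_recr.
apply: (smooth_op (fun u v : gT => u * v)%g); last exact: ho.
by apply: IH => i /ltnW; exact: ho.
Qed.

(* Killing an obstruction that is a coboundary with values in a central subgroup of Phi(T). *)
Lemma lifts_family_correct (gT : finGroupType) (T A : {group gT}) (t : 'I_m -> gT) (psi : G -> gT) o :
  p.-group T -> A \subset 'Z(T) -> A \subset 'Phi(T) ->
  smooth U psi -> (forall g, U g -> psi g \in T) ->
  (forall g h, U g -> U h -> (psi g * psi h = psi (g * h) * o g h)%g) ->
  (forall l : gT -> Fp, {in T &, forall y z, l (y * z)%g = (l y + l z)%R} ->
        forall u, U u -> l (psi u) = (\sum_(i < m) xp i u * l (t i))%R) ->
  group_cob A o -> exists phi, lifts_family T t phi.
Proof.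
move=> pT AZ AP spsi Tpsi epsi lpsi [b [sb Ab] eb].
have Zb g : U g -> b g \in 'Z(T) by move=> /Ab; exact: (fintype.subsetP AZ).
have Tb g : U g -> b g \in T by move=> /Zb; exact: (fintype.subsetP (center_sub T)).
have com g y : U g -> y \in T -> (b g * y = y * b g)%g.
  by move=> /Zb /centerP[_ h] Ty; exact: h.
exists (fun g => psi g * (b g)^-1)%g; split.
- exact: (smooth_op (fun u v : gT => u * v^-1)%g spsi sb).
- by move=> g Ug; rewrite groupM ?groupV ?Tpsi ?Tb.
- move=> g h Ug Uh; have Ugh := osubM U_open Ug Uh.
  have -> : (psi g * (b g)^-1 * (psi h * (b h)^-1) = psi g * psi h * ((b g)^-1 * (b h)^-1))%g.
    rewrite -!mulgA; congr (_ * _)%g; rewrite !mulgA; congr (_ * _)%g.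
    by apply: (mulgI (b g)); rewrite mulKVg mulgA com ?Tpsi // mulgK.
  rewrite epsi // eb // -!mulgA; congr (_ * _)%g.
  have Tbi w : U w -> (b w)^-1%g \in T by move=> Uw; rewrite groupV Tb.
  rewrite -invgM [(b h * b g)%g]com ?Tb //.
  have {1}-> : (b (g * h)%g)^-1%g = ((b g * b h) * (b (g * h)%g)^-1 * (b g * b h)^-1)%g.
    have cw : commute (b (g * h)%g) (b g * b h)%g by apply: com => //; rewrite groupM ?Tb.
    by rewrite (commuteV (commute_sym cw)) mulgK.
  by rewrite !mulgA.
move=> l lM u Uu; rewrite lM ?groupV ?Tpsi ?Tb // lpsi //.
rewrite [X in (_ + X)%R](hom_Phi_eq0 p_pr pT lM) ?addr0 //.
by apply: (fintype.subsetP AP); rewrite groupV Ab.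
Qed.

End Embedding.

Section CentralCommutators.
Variables (gT : finGroupType) (T : {group gT}) (w : gT).
Hypotheses (Tw : w \in T) (wZ : {in T, forall y, [~ w, y]%g \in 'Z(T)}).

Lemma central_comm z y : z \in 'Z(T) -> y \in T -> commute z y.
Proof. by move=> /centerP[_ h] Ty; exact: h. Qed.

Lemma commgM_central y z : y \in T -> z \in T -> [~ w, (y * z)%g]%g = ([~ w, y] * [~ w, z])%g.
Proof.
move=> Ty Tz; rewrite commgMJ.
have /central_comm/(_ Tz) c := wZ Ty.
by rewrite [X in (_ * X)%g]/conjg c mulKg; apply: central_comm => //; [exact: wZ | rewrite groupR].
Qed.

Lemma commgX_central y k : y \in T -> [~ w, (y ^+ k)%g]%g = ([~ w, y] ^+ k)%g.
Proof.
move=> Ty; elim: k => [|k IH]; first by rewrite !expg0 commg1.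
by rewrite !expgS commgM_central ?groupX // IH.
Qed.

Lemma commXg_central y k : y \in T -> [~ (w ^+ k)%g, y]%g = ([~ w, y] ^+ k)%g.
Proof.
move=> Ty; apply: commXg; apply: commute_sym; apply: central_comm => //; exact: wZ.
Qed.

Lemma commg_prod_central n (f : nat -> gT) : (forall i, (i < n)%N -> f i \in T) ->
  [~ w, (\prod_(i < n) f i)%g]%g = (\prod_(i < n) [~ w, f i])%g.
Proof.
elim: n => [_|n IH hf]; first by rewrite !big_ord0 commg1.
rewrite !big_ord_recr /= commgM_central ?IH //; last exact: hf.
- by move=> i /ltnW; exact: hf.
- by apply: group_prod => i _; apply: hf; rewrite ltnS ltnW.
Qed.

End CentralCommutators.

Section EmbeddingTheorem.
Variables (p : nat) (p_pr : prime p) (G : topGroupType).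
Hypothesis cG : compact [set: G].
Local Notation Fp := 'F_p.
Variables (U : set G) (K m : nat) (x : 'I_m -> G -> nat).
Hypotheses (U_open : open_subgroup U) (hx : isotropic_family p U K.+1 x).
Local Notation xp i := (mod_p p (x i)).

Lemma hom_prodX (gT : finGroupType) (T : {group gT}) (l : gT -> Fp) n (t : nat -> gT)
    (k : nat -> nat) : {in T &, forall y z, l (y * z)%g = (l y + l z)%R} ->
  (forall i, (i < n)%N -> t i \in T) ->
  l (\prod_(i < n) t i ^+ k i)%g = (\sum_(i < n) (k i)%:R * l (t i))%R.
Proof.
move=> lM; have l1 : l 1%g = 0%R.
  by apply: (addrI (l 1%g)); rewrite -lM ?group1 // mulg1 addr0.
have lX y j : y \in T -> l (y ^+ j)%g = (j%:R * l y)%R.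
  move=> Ty; elim: j => [|j IH]; first by rewrite expg0 mul0r.
  by rewrite expgS lM ?groupX // IH -natr1 mulrDl mul1r addrC.
elim: n => [_|n IH ht]; first by rewrite !big_ord0.
rewrite !big_ord_recr /= lM ?groupX ?ht // ?lX ?ht // ?IH //.
  by move=> i /ltnW; exact: ht.
by apply: group_prod => i _; apply: groupX; apply: ht; rewrite ltnS ltnW.
Qed.

(** Extends a family to all natural numbers, so that products over initial segments can be treated
    by induction. *)
Definition ext_ord (X : Type) (d : X) (f : 'I_m -> X) (i : nat) : X :=
  if insub i is Some j then f j else d.

Lemma ext_ordE (X : Type) (d : X) f (i : 'I_m) : ext_ord d f i = f i.
Proof. by rewrite /ext_ord valK. Qed.

Lemma B2_add (f f' : G -> G -> Fp) : B2 U f -> B2 U f' -> B2 U (fun g h => f g h + f' g h)%R.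
Proof.
move=> [b sb eb] [b' sb' eb']; exists (fun g => b g + b' g)%R.
  exact: (smooth_op (fun u v => u + v)%R sb sb').
by move=> g h Ug Uh; rewrite eb // eb' //; ring.
Qed.

Lemma B2_sum n (f : 'I_n -> G -> G -> Fp) : (forall i, B2 U (f i)) ->
  B2 U (fun g h => \sum_i f i g h)%R.
Proof.
elim: n f => [|n IH] f hf.
  exists (fun=> 0%R); first exact: (smooth_cst cG U_open).
  by move=> g h _ _; rewrite big_ord0; ring.
have -> : (fun g h => \sum_i f i g h)%R =
          (fun g h => f ord0 g h + \sum_(i < n) f (lift ord0 i) g h)%R.
  by apply: funext => g; apply: funext => h; rewrite big_ord_recl.
by apply: B2_add => //; exact: IH.
Qed.

Lemma expg_nat_hom (gT : finGroupType) (y : gT) (c : G -> nat) g h :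
  (y ^+ (p ^ K.+1) = 1)%g -> nat_hom_mod p U K.+1 c -> U g -> U h ->
  (y ^+ c (g * h)%g = y ^+ c g * y ^+ c h)%g.
Proof.
move=> y1 [_ hc] Ug Uh; rewrite -expgD -(expg_mod _ y1) hc //.
by rewrite expg_mod.
Qed.

(** The product of the t_i^(x_i(g)) is multiplicative up to commutators. As commutators and p-th
    powers are central, collection produces factors [t_k, t_i]^(x_k(g) x_i(h)) with i < k. Their
    exponents modulo p are cup products of distinct members of the family, hence coboundaries. *)
Lemma lifts_family_base (gT : finGroupType) (T : {group gT}) (t : 'I_m -> gT) :
  p.-group T -> (forall i, t i \in T) -> {in T, forall y, y ^+ (p ^ K.+1) = 1}%g ->
  'Phi(T) \subset 'Z(T) -> exists phi, lifts_family p U x T t phi.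
Proof.
move=> pT Tt expT PZ.
pose tn := ext_ord 1%g t; pose xn := ext_ord (fun=> 0%N) x.
have Ttn i : tn i \in T by rewrite /tn /ext_ord; case: insubP => [j _ _|_]; rewrite ?group1.
have hxn i : (i < m)%N -> nat_hom_mod p U K.+1 (xn i).
  by move=> im; rewrite -[i]/(val (Ordinal im)) /xn ext_ordE; case: hx.
have DP := der1_sub_Phi pT.
have DZ : T^`(1)%g \subset 'Z(T) := fintype.subset_trans DP PZ.
have abD : abelian T^`(1)%g.
  by apply: abelianS DZ _; exact: center_abelian.
have RD y z : y \in T -> z \in T -> [~ y, z]%g \in T^`(1)%g by move=> Ty Tz; exact: mem_commg.
have RZ y z : y \in T -> z \in T -> [~ y, z]%g \in 'Z(T).
  by move=> Ty Tz; apply: (fintype.subsetP DZ); exact: RD.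
pose s k g := (\prod_(i < k) tn i ^+ xn i g)%g.
have Ts k g : s k g \in T by apply: group_prod => i _; exact: groupX.
have main k : (k <= m)%N -> exists2 o, group_cob U [group of T^`(1)%g] o &
    forall g h, U g -> U h -> o g h \in T^`(1)%g /\ (s k g * s k h = s k (g * h) * o g h)%g.
  elim: k => [_|k IH km].
    exists (fun _ _ => 1%g); first exact: (group_cob1 cG U_open).
    by move=> g h _ _; rewrite /s !big_ord0 !mulg1 group1.
  have [w co eo] := IH (ltnW km).
  pose c g h := (\prod_(i < k) [~ tn k, tn i] ^+ (xn k g * xn i h))%g.
  have Dc g h : c g h \in T^`(1)%g by apply: group_prod => i _; apply: groupX; exact: RD.
  exists (fun g h => w g h * c g h)%g.
    apply: (group_cob_mul U_open abD co).
    apply: (group_cob_prod cG U_open (o := fun i g h => [~ tn k, tn i] ^+ (xn k g * xn i h))%g abD).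
    move=> i ik; have im := ltn_trans ik km.
    have cp1 : ([~ tn k, tn i] ^+ p = 1)%g.
      rewrite -(commXg_central _ (w := tn k) (T := T)) //; last by move=> y Ty; exact: RZ.
      apply/eqP/commgP; apply: (central_comm (T := T)) => //.
      by apply: (fintype.subsetP PZ); exact: Phi_expg.
    have b2 : B2 U (cp (mod_p p (xn k)) (mod_p p (xn i))).
      rewrite -[k]/(val (Ordinal km)) -[i]/(val (Ordinal im)) /xn !ext_ordE.
      case: hx => _ h _ _; apply: h; rewrite -val_eqE /=; lia.
    apply: group_cob_ext (group_cob_pow p_pr (RD _ _ (Ttn k) (Ttn i)) cp1 b2) => g h _ _.
    by rewrite /cp /mod_p -natrM expg_Fp.
  move=> g h Ug Uh; have [Do e] := eo g h Ug Uh; split; first exact: groupM.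
  have -> : s k.+1 g = (s k g * tn k ^+ xn k g)%g by rewrite /s big_ord_recr.
  have -> : s k.+1 h = (s k h * tn k ^+ xn k h)%g by rewrite /s big_ord_recr.
  have -> : s k.+1 (g * h)%g = (s k (g * h) * tn k ^+ xn k (g * h))%g by rewrite /s big_ord_recr.
  rewrite (expg_nat_hom _ (hxn _ km)) //; last exact: expT.
  have ec : [~ (tn k ^+ xn k g)%g, s k h]%g = c g h.
    have Z1 : {in T, forall y, [~ (tn k ^+ xn k g)%g, y]%g \in 'Z(T)}.
      by move=> y Ty; apply: RZ => //; exact: groupX.
    have Tk : tn k ^+ xn k g \in T by exact: groupX.
    have Tf i : (i < k)%N -> tn i ^+ xn i h \in T by move=> _; exact: groupX.
    rewrite /s (commg_prod_central Tk Z1 Tf).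
    apply: eq_bigr => i _.
    rewrite (commgX_central Tk Z1 (xn i h) (Ttn i)).
    have Zk : {in T, forall y, [~ tn k, y]%g \in 'Z(T)} by move=> y Ty; exact: RZ.
    by rewrite (commXg_central (Ttn k) Zk (xn k g) (Ttn i)) -expgM.
  have Zo := fintype.subsetP DZ _ Do; have Zc := fintype.subsetP DZ _ (Dc g h).
  transitivity (s k g * s k h * (tn k ^+ xn k g * c g h) * tn k ^+ xn k h)%g.
    rewrite -!mulgA; congr (_ * _)%g; rewrite !mulgA; congr (_ * _)%g.
    by rewrite -ec -commgC.
  rewrite e -!mulgA; congr (_ * _)%g.
  have c1 y : y \in T -> (w g h * y = y * w g h)%g by move=> Ty; exact: (central_comm Zo).
  have c2 y : y \in T -> (c g h * y = y * c g h)%g by move=> Ty; exact: (central_comm Zc).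
  rewrite [(c g h * _)%g]c2 ?groupX // !mulgA; congr (_ * _)%g.
  by rewrite c1 ?groupX // -!mulgA c1 ?groupX.
have [w co eo] := main m (leqnn m).
apply: (lifts_family_correct p_pr U_open (psi := s m) (A := [group of T^`(1)%g]) pT DZ DP _ _ _ _ co).
- apply: (smooth2_prodg cG U_open (o := fun i g => tn i ^+ xn i g)%g) => i im.
  exact: (smooth_comp (fun k => tn i ^+ k)%g (hxn i im).1).
- by [].
- by move=> g h Ug Uh; have [_] := eo g h Ug Uh.
move=> l lM u Uu.
rewrite (hom_prodX (fun i => xn i u) lM (fun i _ => Ttn i)).
by apply: eq_bigr => i _; rewrite /tn /xn !ext_ordE.
Qed.

Lemma coset_invg (gT : finGroupType) (A : {group gT}) y : y \in 'N(A) ->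
  coset A y^-1%g = ((coset A y)^-1)%g.
Proof. by move=> Ny; exact: (morphV (coset_morphism A)). Qed.

Lemma coset_section (gT : finGroupType) (T A : {group gT}) (q : coset_of A) :
  normal A T -> q \in (T / A)%g -> repr q \in T /\ coset A (repr q) = q.
Proof.
move=> nAT qTA; have e := coset_reprK q; split=> //.
rewrite -(quotientGK nAT); apply/morphpreP; split; first exact: repr_coset_norm.
by rewrite /= e.
Qed.

(** As [l] vanishes on [A], it factors through T/A, where the property of [phi] applies. *)
Lemma lifts_family_section (gT : finGroupType) (T A : {group gT}) (t : 'I_m -> gT)
    (phi : G -> coset_of A) (l : gT -> Fp) : normal A T -> (forall i, t i \in T) ->
  lifts_family p U x (T / A)%G (fun i => coset A (t i)) phi ->
  {in T &, forall y z, l (y * z)%g = (l y + l z)%R} -> {in A, forall y, l y = 0%R} ->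
  forall u, U u -> l (repr (phi u)) = (\sum_(i < m) xp i u * l (t i))%R.
Proof.
move=> nAT Tt [_ Tphi _ lphi] lM lA u Uu.
have nT y : y \in T -> y \in 'N(A) by apply: (fintype.subsetP (normal_norm nAT)).
have lc y z : y \in T -> z \in T -> coset A y = coset A z -> l y = l z.
  move=> Ty Tz e; have Ayz : (y * z^-1)%g \in A.
    apply: coset_idr; first by rewrite groupM ?groupV ?nT.
    by rewrite coset_morphM ?groupV ?nT // e coset_invg ?nT // mulgV.
  by rewrite -(mulgKV z y) lM ?groupM ?groupV // lA // add0r.
pose lb (q : coset_of A) := l (repr q).
have lbE y : y \in T -> lb (coset A y) = l y.
  move=> Ty; have [Tr er] := coset_section nAT (mem_quotient A Ty).
  exact: lc.
have lbM : {in (T / A)%g &, forall q q', lb (q * q')%g = (lb q + lb q')%R}.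
  move=> q q' hq hq'; have [Tq eq] := coset_section nAT hq.
  have [Tq' eq'] := coset_section nAT hq'.
  rewrite -{1}eq -{1}eq' -coset_morphM ?nT // lbE ?groupM // lM //.
rewrite -[LHS]/(lb (phi u)) lphi //.
by apply: eq_bigr => i _; rewrite lbE.
Qed.

Lemma prod_abelianM (gT : finGroupType) (A : {group gT}) n (f f' : nat -> gT) :
  abelian A -> (forall i, (i < n)%N -> f i \in A) -> (forall i, (i < n)%N -> f' i \in A) ->
  (\prod_(i < n) (f i * f' i) = (\prod_(i < n) f i) * \prod_(i < n) f' i)%g.
Proof.
move=> abA; elim: n => [_ _|n IH hf hf']; first by rewrite !big_ord0 mulg1.
rewrite !big_ord_recr /= IH; [|by move=> i /ltnW; auto..].
have P : (\prod_(i < n) f' i)%g \in A.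
  by apply: group_prod => i _; apply: hf'; rewrite ltnS ltnW.
rewrite -!mulgA; congr (_ * _)%g; rewrite !mulgA; congr (_ * _)%g.
exact: (centsP abA _ P _ (hf n (ltnSn n))).
Qed.

Lemma prod_abelianX (gT : finGroupType) (A : {group gT}) n (f : nat -> gT) k :
  abelian A -> (forall i, (i < n)%N -> f i \in A) ->
  ((\prod_(i < n) f i) ^+ k = \prod_(i < n) f i ^+ k)%g.
Proof.
move=> abA hf; elim: k => [|k IH].
  by rewrite expg0 big1 // => i _; rewrite expg0.
have hfk i : (i < n)%N -> f i ^+ k \in A by move=> im; apply: groupX; exact: hf.
rewrite expgS IH -(prod_abelianM abA hf hfk).
by apply: eq_bigr => i _; rewrite expgS.
Qed.

(** A set-theoretic lift [psi1] of [phi] fails to be multiplicative by some [w] in [A]. Multiplying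
    it by a^N, with [N] additive modulo an exponent of [T], contributes [a, psi1(h)]^N(g), whose
    i-th coordinate is the cup product of [N] with [x i]. [N] is a sum of characters, the k-th of
    which cancels the k-th coordinate of [w] and is orthogonal to the other [x i]. Since [a] lies in
    Phi(T), nothing changes modulo Phi(T). *)
Lemma lifts_family_step (gT : finGroupType) (T : {group gT}) (t : 'I_m -> gT) a :
  p.-group T -> (forall i, t i \in T) ->
  (forall H : {group gT}, (forall i, t i \in H) -> T \subset H) ->
  {in T, forall y, y ^+ (p ^ K.+1) = 1}%g ->
  a \in 'Phi(T) -> {in T, forall y, [~ a, y]%g \in 'Z(T)} ->
  {in T, forall y, ([~ a, y] ^+ p = 1)%g} ->
  let A := span_group (fun i => [~ a, ext_ord 1%g t i]%g) m in
  (exists phi, lifts_family p U x (T / A)%G (fun i => coset A (t i)) phi) ->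
  exists phi, lifts_family p U x T t phi.
Proof.
move=> pT Tt genT expT Pa aZ ap A [phi hphi].
have Ta : a \in T := fintype.subsetP (Phi_sub T) _ Pa.
pose tn := ext_ord 1%g t; pose e i := [~ a, tn i]%g.
have Ttn i : tn i \in T by rewrite /tn /ext_ord; case: insubP => [j _ _|_]; rewrite ?group1.
have AZ : A \subset 'Z(T) by apply: span_group_sub => i _; apply: aZ.
have AP : A \subset 'Phi(T).
  apply: span_group_sub => i _; apply: (fintype.subsetP (der1_sub_Phi pT)).
  by apply: mem_commg.
have AT : A \subset T := fintype.subset_trans AZ (center_sub T).
have nAT : normal A T by exact: sub_center_normal.
have abA : abelian A := abelianS AZ (center_abelian T).
have Ae i : (i < m)%N -> e i \in A by exact: mem_span_group.
have ep i : (e i ^+ p = 1)%g by exact: ap.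
have eA : p.-abelem A.
  apply/(abelemP p_pr); split=> // y Ay.
  have kg : group_set [set z in A | (z ^+ p)%g == 1%g]%SET.
    apply/group_setP; split; first by rewrite inE group1 expg1n eqxx.
    move=> u v; rewrite !inE => /andP[Au /eqP up] /andP[Av /eqP vp].
    rewrite groupM //= expgMn; last exact: (centsP abA).
    by rewrite up vp mulg1 eqxx.
  have : A \subset Group kg.
    by apply: span_group_sub => i im; rewrite inE Ae //=; apply/eqP; exact: ep.
  by move=> /fintype.subsetP/(_ y Ay); rewrite inE => /andP[_ /eqP].
have [l [lM lE]] := abelem_coordinates p_pr eA.
have [sphi Tphi phiM _] := hphi.
pose psi1 g := repr (phi g).
have psi1T g : U g -> psi1 g \in T /\ coset A (psi1 g) = phi g.
  by move=> /Tphi; exact: coset_section.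
have nT y : y \in T -> y \in 'N(A) by apply: (fintype.subsetP (normal_norm nAT)).
pose w g h := ((psi1 (g * h)%g)^-1 * (psi1 g * psi1 h))%g.
have Aw g h : U g -> U h -> w g h \in A.
  move=> Ug Uh; have [T1 c1] := psi1T g Ug; have [T2 c2] := psi1T h Uh.
  have [T3 c3] := psi1T _ (osubM U_open Ug Uh).
  apply: coset_idr; first by rewrite !groupM ?groupV ?nT.
  rewrite coset_morphM ?groupV ?groupM ?nT // coset_invg ?nT // coset_morphM ?nT //.
  by rewrite c1 c2 c3 phiM // mulVg.
have psi1M g h : (psi1 g * psi1 h = psi1 (g * h) * w g h)%g by rewrite /w mulKVg.
have spsi1 : smooth U psi1 by exact: (smooth_comp (fun q : coset_of A => repr q) sphi).
have sw : smooth2 U w.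
  have s1 := smooth2_op (fun u v : gT => u * v)%g (smooth2_l spsi1) (smooth2_r spsi1).
  exact: (smooth2_op (fun u v : gT => u^-1 * v)%g (smooth2_mul U_open spsi1) s1).
clearbody w.
have zl k : Z2 U (fun g h => l k (w g h)).
  split; first exact: (smooth2_comp (fun u : gT => l k u) sw).
  move=> g h j Ug Uh Uj; have Ugh := osubM U_open Ug Uh; have Uhj := osubM U_open Uh Uj.
  have cA z y : z \in A -> y \in T -> (z * y = y * z)%g.
    by move=> /(fintype.subsetP AZ) Zz; exact: central_comm.
  have assoc : (w g (h * j)%g * w h j = w (g * h)%g j * w g h)%g.
    have : (psi1 g * (psi1 h * psi1 j) = psi1 g * psi1 h * psi1 j)%g by rewrite mulgA.
    rewrite [(psi1 h * psi1 j)%g]psi1M [(psi1 g * psi1 h)%g]psi1M.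
    have [Tj _] := psi1T j Uj.
    rewrite -[RHS]mulgA (cA (w g h)) ?Aw // !mulgA !psi1M mulgA => eq.
    by apply: (mulgI (psi1 (g * h * j)%g)); rewrite !mulgA.
  have := congr1 (l k) assoc; rewrite !lM ?Aw // => eq.
  transitivity ((l k (w g (h * j)%g) + l k (w h j)) - (l k (w (g * h)%g j) + l k (w g h)))%R.
    by ring.
  by rewrite eq subrr.
have lw k (kk : (k < m)%N) : exists c, nat_hom_mod p U K.+1 c /\
    forall i, (i < m)%N -> B2 U (fun g h => cp (mod_p p c) (mod_p p (ext_ord (fun=> 0%N) x i)) g h
      + (i == k)%:R * l k (w g h))%R.
  have [_ _ h3 _] := hx.
  have zf : Z2 U (fun g h => -1 * l k (w g h) + 0)%R.
    by apply: Z2_lin => //; exact: (Z2_0 p cG U_open).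
  have [c hc [b1 b2]] := h3 _ (Ordinal kk) zf; exists c; split=> // i im.
  rewrite -[i]/(val (Ordinal im)) ext_ordE.
  have [/eqP eik|nik] := boolP (Ordinal im == Ordinal kk).
    rewrite eik /=; apply: B2_ext b1 => g h _ _; rewrite eqxx mul1r; ring.
  apply: B2_ext (b2 _ nik) => g h _ _.
  by move: nik; rewrite -val_eqE /= => /negbTE ->; rewrite mul0r addr0.
have /choice [ch hch] : forall k : 'I_m, exists c, nat_hom_mod p U K.+1 c /\
    forall i, (i < m)%N -> B2 U (fun g h => cp (mod_p p c) (mod_p p (ext_ord (fun=> 0%N) x i)) g h
      + (i == k)%:R * l k (w g h))%R by move=> k; exact: lw.
pose N g := (\sum_(k < m) ch k g)%N.
have hN : nat_hom_mod p U K.+1 N.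
  split.
    have gen n (f : 'I_n -> G -> nat) : (forall k, smooth U (f k)) ->
        smooth U (fun g => \sum_(k < n) f k g)%N.
      elim: n f => [|n IH] f hf.
        apply: smooth_ext (smooth_cst cG U_open 0%N) => // g _; by rewrite big_ord0.
      have -> : (fun g => \sum_(k < n.+1) f k g)%N =
          (fun g => f ord0 g + \sum_(k < n) f (lift ord0 k) g)%N.
        by apply: funext => g; rewrite big_ord_recl.
      by apply: (smooth_op addn) => //; exact: IH.
    by apply: gen => k; have [[]] := hch k.
  move=> g h Ug Uh; rewrite /N -big_split /=.
  apply: (big_ind2 (fun u v => u = v %[mod p ^ K.+1])) => // [u1 u2 v1 v2 e1 e2|k _].
    by rewrite -modnDm e1 e2 modnDm.
  by have [[_ ->]] := hch k.
have Aap y : y \in T -> [~ a, y]%g \in A.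
  have gS : group_set [set z in T | [~ a, z]%g \in A]%SET.
    apply/group_setP; split; first by rewrite inE group1 commg1 group1.
    move=> u v; rewrite !inE => /andP[Tu Au] /andP[Tv Av].
    by rewrite groupM //= (commgM_central Ta aZ) // groupM.
  have : T \subset Group gS.
    apply: genT => i; rewrite inE Tt /=; have := Ae i (ltn_ord i).
    by rewrite /e /tn ext_ordE.
  by move=> /fintype.subsetP h /h; rewrite inE => /andP[].
have l1 k : l k 1%g = 0%R.
  by apply: (addrI (l k 1%g)); rewrite -lM ?group1 // mulg1 addr0.
have eqA y z : y \in A -> z \in A -> (forall k, l k y = l k z) -> y = z.
  by move=> Ay Az eyz; rewrite (lE y Ay) (lE z Az); apply: eq_bigr => i _; rewrite eyz.
have cA z y : z \in A -> y \in T -> (z * y = y * z)%g.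
  by move=> /(fintype.subsetP AZ) Zz; exact: central_comm.
pose xn := ext_ord (fun=> 0%N) x.
have ac h : U h -> [~ a, psi1 h]%g = (\prod_(i < m) e i ^+ xn i h)%g.
  move=> Uh; have [Th _] := psi1T h Uh.
  apply: eqA => [||k]; first exact: Aap.
    by apply: group_prod => i _; apply: groupX; exact: Ae.
  have lkM : {in T &, forall y z, l k [~ a, (y * z)%g]%g = (l k [~ a, y]%g + l k [~ a, z]%g)%R}.
    by move=> y z Ty Tz; rewrite (commgM_central Ta aZ) // lM ?Aap.
  have lkA : {in A, forall y, l k [~ a, y]%g = 0%R}.
    move=> y Ay; have -> : [~ a, y]%g = 1%g by apply/eqP/commgP; rewrite /commute -cA.
    exact: l1.
  rewrite (lifts_family_section (l := fun y => l k [~ a, y]%g) nAT Tt hphi lkM lkA) //.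
  rewrite (hom_prodX (fun i => xn i h) (lM k) (fun i im => Ae i im)).
  by apply: eq_bigr => i _; rewrite /xn /e /tn !ext_ordE.
pose w2 g h := ([~ a, psi1 h] ^+ N g)%g.
have H3 : group_cob U A (fun g h => w g h * w2 g h)%g.
  pose H i g h := (l i (w g h) + cp (mod_p p N) (mod_p p (xn i)) g h)%R.
  have bH i : (i < m)%N -> B2 U (H i).
    move=> im; have := B2_sum (fun k => (hch k).2 i im).
    apply: B2_ext => g h _ _; rewrite big_split /= addrC /H; congr (_ + _)%R.
      rewrite (bigD1 (Ordinal im)) //= eqxx mul1r big1 ?addr0 // => k.
      by rewrite -val_eqE /= eq_sym => /negbTE ->; rewrite mul0r.
    by rewrite /cp /mod_p /N natr_sum big_distrl.
  have cH i : (i < m)%N -> group_cob U A (fun g h => e i ^+ (H i g h : nat))%g.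
    by move=> im; exact: (group_cob_pow p_pr (Ae i im) (ep i) (bH i im)).
  have := group_cob_prod cG U_open (o := fun i g h => e i ^+ (H i g h : nat))%g abA cH.
  apply: group_cob_ext => g h Ug Uh.
  have A1 i : (i < m)%N -> (e i ^+ xn i h)%g \in A by move=> im; apply: groupX; exact: Ae.
  have A2 i : (i < m)%N -> ((e i ^+ xn i h) ^+ N g)%g \in A by move=> im; apply: groupX; exact: A1.
  have A3 i : (i < m)%N -> (e i ^+ (l i (w g h) : nat))%g \in A.
    by move=> im; apply: groupX; exact: Ae.
  rewrite /w2 ac // (prod_abelianX _ abA A1) [w g h]lE ?Aw // -(prod_abelianM abA A3 A2).
  apply: eq_bigr => i _; rewrite /H expg_FpD //; congr (_ * _)%g.
  by rewrite /cp /mod_p -natrM expg_Fp // mulnC expgM.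
apply: (lifts_family_correct p_pr U_open (psi := fun g => (psi1 g * a ^+ N g)%g) pT AZ AP _ _ _ _ H3).
- apply: (smooth_op (fun u v : gT => u * v)%g spsi1).
  exact: (smooth_comp (fun k => a ^+ k)%g hN.1).
- by move=> g Ug; rewrite groupM ?groupX //; exact: (psi1T g Ug).1.
- move=> g h Ug Uh.
  have [Th _] := psi1T h Uh.
  have Aw2 : w2 g h \in A by apply: groupX; exact: Aap.
  rewrite (expg_nat_hom _ hN) //; last exact: expT.
  transitivity (psi1 g * psi1 h * (a ^+ N g * w2 g h) * a ^+ N h)%g.
    have c1 : (a ^+ N g * psi1 h = psi1 h * (a ^+ N g * w2 g h))%g.
      by rewrite /w2 -(commXg_central Ta aZ) // mulgA -commgC.
    by rewrite -[LHS]mulgA [(a ^+ N g * (psi1 h * _))%g]mulgA c1 !mulgA.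
  rewrite psi1M -!mulgA; congr (_ * _)%g.
  have Tak k : (a ^+ k)%g \in T by exact: groupX.
  have Taa : (a ^+ N g * a ^+ N h)%g \in T by exact: groupM.
  rewrite [(w2 g h * _)%g](cA _ _ Aw2 (Tak _)).
  transitivity (w g h * (a ^+ N g * a ^+ N h) * w2 g h)%g; first by rewrite !mulgA.
  by rewrite (cA _ _ (Aw g h Ug Uh) Taa) !mulgA.
move=> f fM u Uu.
have fP := hom_Phi_eq0 p_pr pT fM.
rewrite fM ?groupX ?(psi1T u Uu).1 // [f (a ^+ _)%g]fP ?groupX // addr0.
apply: (lifts_family_section nAT Tt hphi fM) => // y Ay.
by apply: fP; exact: (fintype.subsetP AP).
Qed.

(** Induction on the order of [T]: as long as Phi(T) is not central, the nontrivial central subgroup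
    generated by the commutators of [a] with the generators is divided out. *)
Theorem lifts_family_exists (gT : finGroupType) (T : {group gT}) (t : 'I_m -> gT) :
  p.-group T -> (forall i, t i \in T) ->
  (forall H : {group gT}, (forall i, t i \in H) -> T \subset H) ->
  {in T, forall y, y ^+ (p ^ K.+1) = 1}%g ->
  exists phi, lifts_family p U x T t phi.
Proof.
move: {2}#|T| (leqnn #|T|) => n; elim: n gT T t => [|n IH] gT T t le pT Tt genT expT.
  by move: le; rewrite leqNgt cardG_gt0.
have [PZ|nPZ] := boolP ('Phi(T) \subset 'Z(T)); first exact: lifts_family_base.
have [a [Pa naZ aZ ap]] := Phi_center_step pT nPZ.
apply: (lifts_family_step pT Tt genT expT Pa aZ ap).
set A := span_group _ _.
have Ta : a \in T := fintype.subsetP (Phi_sub T) _ Pa.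
have AZ : A \subset 'Z(T).
  by apply: span_group_sub => i im; apply: aZ; rewrite -[i]/(val (Ordinal im)) ext_ordE.
have nAT : normal A T by exact: sub_center_normal.
have ntA : A != 1%G.
  apply/negP => /eqP A1; case/negP: naZ; apply/centerP; split=> // y Ty.
  have gS : group_set [set z in T | [~ a, z]%g == 1%g]%SET.
    apply/group_setP; split; first by rewrite inE group1 commg1 eqxx.
    move=> u v; rewrite !inE => /andP[Tu /eqP Au] /andP[Tv /eqP Av].
    by rewrite groupM //= (commgM_central Ta aZ) // Au Av mulg1.
  have : T \subset Group gS.
    apply: genT => i; rewrite inE Tt /=; apply/eqP/set1gP.
    have : [~ a, ext_ord 1%g t i]%g \in A by exact: (mem_span_group _ (ltn_ord i)).
    by rewrite A1 ext_ordE.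
  by move=> /fintype.subsetP/(_ y Ty); rewrite inE => /andP[_ /commgP].
apply: IH.
- rewrite -ltnS; apply: leq_trans le; apply: ltn_quotient => //.
  exact: fintype.subset_trans AZ (center_sub T).
- exact: quotient_pgroup.
- by move=> i; exact: mem_quotient.
- move=> H hH; apply/fintype.subsetP => _ /morphimP[y Ny Ty ->].
  have TH : T \subset (coset A @*^-1 H)%G.
    apply: genT => i; apply/morphpreP; split; last exact: hH.
    exact: fintype.subsetP (normal_norm nAT) _ (Tt i).
  by move/fintype.subsetP/(_ y Ty): TH => /morphpreP[].
move=> _ /morphimP[y Ny Ty ->]; rewrite -morphX // expT //; exact: morph1.
Qed.

(* The homomorphism is onto because its image lies in no maximal subgroup: modulo
   such a subgroup it would give a relation between the [x i]. *)
Theorem pgroup_quotient_exists (gT : finGroupType) (T : {group gT}) (t : 'I_m -> gT) :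
  p.-group T -> (forall i, t i \in T) ->
  (forall H : {group gT}, (forall i, t i \in H) -> T \subset H) ->
  {in T, forall y, y ^+ (p ^ K.+1) = 1}%g ->
  exists phi : G -> gT, [/\ smooth U phi, forall g, U g -> phi g \in T,
    forall g h, U g -> U h -> phi (g * h)%g = (phi g * phi h)%g &
    forall y, y \in T -> exists2 g, U g & phi g = y].
Proof.
move=> pT Tt genT expT.
have [phi [sphi Tphi phiM lphi]] := lifts_family_exists pT Tt genT expT.
exists phi; split=> // y Ty.
have gI : group_set [set z | `[< exists2 g, U g & phi g = z >]]%SET.
  apply/group_setP; split.
    rewrite inE; apply/asboolP; exists 1%g; first exact: osub1.
    have e := phiM _ _ (osub1 U_open) (osub1 U_open).
    by apply: (mulgI (phi 1%g)); rewrite mulg1 -e mulg1.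
  move=> u v; rewrite !inE => -[g Ug <-] [h Uh <-].
  by exists (g * h)%g; [exact: osubM | rewrite phiM].
have IT : Group gI \subset T.
  by apply/fintype.subsetP => z; rewrite inE => /asboolP[g Ug <-]; exact: Tphi.
case: (maximal_exists IT) => [eIT|[M maxM IM]].
  have : y \in (Group gI : {set gT}) by rewrite eIT.
  by rewrite inE => /asboolP.
have [l [lM lK [s Ts ls]]] := pgroup_maximal_hom p_pr pT maxM.
have [_ _ _ ind] := hx.
have l0 : forall i, l (t i) = 0%R.
  apply: ind => u Uu.
  have : l (phi u) = 0%R.
    apply/lK; first exact: Tphi.
    apply: (fintype.subsetP IM); rewrite inE; apply/asboolP; by exists u.
  rewrite lphi // => e; apply: etrans e; by apply: eq_bigr => i _; rewrite mulrC.
have TM : T \subset M by apply: genT => i; apply/lK.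
have : l s = 0%R by apply/lK => //; exact: (fintype.subsetP TM).
by rewrite ls => /eqP; rewrite oner_eq0.
Qed.

End EmbeddingTheorem.

(** * Free quotients and the order of verbal sections *)

Section FreeRank.
Variables (p : nat) (p_pr : prime p) (G : topGroupType).
Hypothesis cG : compact [set: G].
Local Notation Fp := 'F_p.

Definition gen_by (gT : finGroupType) (T : {group gT}) n (t : 'I_n -> gT) : Prop :=
  (forall i, t i \in T) /\ forall H : {group gT}, (forall i, t i \in H) -> T \subset H.

Definition onto_hom (U : set G) (gT : finGroupType) (T : {group gT}) (phi : G -> gT) : Prop :=
  [/\ smooth U phi, forall g, U g -> phi g \in T,
      forall g h, U g -> U h -> phi (g * h)%g = (phi g * phi h)%g &
      forall y, y \in T -> exists2 g, U g & phi g = y].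

Definition free_rank (U : set G) (m : nat) : Prop :=
  forall (gT : finGroupType) (T : {group gT}) (t : 'I_m -> gT),
    p.-group T -> gen_by T t -> exists phi : G -> gT, onto_hom U T phi.

(** The family is needed only modulo a power of p that annihilates [T], and the order of [T]
    provides one. *)
Lemma pd_free_rank (U : set G) (tr : (G -> G -> Fp) -> Fp) m : open_subgroup U ->
  pd_trace U tr -> dimge U (hom1 (p := p) U) (m.*2).+1 -> free_rank U m.
Proof.
move=> oU htr hd gT T t pT [Tt genT].
have [k ek] := p_natP pT.
have [x hx] := isotropic_family_exists p_pr cG oU htr k hd.
apply: (pgroup_quotient_exists p_pr cG oU hx pT Tt genT) => y Ty.
by apply/eqP; rewrite -order_dvdn expnS -ek dvdn_mull // order_dvdG.
Qed.

Lemma free_rank_power (U : set G) m (gT : finGroupType) (T : {group gT}) s (t : 'I_s -> gT) q :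
  free_rank U m -> p.-group T -> gen_by T t -> (q * s <= m)%N ->
  exists phi : G -> {dffun forall i : 'I_q, gT}, onto_hom U (setXn_group (fun _ : 'I_q => T)) phi.
Proof.
move=> hU pT [Tt genT] qs.
pose de (k : 'I_q) (y : gT) : {dffun forall i : 'I_q, gT} := [ffun i => if i == k then y else 1%g].
have deM k y z : de k (y * z)%g = (de k y * de k z)%g.
  by apply/ffunP => i; rewrite !ffunE; case: eqP; rewrite ?mulg1.
have de1 k : de k 1%g = 1%g by apply: (mulgI (de k 1%g)); rewrite -deM !mulg1.
pose tt (i : 'I_m) : {dffun forall i : 'I_q, gT} :=
  if insub (i %/ s)%N is Some k then
    if insub (i %% s)%N is Some j then de k (t j) else 1%g
  else 1%g.
apply: (hU _ _ tt).
  rewrite /pgroup cardsXn; apply: (big_ind (fun n => p.-nat n)) => //= u v pu pv.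
  by rewrite pnatM pu pv.
split.
  move=> i; rewrite /tt; case: insubP => [k _ _|_]; last exact: group1.
  case: insubP => [j _ _|_]; last exact: group1.
  by apply/setXnP => l; rewrite ffunE; case: eqP; rewrite ?group1 ?Tt.
move=> H hH.
have hde k y : y \in T -> de k y \in H.
  have gS : group_set [set y | de k y \in H]%SET.
    apply/group_setP; split; first by rewrite inE de1 group1.
    by move=> u v; rewrite !inE deM => hu hv; rewrite groupM.
  have : T \subset Group gS.
    apply: genT => j; rewrite inE.
    have jm : (k * s + j < m)%N.
      apply: leq_trans qs; have := ltn_ord k; have := ltn_ord j; nia.
    have := hH (Ordinal jm); rewrite /tt /=.
    have s0 : (0 < s)%N by apply: leq_trans (ltn_ord j).
    rewrite divnMDl // divn_small ?ltn_ord // addn0 modnMDl modn_small ?ltn_ord //.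
    by rewrite !valK.
  by move=> /fintype.subsetP h /h; rewrite inE.
rewrite /= -setXn_prod; apply: prod_subG => k _.
apply/fintype.subsetP => f; rewrite set1gXnE => /setXnP fT.
suff -> : f = de k (f k) by apply: hde; have := fT k; rewrite eqtype.dfwith_in.
apply/ffunP => i; rewrite ffunE; case: eqP => [->//|/eqP ik].
have ki : k != i by rewrite eq_sym.
by have := fT i; rewrite (eqtype.dfwith_out _ _ ki) => /set1P.
Qed.

Definition wordv (H : groupType) (h : nat -> H) (w : word) : H :=
  (\prod_(x <- w) (if x.2 then h x.1 else (h x.1)^-1))%g.

Definition satisfies (W : set word) (gT : finGroupType) (T : {group gT}) : Prop :=
  forall w, W w -> forall h : nat -> gT, (forall k, h k \in T) -> wordv h w = 1%g.

Lemma subgroup_wordv (U : set G) (h : nat -> G) w : subgroup U -> (forall k, U (h k)) ->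
  U (wordv h w).
Proof.
move=> [U1 UM UV] hU; rewrite /wordv; apply: big_ind => // -[k b] _ /=.
by case: b => //; exact: UV.
Qed.

Lemma wordv_hom (U : set G) (gT : finGroupType) (phi : G -> gT) (h : nat -> G) w :
  subgroup U -> (forall g k, U g -> U k -> phi (g * k)%g = (phi g * phi k)%g) ->
  (forall k, U (h k)) -> phi (wordv h w) = wordv (phi \o h) w.
Proof.
move=> sU phiM hU; have [U1 UM UV] := sU.
have phi1 : phi 1%g = 1%g.
  by apply: (mulgI (phi 1%g)); rewrite -phiM // !mulg1.
have phiV g : U g -> phi g^-1%g = (phi g)^-1%g.
  by move=> Ug; apply: (mulgI (phi g)); rewrite -phiM ?mulgV //; exact: UV.
elim: w => [|[k b] w IH]; first by rewrite /wordv !big_nil.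
have := subgroup_wordv w sU hU; rewrite /wordv !big_cons /= => Uw.
rewrite phiM //; last by case: b => //; exact: UV.
by rewrite -/(wordv h w) IH; case: b; rewrite ?phiV.
Qed.

(* Weaker than [V] being the verbal subgroup of [U] on [W]; in this form the relation
   passes from a direct product to its factors. *)
Definition weakly_verbal (W : set word) (U V : set G) : Prop :=
  [/\ V `<=` U, forall w h, W w -> (forall k, U (h k)) -> V (wordv h w) &
      forall A, open_subgroup A ->
        (forall w h, W w -> (forall k, U (h k)) -> A (wordv h w)) -> V `<=` A].

Lemma smooth_kernel_open (U : set G) (gT : finGroupType) (phi : G -> gT) :
  open_subgroup U -> smooth U phi ->
  (forall g k, U g -> U k -> phi (g * k)%g = (phi g * phi k)%g) ->
  open_subgroup [set g | U g /\ phi g = 1%g].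
Proof.
move=> oU [N [[oN [[N1 _ _] _]] NU] hN] phiM.
have phi1 : phi 1%g = 1%g.
  by apply: (mulgI (phi 1%g)); rewrite -phiM ?mulg1 //; exact: osub1.
have phiV g : U g -> phi g^-1%g = (phi g)^-1%g.
  by move=> Ug; apply: (mulgI (phi g)); rewrite -phiM ?mulgV //; exact: osubV.
have sA : subgroup [set g | U g /\ phi g = 1%g].
  split=> [|g h [Ug eg] [Uh eh]|g [Ug eg]].
  - by split; [exact: osub1|].
  - by split; [exact: osubM | rewrite phiM // eg eh mulg1].
  - by split; [exact: osubV | rewrite phiV // eg invg1].
split=> //; apply: open_subgroup_nbhs => //.
have nN : nbhs (1%g : G) N by exact: open_nbhs_nbhs.
apply: (@filterS _ _ (nbhs_filter (1%g : G)) _ _ _ nN) => n Nn; split; first exact: NU.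
by have := hN 1%g n (osub1 oU) Nn; rewrite mul1g => ->.
Qed.

(** T^q satisfies the laws of [T], so the epimorphism from [U] onto it kills [V]. Thus T^q is a
    quotient of U/V, which [f] identifies with [imq f U]. *)
Lemma verbal_index_bound (U V : set G) (W : set word) m (gT : finGroupType) (T : {group gT})
    s (t : 'I_s -> gT) q (Q : finGroupType) (f : G -> Q) :
  open_subgroup U -> weakly_verbal W U V -> free_rank U m ->
  fquot p V f -> p.-group T -> satisfies W T -> gen_by T t -> (q * s <= m)%N ->
  (#|T| ^ q <= #|imq f U|)%N.
Proof.
move=> oU [VU _ hV] hU [fM fS pQ fV] pT lawT genT qs.
have [phi [sphi Tphi phiM surj]] := free_rank_power hU pT genT qs.
have kV : V `<=` [set g | U g /\ phi g = 1%g].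
  apply: hV; first exact: smooth_kernel_open.
  move=> w h Ww hh; split; first exact: subgroup_wordv oU.2 _.
  rewrite (wordv_hom w oU.2 phiM hh).
  apply/ffunP => i; rewrite [RHS]ffunE.
  have -> : wordv (phi \o h) w i = wordv (fun k => phi (h k) i) w.
    rewrite /wordv; elim: w {Ww} => [|[k b] w IH]; first by rewrite !big_nil ffunE.
    by rewrite !big_cons ffunE IH; case: b => //=; rewrite ffunE.
  by apply: lawT => // k; have /setXnP := Tphi _ (hh k).
pose sec (y : {dffun forall i : 'I_q, gT}) : G := xget 1%g [set g | U g /\ phi g = y].
have secP y : y \in setXn (fun _ : 'I_q => T) -> U (sec y) /\ phi (sec y) = y.
  move=> hy; rewrite /sec; case: xgetP => [g _ //|h].
  by have [g Ug eg] := surj y hy; case: (h g).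
have inj : {in setXn (fun _ : 'I_q => T) &, injective (fun y => f (sec y))}.
  move=> y z hy hz e; have [Uy ey] := secP y hy; have [Uz ez] := secP z hz.
  have : V ((sec y)^-1 * sec z)%g.
    by apply/fV; rewrite fM (morphVg fM) e mulVg.
  move=> /kV[_]; rewrite phiM //; last exact: osubV.
  have -> : phi (sec y)^-1%g = (phi (sec y))^-1%g.
    apply: (mulgI (phi (sec y))); rewrite -phiM ?mulgV //; last exact: osubV.
    by apply: (mulgI (phi 1%g)); rewrite -phiM ?mulg1 //; exact: osub1.
  rewrite ey ez => /(congr1 (mulg y)); by rewrite mulKVg mulg1 => ->.
have := card_in_imset inj; rewrite cardsXn prod_nat_const card_ord => <-.
apply: subset_leq_card; apply/fintype.subsetP => _ /imsetP[y hy ->].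
by apply: mem_imq; exact: (secP y hy).1.
Qed.

End FreeRank.

(** * Characters with values in the p-adic integers *)

(** The second maximal subgroup is taken around an element [s1] outside the first; it exists because
    [s1] does not generate the group. *)
Lemma noncyclic_homs (p : nat) (gT : finGroupType) (P : {group gT}) : prime p ->
  p.-group P -> ~~ cyclic P ->
  exists l1 l2 : gT -> 'F_p,
    [/\ {in P &, forall x y, l1 (x * y)%g = (l1 x + l1 y)%R},
        {in P &, forall x y, l2 (x * y)%g = (l2 x + l2 y)%R} &
        forall c1 c2 : 'F_p, {in P, forall x, c1 * l1 x + c2 * l2 x = 0}%R ->
          c1 = 0%R /\ c2 = 0%R].
Proof.
move=> p_pr pP ncP.
case: (maximal_exists (sub1G P)) => [P1|[M1 maxM1 _]].
  by rewrite -P1 cyclic1 in ncP.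
have [s1 Ps1 nMs1] := fintype.subsetPn (proper_subn (maxgroupp maxM1)).
have sP : <[s1]> \subset P by rewrite cycle_subG.
case: (maximal_exists sP) => [sE|[M2 maxM2 sM2]].
  by case/negP: ncP; apply/cyclicP; exists s1.
have [l1 [l1M l1K _]] := pgroup_maximal_hom p_pr pP maxM1.
have [l2 [l2M l2K [s2 Ps2 l2s]]] := pgroup_maximal_hom p_pr pP maxM2.
exists l1, l2; split=> // c1 c2 h.
have l2s1 : l2 s1 = 0%R by apply/l2K => //; rewrite -cycle_subG.
have l1s1 : l1 s1 != 0%R by apply/eqP => /l1K e; case/negP: nMs1; exact: e.
have c10 : c1 = 0%R.
  have /eqP := h s1 Ps1; rewrite l2s1 mulr0 addr0 mulf_eq0 (negbTE l1s1) orbF.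
  by move/eqP.
split=> //; have := h s2 Ps2; by rewrite c10 mul0r add0r l2s mulr1.
Qed.

Section Dichotomy.
Variables (p : nat) (p_pr : prime p) (G : topGroupType).
Hypothesis Gp : pro_p p G.
Local Notation Fp := 'F_p.
Let cG : compact [set: G]. Proof. by case: Gp. Qed.

Local Open Scope ring_scope.
(** A compatible system of homomorphisms modulo p^(n+1) is a homomorphism to the p-adic integers;
    [t] witnesses a unit value, hence surjectivity. *)
Definition Zp_character (xs : nat -> G -> int) (t : G) : Prop :=
  [/\ forall n, hom_mod p setT n.+1 (xs n),
      forall n g, ((p ^ n.+1)%N%:Z %| xs n.+1 g - xs n g)%Z &
      ~~ (p%:Z %| xs 0%N t)%Z].

Definition char_level (xs : nat -> G -> int) (n : nat) : set G :=
  [set g | ((p ^ n.+1)%N%:Z %| xs n g)%Z].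

Definition char_kernel (xs : nat -> G -> int) : set G := \bigcap_n char_level xs n.

Lemma setT_open : open_subgroup [set: G].
Proof. by split; [exact: openT|]. Qed.

Section Character.
Variables (xs : nat -> G -> int) (t : G).
Hypothesis xsP : Zp_character xs t.

Lemma char_hom n g h : ((p ^ n.+1)%N%:Z %| xs n g + xs n h - xs n (g * h)%g)%Z.
Proof. by case: xsP => h1 _ _; exact: (h1 n).2. Qed.

Lemma char_levelM n g h : char_level xs n g -> char_level xs n h -> char_level xs n (g * h)%g.
Proof.
rewrite /char_level /= => hg hh.
have -> : xs n (g * h)%g = (xs n g + xs n h) - (xs n g + xs n h - xs n (g * h)%g) by ring.
by apply: rpredB; [exact: rpredD | exact: char_hom].
Qed.

Lemma char1 n : char_level xs n 1%g.
Proof.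
have := char_hom n 1%g 1%g; rewrite mulg1 /char_level /=.
by have -> : (xs n 1%g + xs n 1%g - xs n 1%g)%R = xs n 1%g by ring.
Qed.

Lemma char_levelV n g : char_level xs n g -> char_level xs n g^-1%g.
Proof.
rewrite /char_level /= => hg; have := char_hom n g g^-1%g; rewrite mulgV => h.
have -> : xs n g^-1%g =
  ((xs n g + xs n g^-1%g - xs n 1%g) + xs n 1%g - xs n g)%R by ring.
by apply: rpredB => //; apply: rpredD => //; exact: char1.
Qed.

Lemma char_level_open n : open_subgroup (char_level xs n).
Proof.
have sD : subgroup (char_level xs n).
  by split; [exact: char1 | exact: char_levelM | exact: char_levelV].
split=> //; apply: open_subgroup_nbhs => //.
have [h1 _ _] := xsP; have [N [[oN [[N1 _ _] _]] _] hN] := (h1 n).1.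
have nN : nbhs (1%g : G) N by exact: open_nbhs_nbhs.
apply: (@filterS _ _ (nbhs_filter (1%g : G)) _ _ _ nN) => m Nm.
by have := hN 1%g m I Nm; rewrite mul1g /char_level /= => ->; exact: char1.
Qed.

Lemma char_levelS n : char_level xs n.+1 `<=` char_level xs n.
Proof.
rewrite /char_level => g /= hg; have [_ h2 _] := xsP.
have -> : xs n g = (xs n.+1 g - (xs n.+1 g - xs n g))%R by ring.
apply: rpredB; last exact: h2.
by apply: dvdz_trans hg; rewrite dvdzE /= dvdn_exp2l.
Qed.

Lemma char_levelW n g : char_level xs n g -> ((p ^ n.+1)%N%:Z %| xs n.+1 g)%Z.
Proof.
rewrite /char_level /= => hg; have [_ h2 _] := xsP.
have -> : xs n.+1 g = (xs n g + (xs n.+1 g - xs n g))%R by ring.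
by apply: rpredD => //; exact: h2.
Qed.

Lemma char_t n k : ((p ^ n.+1)%N%:Z %| xs n (t ^+ k)%g - k%:Z * xs n t)%Z.
Proof.
elim: k => [|k IH]; first by rewrite expg0 mul0r subr0; exact: char1.
rewrite expgS; have := char_hom n t (t ^+ k)%g => h.
have -> : (xs n (t * t ^+ k)%g - k.+1%:Z * xs n t =
  (xs n (t ^+ k)%g - k%:Z * xs n t) - (xs n t + xs n (t ^+ k)%g - xs n (t * t ^+ k)%g))%R.
  by rewrite -addn1 PoszD; ring.
exact: rpredB.
Qed.

Lemma char_t_unit n : ~~ (p%:Z %| xs n t)%Z.
Proof.
elim: n => [|n IH]; first by case: xsP.
apply: contra IH => h; have [_ h2 _] := xsP.
have -> : xs n t = (xs n.+1 t - (xs n.+1 t - xs n t))%R by ring.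
apply: rpredB => //; apply: dvdz_trans (h2 n t).
by rewrite dvdzE /= expnS dvdn_mulr.
Qed.

Lemma char_t_pow_level n k : char_level xs n (t ^+ k)%g -> (p ^ n.+1 %| k)%N.
Proof.
rewrite /char_level /= => h; have := char_t n k => h'.
have {h h'} : ((p ^ n.+1)%N%:Z %| k%:Z * xs n t)%Z.
  have -> : (k%:Z * xs n t = xs n (t ^+ k)%g - (xs n (t ^+ k)%g - k%:Z * xs n t))%R by ring.
  exact: rpredB.
have := char_t_unit n; rewrite !dvdzE abszM !absz_nat => nt.
by rewrite Gauss_dvdl // coprimeXl // prime_coprime.
Qed.

(** The value at [t] is a unit, so a Bezout relation gives a power of [t] with the value of [g]
    modulo p^(n+1). *)
Lemma char_t_reach n g : exists k, char_level xs n (g * t ^- k)%g.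
Proof.
have p0 : (p ^ n.+1)%N%:Z != 0%R by exact: pK_neq0.
have cop : coprimez (p ^ n.+1)%N%:Z (xs n t).
  have := char_t_unit n; rewrite dvdzE absz_nat => nt.
  by rewrite coprimezE absz_nat coprimeXl // prime_coprime.
have /coprimezP[[u v] /= uv] := cop.
pose k := `|((v * xs n g) %% (p ^ n.+1)%N%:Z)%Z|%N.
exists k; have ek : (k%:Z = (v * xs n g) %% (p ^ n.+1)%N%:Z)%Z by rewrite gez0_abs ?modz_ge0.
have dk : ((p ^ n.+1)%N%:Z %| v * xs n g - k%:Z)%Z.
  rewrite ek {1}(divz_eq (v * xs n g) (p ^ n.+1)%N%:Z) addrK; exact: dvdz_mull.
have dg : ((p ^ n.+1)%N%:Z %| xs n g - k%:Z * xs n t)%Z.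
  have -> : (xs n g - k%:Z * xs n t =
     (v * xs n g - k%:Z) * xs n t + xs n g * (1 - v * xs n t))%R by ring.
  apply: rpredD; first exact: dvdz_mulr.
  apply: dvdz_mull; rewrite -uv.
  have -> : (u * (p ^ n.+1)%N%:Z + v * xs n t - v * xs n t = u * (p ^ n.+1)%N%:Z)%R by ring.
  exact: dvdz_mull.
rewrite /char_level /=; have h1 := char_hom n g (t ^- k)%g.
have h2 := char_hom n (t ^+ k)%g (t ^- k)%g; rewrite mulgV in h2.
have h3 := char_t n k; have h4 := char1 n.
have -> : xs n (g * t ^- k)%g = ((xs n g - k%:Z * xs n t)
   - (xs n (t ^+ k)%g - k%:Z * xs n t)
   + (xs n (t ^+ k)%g + xs n (t ^- k)%g - xs n 1%g) + xs n 1%g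
   - (xs n g + xs n (t ^- k)%g - xs n (g * t ^- k)%g))%R by ring.
by do ?[done | apply: rpredB | apply: rpredD].
Qed.

Lemma char_kernel_subgroup : subgroup (char_kernel xs).
Proof.
split=> [n _|g h hg hh n _|g hg n _]; first exact: char1.
  by apply: char_levelM; [exact: hg | exact: hh].
by apply: char_levelV; exact: hg.
Qed.

(** An element in the image of every level is, by compactness, in the image of their intersection;
    so a finite quotient cannot tell the kernel from a deep level. *)
Lemma char_level_image N (Q : finGroupType) (f : G -> Q) : opn N -> fquot p N f ->
  exists n0, forall n, (n0 <= n)%N -> imq f (char_level xs n) = imq f (char_kernel xs).
Proof.
move=> oN [fM fS pQ fN].
have mono n m : (n <= m)%N -> char_level xs m `<=` char_level xs n.
  move=> /subnK <-; elim: (m - n)%N => [//|k IH]; rewrite addSn.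
  by apply: subset_trans IH; exact: char_levelS.
have main (q : Q) : exists n, q \in imq f (char_level xs n) -> q \in imq f (char_kernel xs).
  apply: contrapT => /forallNP h.
  have hn n : q \in imq f (char_level xs n) by apply: contrapT => hq; apply: (h n) => /hq.
  have hk : ~ q \in imq f (char_kernel xs) by move=> hq; apply: (h 0%N) => _.
  apply: hk; have [g0 eg0] := fS q.
  have oN' := oN.1; have sN := oN.2.1.
  have cN : closed N by exact: open_subgroup_closed.
  have [g Fg] : (\bigcap_n (char_level xs n `&` [set g | N (g0^-1 * g)%g])) !=set0.
    apply: (compact_decreasing cG).
    - move=> n; apply: closedI; last exact: closed_lmul.
      by apply: open_subgroup_closed; case: (char_level_open n).
    - by move=> n g [hg Ng]; split=> //; exact: char_levelS.
    - move=> n; have /imqP[g hg eg] := hn n; exists g; split=> //=.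
      by apply/fN; rewrite fM (morphVg fM) eg eg0 mulVg.
  apply/imqP; exists g; first by move=> n _; exact: (Fg n I).1.
  have /fN := (Fg 0%N I).2; rewrite fM (morphVg fM) eg0 => e.
  by rewrite -[f g](mulKVg q) e mulg1.
have /choice [n0 hn0] := main.
exists (\max_(q : Q) n0 q) => n hn; apply/setP => q; apply/idP/idP.
  move=> hq; apply: (hn0 q); apply: (fintype.subsetP (imqS f _)) hq.
  by apply: mono; apply: leq_trans hn; exact: leq_bigmax.
apply: (fintype.subsetP (imqS f _)) => g hg; exact: hg.
Qed.

End Character.

Lemma char_levelJ (xs : nat -> G -> int) (t : G) n g h : Zp_character xs t ->
  char_level xs n g -> char_level xs n (g ^ h)%g.
Proof.
move=> xsP; rewrite /char_level /= => hg; rewrite conjgE.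
have h1 := char_hom xsP n h^-1%g (g * h)%g; have h2 := char_hom xsP n g h.
have h3 := char_hom xsP n h^-1%g h; rewrite mulVg in h3.
have -> : (xs n (h^-1 * (g * h))%g = xs n g + xs n 1%g
  - (xs n h^-1%g + xs n (g * h)%g - xs n (h^-1 * (g * h))%g)
  - (xs n g + xs n h - xs n (g * h)%g) + (xs n h^-1%g + xs n h - xs n 1%g))%R by ring.
have h4 := char1 xsP n.
by do ?[done | apply: rpredB | apply: rpredD].
Qed.

Lemma fquot_smooth N (Q : finGroupType) (f : G -> Q) U : opn N -> fquot p N f ->
  open_subgroup U -> smooth U f.
Proof.
move=> oN [fM _ _ fN] [oU sU]; have [N' oN' N'U] := opn_core cG oU sU.
exists (N `&` N'); first by split; [exact: opnI | move=> x [_ /N'U]].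
by move=> g n _ [/fN e _]; rewrite fM e mulg1.
Qed.

Lemma smooth_sub U V (X : Type) (x : G -> X) : open_subgroup V -> V `<=` U ->
  smooth U x -> smooth V x.
Proof.
move=> [oV sV] VU [N [oN _] h]; have [N' oN' N'V] := opn_core cG oV sV.
exists (N `&` N'); first by split; [exact: opnI | move=> y [_ /N'V]].
by move=> g n /VU Ug [Nn _]; exact: h.
Qed.

(** A power of [t] moves any element into a deep level, whose image is that of the kernel; so [t]
    generates the quotient. *)
Lemma char_kernel_quotient (xs : nat -> G -> int) (t : G) N (Q : finGroupType) (f : G -> Q) :
  Zp_character xs t -> opn N -> fquot p N f ->
  forall K : {group Q}, K = imq f (char_kernel xs) :> {set Q} ->
  normal K [set: Q]%G /\ cyclic ([set: Q]%G / K).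
Proof.
move=> xsP oN fq K0 eK0; have [fM fS _ _] := fq.
have gK : group_set (imq f (char_kernel xs)).
  by apply: imq_group_set => //; exact: char_kernel_subgroup xsP.
have -> : K0 = Group gK by exact: val_inj.
have [n0 hn0] := char_level_image xsP oN fq.
split.
  apply/normalP; split; first exact: finset.subsetT.
  move=> q _; apply/eqP; rewrite eqEcard cardJg leqnn andbT.
  apply/fintype.subsetP => _ /imsetP[_ /imqP[g hg <-] ->].
  have [h <-] := fS q; apply/imqP; exists (g ^ h)%g.
    by move=> n _; apply: char_levelJ xsP _; exact: hg.
  by rewrite !conjgE !fM (morphVg fM).
apply/cyclicP; exists (coset (Group gK) (f t)).
apply/eqP; rewrite finset.eqEsubset; apply/andP; split.
  apply/fintype.subsetP => _ /morphimP[q nq _ ->]; have [g eg] := fS q.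
  have [k hk] := char_t_reach xsP n0 g.
  have hq : f (g * t ^- k)%g \in Group gK by rewrite /= -(hn0 n0 (leqnn _)); exact: mem_imq.
  have eq : q = (f (g * t ^- k) * f t ^+ k)%g.
    by rewrite fM (morphVg fM) (morphXg _ fM) eg mulgKV.
  have nft : f t \in 'N(Group gK)%g.
    apply/normP; apply/eqP; rewrite eqEcard cardJg leqnn andbT.
    apply/fintype.subsetP => _ /imsetP[_ /imqP[u hu <-] ->].
    apply/imqP; exists (u ^ t)%g.
      by move=> n _; apply: char_levelJ xsP _; exact: hu.
    by rewrite !conjgE !fM (morphVg fM).
  rewrite eq morphM; last 2 first.
  - exact: (fintype.subsetP (normG (Group gK)) _ hq).
  - by rewrite groupX.
  apply: groupM; last by rewrite (morphX _ _ nft) mem_cycle.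
  have -> : coset_morphism (Group gK) (f (g * t ^- k)%g) = 1%g by exact: coset_id hq.
  exact: group1.
rewrite cycle_subG; apply: mem_quotient; exact: finset.in_setT.
Qed.

Lemma char_kernel_metacyclic (xs : nat -> G -> int) (t : G) N (Q : finGroupType) (f : G -> Q) :
  Zp_character xs t -> opn N -> fquot p N f -> cyclic (imq f (char_kernel xs)) ->
  metacyclic [set: Q]%G.
Proof.
move=> xsP oN fq cyc; have [fM _ _ _] := fq.
have gK : group_set (imq f (char_kernel xs)).
  by apply: imq_group_set => //; exact: char_kernel_subgroup xsP.
have [nK cK] := char_kernel_quotient xsP oN fq (erefl (Group gK : {set Q})).
by apply/metacyclicP; exists (Group gK).
Qed.

Lemma pd_dichotomy (tr : (G -> G -> Fp) -> Fp) : pd_trace setT tr ->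
  (forall N (Q : finGroupType) (f : G -> Q), opn N -> fquot p N f -> metacyclic [set: Q]%G) \/
  exists (xs : nat -> G -> int) (t : G) (U : set G),
    [/\ Zp_character xs t, open_subgroup U & dimge U (hom1 (p := p) U) 3].
Proof.
move=> htr.
have [d2|nd2] := pselect (dimge setT (hom1 (p := p) (G := G) setT) 2); last first.
  left=> N Q f oN fq; apply: cyclic_metacyclic; apply: contrapT => /negP nc.
  have [fM fS pQ fN] := fq.
  have [l1 [l2 [l1M l2M lI]]] := noncyclic_homs p_pr pQ nc.
  apply: nd2; exists (fun i : 'I_2 => if i == ord0 then l1 \o f else l2 \o f); split.
    have sf := fquot_smooth oN fq setT_open.
    move=> i; case: ifP => _; split=> [|g h _ _] /=; try exact: smooth_comp.
      by rewrite fM l1M ?finset.in_setT.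
    by rewrite fM l2M ?finset.in_setT.
  move=> c hc; have [|c0 c1] := lI (c ord0) (c (lift ord0 ord0)).
    move=> q _; have [g <-] := fS q; have := hc g I.
    by rewrite !big_ord_recl big_ord0 /= addr0.
  move=> i; case: (unliftP ord0 i) => [j ->|->] //; by rewrite (ord1 j).
have := dimge_liftable p_pr cG setT_open htr d2.
move=> [w [wl wi]].
have [y yl [t yt]] : exists2 y : G -> Fp, liftable setT y & exists t, y t != 0.
  exists (w ord0) => //; apply: contrapT => /forallNP h.
  suff /(_ ord0)/eqP : forall i : 'I_1, (1 : Fp) = 0 by rewrite oner_eq0.
  apply: (wi (fun=> 1)) => u _; rewrite big_ord1 mul1r.
  by have /negP := h u; rewrite negbK => /eqP.
have [_ [xs [xs1 xs2 xs3]]] := yl.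
have xsP : Zp_character xs t.
  split=> // [n g|]; first exact: xs2.
  by rewrite -(intr_Fp_eq0 p_pr) (xs3 t I).
have [hcyc|] := pselect (forall N (Q : finGroupType) (f : G -> Q), opn N -> fquot p N f ->
  cyclic (imq f (char_kernel xs))).
  by left=> N Q f oN fq; apply: (char_kernel_metacyclic xsP oN fq); exact: (hcyc N).
move=> /existsNP[N /existsNP[Q /existsNP[f]]].
move=> /not_implyP[oN /not_implyP[fq /negP ncyc]].
right; have [fM fS pQ fN] := fq.
have gK : group_set (imq f (char_kernel xs)).
  by apply: imq_group_set => //; exact: char_kernel_subgroup xsP.
have pK : p.-group (Group gK) by apply: pgroupS pQ; exact: finset.subsetT.
have [l1 [l2 [l1M l2M lI]]] := noncyclic_homs p_pr pK ncyc.
have [n0 hn0] := char_level_image xsP oN fq.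
have [e ee] := p_natP pQ.
pose n := (n0 + e)%N; pose U := char_level xs n.
have oU : open_subgroup U := char_level_open xsP n.
have imU : imq f U = imq f (char_kernel xs) by apply: hn0; rewrite leq_addr.
have UK u : U u -> f u \in Group gK by move=> Uu; rewrite /= -imU; exact: mem_imq.
pose w2 g : Fp := ((xs n.+1 g %/ (p ^ n.+1)%N%:Z)%Z)%:~R.
have d0 := pK_neq0 p_pr n.+1.
have w2h : hom1 U w2.
  split; first apply: (smooth_comp (fun u : int => ((u %/ (p ^ n.+1)%N%:Z)%Z)%:~R : Fp)).
    by apply: (smooth_sub oU _ (xs1 n.+1).1).
  move=> g h Ug Uh; apply/eqP; rewrite eq_sym -subr_eq0 -intrD -intrB (intr_Fp_eq0 p_pr).
  have hg := char_levelW xsP Ug; have hh := char_levelW xsP Uh.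
  have hgh := char_levelW xsP (osubM oU Ug Uh).
  have hc := char_hom xsP n.+1 g h; rewrite -(dvdz_mul2r d0).
  by rewrite mulrBl mulrDl !divzK // -PoszM -(expnS p n.+1).
pose w' (i : 'I_3) := if i == ord0 then l1 \o f else if i == lift ord0 ord0 then l2 \o f else w2.
exists xs, t, U; split=> //; exists w'; split.
  have sf := fquot_smooth oN fq oU.
  move=> i; rewrite /w'; case: ifP => _; last case: ifP => // _.
    split=> [|g h Ug Uh] /=; first exact: smooth_comp.
    by rewrite fM l1M ?UK.
  split=> [|g h Ug Uh] /=; first exact: smooth_comp.
  by rewrite fM l2M ?UK.
move=> c hc.
have hc' u : U u -> c ord0 * l1 (f u) + (c (lift ord0 ord0) * l2 (f u) + c ord_max * w2 u) = 0.
  move=> Uu; have := hc u Uu; rewrite !big_ord_recl big_ord0 /= addr0.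
  by have -> : lift ord0 (lift ord0 ord0) = ord_max :> 'I_3 by exact: val_inj.
pose t' := (t ^+ (p ^ n.+1))%g.
have ft' : f t' = 1%g.
  rewrite (morphXg _ fM); apply/eqP; rewrite -order_dvdn.
  apply: dvdn_trans (order_dvdG (finset.in_setT _)) _; rewrite ee.
  by apply: dvdn_exp2l; rewrite /n; lia.
have dt := char_t xsP n.+1 (p ^ n.+1); rewrite -/t' in dt.
have Ut' : U t'.
  rewrite /U /char_level /=.
  have -> : xs n t' = (xs n.+1 t' - (p ^ n.+1)%N%:Z * xs n.+1 t) + (p ^ n.+1)%N%:Z * xs n.+1 t
     - (xs n.+1 t' - xs n t') by ring.
  apply: rpredB; last exact: xs2.
  apply: rpredD; last exact: dvdz_mulr.
  by apply: dvdz_trans dt; rewrite dvdzE /= dvdn_exp2l.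
have w2t : w2 t' != 0.
  rewrite /w2 (intr_Fp_eq0 p_pr); apply: contra (char_t_unit xsP n.+1) => h.
  have hx : ((p ^ n.+2)%N%:Z %| xs n.+1 t')%Z.
    by rewrite -(divzK (char_levelW xsP Ut')) (expnS p n.+1) PoszM (dvdz_mul2r d0).
  have : ((p ^ n.+2)%N%:Z %| (p ^ n.+1)%N%:Z * xs n.+1 t)%Z.
    have -> : (p ^ n.+1)%N%:Z * xs n.+1 t =
       xs n.+1 t' - (xs n.+1 t' - (p ^ n.+1)%N%:Z * xs n.+1 t) by ring.
    exact: rpredB.
  by rewrite (expnS p n.+1) PoszM (mulrC (p ^ n.+1)%N%:Z) (dvdz_mul2r d0).
have l10 : l1 1%g = 0 by apply: (addrI (l1 1%g)); rewrite -l1M ?group1 // mulg1 addr0.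
have l20 : l2 1%g = 0 by apply: (addrI (l2 1%g)); rewrite -l2M ?group1 // mulg1 addr0.
have c20 : c ord_max = 0.
  have /eqP := hc' t' Ut'; rewrite ft' l10 l20 !mulr0 !add0r mulf_eq0 (negbTE w2t) orbF.
  by move/eqP.
have [|c0 c1] := lI (c ord0) (c (lift ord0 ord0)).
  move=> q; rewrite /= -imU => /imqP[u Uu <-].
  by have := hc' u Uu; rewrite c20 mul0r addr0.
move=> i; have [->|->|->] : [\/ i = ord0, i = lift ord0 ord0 | i = ord_max] => //.
case: i => -[|[|[|//]]] hi; [apply: Or31|apply: Or32|apply: Or33]; exact: val_inj.
Qed.

End Dichotomy.

(** * Growth along a verbal filtration *)

(** [Y] consists of the Schreier generators. The product of the subgroup they generate with the
    transversal is stable under right multiplication by the whole group, so it contains [B]; and the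
    representative of the coset [B] is 1. *)
Lemma schreier (gT : finGroupType) (X : {set gT}) (B : {group gT}) : B \subset <<X>>%g ->
  exists2 Y : {set gT}, <<Y>>%g = B & (#|Y| <= #|X| * #|<<X>>%g : B|)%N.
Proof.
move=> BX; pose A := <<X>>%G.
pose g2 (z : gT * {set gT}) : gT := (repr z.2 * z.1 * (repr (B :* (repr z.2 * z.1)))^-1)%g.
pose Y := (g2 @: finset.setX X (rcosets B A))%SET.
have rep x : x \in A -> repr (B :* x)%g \in (B :* x)%g by move=> _; exact: mem_repr_rcoset.
exists Y; last first.
  by apply: leq_trans (leq_imset_card _ _) _; rewrite cardsX.
have YB : Y \subset B.
  apply/fintype.subsetP => _ /imsetP[[a C] /setXP[_ /rcosetsP[x Ax ->]] ->] /=.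
  set y := (repr (B :* x) * a)%g.
  by have := mem_repr_rcoset B y; rewrite /g2 /= -/y mem_rcoset -groupV invMg invgK.
pose H : {set gT} := (<<Y>> * [set repr C | C in rcosets B A]%SET)%g.
have gS : group_set [set g | H :* g \subset H]%SET.
  apply/group_setP; split; first by rewrite inE mulg1.
  move=> x y; rewrite !inE => hx hy; rewrite rcosetM.
  by apply: fintype.subset_trans hy; exact: mulSg.
have AS : A \subset Group gS.
  rewrite gen_subG; apply/fintype.subsetP => a Xa; rewrite inE.
  apply/fintype.subsetP => _ /rcosetP[_ /mulsgP[y _ Yy /imsetP[C CA ->] ->] ->].
  have -> : (y * repr C * a = y * g2 (a, C) * repr (B :* (repr C * a)))%g.
    by rewrite /g2 /= !mulgA mulgKV.
  apply: mem_mulg.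
    by rewrite groupM // mem_gen //; apply/imsetP; exists (a, C) => //; rewrite inE /= Xa.
  apply/imsetP; exists (B :* (repr C * a))%g => //; apply/rcosetsP; exists (repr C * a)%g => //.
  apply: groupM; last exact: mem_gen.
  have /rcosetsP[x Ax ->] := CA; have /rcosetP[b Bb ->] := rep x Ax.
  by rewrite groupM //; exact: (fintype.subsetP BX).
apply/eqP; rewrite finset.eqEsubset gen_subG YB /=; apply/fintype.subsetP => b Bb.
have := fintype.subsetP AS b (fintype.subsetP BX b Bb); rewrite inE => /fintype.subsetP/(_ b).
have H1 : 1%g \in H.
  rewrite -[1%g]mulg1; apply: mem_mulg; first exact: group1.
  apply/imsetP; exists (B : {set gT}); last by rewrite repr_group.
  by apply/rcosetsP; exists 1%g; rewrite ?group1 ?mulg1.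
rewrite -{1}[b]mul1g mem_rcoset mulgK H1 => /(_ isT) /mulsgP[y _ Yy /imsetP[C CA ->] e].
have /rcosetsP[x Ax eC] := CA.
have By : y \in B by move: Yy; apply/fintype.subsetP; rewrite gen_subG.
have BC : repr C \in B by rewrite -(groupMl _ By) -e.
have : repr C = 1%g.
  have := rep x Ax; rewrite -eC eC => /rcosetP[c Bc ec].
  have Bx : x \in B by rewrite -(groupMl _ Bc) -ec -eC.
  by rewrite (rcoset_id Bx) repr_group.
by rewrite e => ->; rewrite mulg1.
Qed.

Lemma gen_by_set (gT : finGroupType) (T : {group gT}) (Y : {set gT}) k :
  <<Y>>%g = T -> (#|Y| <= k)%N -> exists t : 'I_k -> gT, gen_by T t.
Proof.
move=> eT Yk; exists (fun i => nth 1%g (enum Y) i); split=> [i|H hH].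
  rewrite -eT; case: (ltnP i (size (enum Y))) => hi; last by rewrite nth_default ?group1.
  by apply: mem_gen; rewrite -mem_enum mem_nth.
rewrite -eT gen_subG; apply/fintype.subsetP => y Yy.
have hy : (index y (enum Y) < size (enum Y))%N by rewrite index_mem mem_enum.
have hk : (index y (enum Y) < k)%N by apply: leq_trans hy _; rewrite -cardE.
by have := hH (Ordinal hk); rewrite /= nth_index // mem_enum.
Qed.

Lemma metacyclic_gen_by (gT : finGroupType) (T : {group gT}) : metacyclic T ->
  exists t : 'I_2 -> gT, gen_by T t.
Proof.
move=> /metacyclicP[K [/cyclicP[x eK] nK /cyclicP[y ey]]].
have : y \in (T / K)%g by rewrite ey cycle_id.
case/morphimP => z nz Tz ez.
have KT := normal_sub nK; have NK := normal_norm nK.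
apply: (@gen_by_set _ _ [set x; z]%SET); last by rewrite cards2; case: (_ == _).
apply/eqP; rewrite finset.eqEsubset; apply/andP; split.
  rewrite gen_subG; apply/fintype.subsetP => u; rewrite finset.in_set2 => /orP[] /eqP -> //.
  by apply: (fintype.subsetP KT); rewrite eK cycle_id.
apply/fintype.subsetP => q Tq.
have : coset K q \in <[y]>%g by rewrite -ey; exact: mem_quotient.
case/cycleP => k ek.
have nq := fintype.subsetP NK q Tq.
have : (q * z ^- k)%g \in K.
  apply: coset_idr; first by rewrite groupM ?groupV ?groupX.
  rewrite morphM ?groupV ?groupX // morphV ?groupX // morphX //.
  by rewrite [X in (X * _)%g]ek ez mulgV.
rewrite eK => /cycleP[l el].
rewrite -(mulgKV (z ^+ k)%g q) el groupM // groupX // mem_gen // finset.in_set2 eqxx ?orbT //.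
Qed.

Lemma satisfiesS (W : set word) (gT : finGroupType) (T T' : {group gT}) :
  T' \subset T -> satisfies W T -> satisfies W T'.
Proof.
by move=> sT hT w Ww h hh; apply: hT => // k; exact: (fintype.subsetP sT).
Qed.

Lemma satisfies_quotient (W : set word) (gT : finGroupType) (T K : {group gT}) :
  T \subset 'N(K)%g -> satisfies W T -> satisfies W (T / K)%G.
Proof.
move=> nK hT w Ww h hh.
have /choice[x hx] k : exists x, x \in T /\ h k = coset K x.
  by have /morphimP[x _ Tx ->] := hh k; exists x.
have xT k : x k \in T by case: (hx k).
have cM a b : a \in T -> b \in T -> coset K (a * b)%g = (coset K a * coset K b)%g.
  by move=> Ta Tb; rewrite morphM //; exact: (fintype.subsetP nK).
have cV a : a \in T -> coset K a^-1%g = (coset K a)^-1%g.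
  by move=> Ta; rewrite morphV //; exact: (fintype.subsetP nK).
have : coset K (wordv x w) = wordv h w /\ wordv x w \in T.
  rewrite /wordv; elim: w {Ww} => [|[k b] w [IH1 IH2]].
    by rewrite !big_nil morph1 group1.
  rewrite !big_cons /=.
  have xb : (if b then x k else (x k)^-1)%g \in T by case: b; rewrite ?groupV.
  split; last exact: groupM.
  by rewrite cM // IH1; congr (_ * _)%g; case: b {xb}; rewrite (hx k).2 ?cV.
by rewrite (hT w Ww x xT) morph1 => -[].
Qed.

Section Factor.
Variables (p : nat) (p_pr : prime p) (G : topGroupType).
Hypothesis Gp : pro_p p G.
Let cG : compact [set: G]. Proof. by case: Gp. Qed.

Lemma fquot_factor N N' (Q Q' : finGroupType) (f : G -> Q) (f' : G -> Q') :
  fquot p N f -> fquot p N' f' -> N' `<=` N ->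
  exists2 phi : {morphism [set: Q'] >-> Q}, forall g, phi (f' g) = f g &
    imq f' N = ('ker phi)%g.
Proof.
move=> [fM fS _ fN] [fM' fS' _ fN'] NN'.
have /choice[s hs] := fS'.
have e g : f (s (f' g)) = f g.
  apply: (mulgI (f g)^-1%g); rewrite mulVg -(morphVg fM) -fM; apply/fN/NN'/fN'.
  by rewrite fM' (morphVg fM') hs mulVg.
have phiM : {in [set: Q']%SET &, {morph (f \o s) : x y / (x * y)%g}}.
  by move=> x y _ _ /=; rewrite -{1}(hs x) -{1}(hs y) -fM' e fM.
exists (Morphism phiM) => //.
apply/setP => y; have [g <-] := fS' y; apply/imqP/kerP; rewrite ?finset.in_setT //.
  by move=> [h Nh <-] /=; rewrite e; apply/fN.
by rewrite /= e => /fN Ng; exists g.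
Qed.

Lemma imq_step N N' (Q Q' : finGroupType) (f : G -> Q) (f' : G -> Q') (A : set G)
    (B : {group Q'}) :
  fquot p N f -> fquot p N' f' -> N' `<=` N -> B = imq f' A :> {set Q'} ->
  (#|B| = #|B :&: imq f' N| * #|imq f A|)%N.
Proof.
move=> fq fq' NN' eB; have [phi hphi kerE] := fquot_factor fq fq' NN'.
have [fM fS _ fN] := fq; have [fM' fS' _ fN'] := fq'.
have -> : imq f A = (phi @* B)%g.
  apply/setP => q; apply/idP/morphimP => [/imqP[g Ag <-]|[b _ Bb ->]].
    by exists (f' g); rewrite ?finset.in_setT // eB mem_imq.
  by move: Bb; rewrite eB => /imqP[g Ag <-]; rewrite hphi mem_imq.
by rewrite kerE card_morphim finset.setTI LagrangeI.
Qed.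

Section FactorFiltration.
Variables (S : nat -> set G) (W : nat -> set word) (Q : nat -> finGroupType).
Variable f : forall i, G -> Q i.
Hypothesis S_opn : forall i, opn (S i).
Hypothesis S_dec : forall i, S i.+1 `<=` S i.
Hypothesis S_cap : \bigcap_i S i = [set 1%g].
Hypothesis S_verbal : forall i, weakly_verbal (W i) (S i) (S i.+1).
Hypothesis fq : forall i, fquot p (S i) (f i).

Let fM i : {morph f i : x y / (x * y)%g}. Proof. by case: (fq i). Qed.
Let oS i : open_subgroup (S i). Proof. by have [oi [si _]] := S_opn i. Qed.

Lemma filtration_le i k : (i <= k)%N -> S k `<=` S i.
Proof.
move=> /subnK <-; elim: (k - i)%N => [//|n IH]; rewrite addSn.
by move=> x /S_dec /IH.
Qed.

(** By compactness, the terms of the filtration form a base of neighbourhoods of 1. *)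
Lemma filtration_enters (U : set G) : open_subgroup U -> exists i0, forall i, (i0 <= i)%N -> S i `<=` U.
Proof.
move=> [oU [U1 _ _]]; have [i0 h0] : exists i0, S i0 `<=` U.
  apply: contrapT => /forallNP h.
  have [g Fg] : (\bigcap_i (S i `&` ~` U)) !=set0.
    apply: (compact_decreasing cG).
    - move=> i; apply: closedI; last exact: open_closedC.
      by apply: open_subgroup_closed; case: (oS i).
    - by move=> i x [/S_dec].
    - move=> i; apply: contrapT => ne; apply: (h i) => x Sx.
      by apply: contrapT => nU; apply: ne; exists x.
  have : [set 1%g] g by rewrite -S_cap => i _; case: (Fg i I).
  by move=> /= g1; case: (Fg 0%N I) => _; rewrite g1.
by exists i0 => i hi; apply: subset_trans h0; exact: filtration_le.
Qed.

Definition imqG i (A : set G) (sA : subgroup A) : {group Q i} :=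
  Group (imq_group_set (fM i) sA).

Lemma satisfies_imq i : satisfies (W i) (imqG i.+1 (oS i).2).
Proof.
move=> w Ww h hh.
have /choice[x hx] k : exists x, S i x /\ f i.+1 x = h k.
  by have /imqP[x Sx <-] := hh k; exists x.
have <- : f i.+1 (wordv x w) = wordv h w.
  rewrite (wordv_hom w (oS i).2 (fun a b _ _ => fM i.+1 a b)); last by move=> k; case: (hx k).
  by congr wordv; apply: funext => k; exact: (hx k).2.
have [_ _ _ fN] := fq i.+1; apply/fN.
by have [_ h2 _] := S_verbal i; apply: h2 => // k; case: (hx k).
Qed.

(* By the embedding theorem [S i] maps onto [T ^ q] for large [i]; the kernel contains
   [S i.+1] as soon as [T] satisfies the laws [W i]. *)
Definition dominates (C i0 : nat) : Prop :=
  forall i (gT : finGroupType) (T : {group gT}) s (t : 'I_s -> gT) q,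
    (i0 <= i)%N -> p.-group T -> satisfies (W i) T -> gen_by T t ->
    (q * s * C <= #|[set: Q i]%SET|)%N -> (#|T| ^ q <= #|imq (f i.+1) (S i)|)%N.

Lemma card_open_image (U : set G) : open_subgroup U ->
  exists C, forall i, (#|[set: Q i]%SET| <= C * #|imq (f i) U|)%N.
Proof.
move=> [oU sU]; have [N oN NU] := opn_core cG oU sU.
have [Q0 [f0 [f0M f0S _ f0N]]] := pro_p_quotient p_pr Gp oN.
have /choice[r hr] := f0S.
exists #|[set: Q0]%SET| => i; rewrite -cardsX.
pose m (z : Q0 * Q i) := (f i (r z.1) * z.2)%g.
apply: leq_trans (leq_imset_card m _); apply: subset_leq_card.
apply/fintype.subsetP => q _; have [_ fS _ _] := fq i; have [g <-] := fS q.
apply/imsetP; exists (f0 g, f i ((r (f0 g))^-1 * g)%g).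
  rewrite finset.in_setX finset.in_setT /=; apply/mem_imq/NU/f0N.
  by rewrite f0M (morphVg f0M) hr mulVg.
by rewrite /m /= -fM mulKVg.
Qed.

(** The excess of dim H^1 over 2 is at least 1 on [U], hence at least |U : S_i| on S_i. The constant
    [C] of [card_open_image] compares this index with |G : S_i|, and the factor 2 pays for
    isotropy. *)
Lemma pd_dominates (tr : (G -> G -> 'F_p) -> 'F_p) (U : set G) : pd_trace setT tr ->
  open_subgroup U -> dimge U (hom1 (p := p) U) 3 -> exists C i0, dominates C i0.
Proof.
move=> htr oU dU; have [i0 hi0] := filtration_enters oU.
have [C hC] := card_open_image oU.
exists (C * 2)%N, i0 => i gT T s t q ii pT lawT genT qs.
have oT : open_subgroup [set: G] := setT_open G.
have SU := hi0 i ii.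
have [tr1 htr1 _] := pd_open_aux p_pr Gp (S_opn i) (fq i) oT oU (subsetT U) SU (leqnn _) htr.
have [tr2 htr2 gr] := pd_open_aux p_pr Gp (S_opn i) (fq i) oU (oS i) SU (@subset_refl _ (S i))
  (leqnn _) htr1.
have := gr 1%N dU.
have -> : #|imq (f i) (S i)| = 1%N.
  apply/eqP/cards1P; exists 1%g; apply/setP => x; rewrite finset.in_set1; have [_ _ _ fN] := fq i.
  apply/imqP/eqP => [[g /fN -> <-] //|->]; exists 1%g; first exact: osub1 (oS i).
  exact: (morph1g (fM i)).
rewrite divn1 muln1; set d := #|imq (f i) U| => hd.
have frk : free_rank p (S i) d./2.
  apply: (pd_free_rank p_pr cG (oS i) htr2); apply: dimge_leq hd.
    exact: (lin_closed_hom1 p cG (oS i)).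
  by have := odd_double_half d; lia.
apply: (verbal_index_bound p_pr (oS i) (S_verbal i) frk (fq i.+1) pT lawT genT).
have : (q * s * (C * 2) <= C * d)%N := leq_trans qs (hC i).
have C0 : (0 < C)%N.
  have := hC i; case: C {hC qs} => //; rewrite mul0n leqn0 cards_eq0 => /eqP e.
  by have := finset.in_setT (1%g : Q i); rewrite e finset.in_set0.
rewrite mulnCA leq_pmul2l // => h.
by rewrite -(doubleK (q * s)%N); apply: half_leq; rewrite -muln2.
Qed.

(** The logarithm of |A S_i : S_i|; [lgG] is the same for the subgroup generated by a finite list.
    The orders are powers of p, so [logn] loses nothing. *)
Definition lgS (A : set G) i := logn p #|imq (f i) A|.
Definition lgG (A : seq G) i := logn p #|<<[set:: map (f i) A]%SET>>%g|.

Lemma pgroup_card i (B : {group Q i}) : #|B| = (p ^ logn p #|B|)%N.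
Proof.
have [_ _ pQ _] := fq i; apply: card_pgroup; apply: pgroupS pQ; exact: finset.subsetT.
Qed.

Lemma imq_card i (A : set G) : subgroup A -> #|imq (f i) A| = (p ^ lgS A i)%N.
Proof. by move=> sA; exact: (pgroup_card (imqG i sA)). Qed.

Lemma imqT i : imq (f i) setT = [set: Q i]%SET.
Proof.
apply/setP => q; rewrite finset.in_setT; apply/imqP.
by have [_ fS _ _] := fq i; have [g <-] := fS q; exists g.
Qed.

Lemma pcard_step i (A : set G) (B : {group Q i.+1}) : B = imq (f i.+1) A :> {set Q i.+1} ->
  (logn p #|B| = logn p #|B :&: imq (f i.+1) (S i)| + lgS A i)%N.
Proof.
move=> eB; rewrite (imq_step (fq i) (fq i.+1) (@S_dec i) eB) lognM ?cardG_gt0 //.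
  exact: (cardG_gt0 (B :&: imqG i.+1 (oS i).2)).
by move: (cardG_gt0 B); rewrite (imq_step (fq i) (fq i.+1) (@S_dec i) eB) muln_gt0 => /andP[].
Qed.

Lemma lgS_step i (A : set G) (sA : subgroup A) :
  (lgS A i.+1 = logn p #|imqG i.+1 sA :&: imq (f i.+1) (S i)| + lgS A i)%N.
Proof. exact: (@pcard_step i A (imqG i.+1 sA) (erefl _)). Qed.

Lemma lgT_step i : (lgS setT i.+1 = logn p #|imq (f i.+1) (S i)| + lgS setT i)%N.
Proof.
have sT : subgroup [set: G] by [].
have -> : imq (f i.+1) (S i) = imqG i.+1 sT :&: imq (f i.+1) (S i).
  by apply/esym/finset.setIidPr; exact: imqS.
exact: lgS_step.
Qed.

Lemma lgS_le i (A B : set G) : subgroup A -> subgroup B -> A `<=` B -> (lgS A i <= lgS B i)%N.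
Proof.
move=> sA sB AB; rewrite -(leq_exp2l _ _ (prime_gt1 p_pr)) -!imq_card //.
exact/subset_leq_card/imqS.
Qed.

Lemma dominates_log (C i0 : nat) i (gT : finGroupType) (T : {group gT}) s (t : 'I_s -> gT) q :
  dominates C i0 -> (i0 <= i)%N -> p.-group T -> satisfies (W i) T -> gen_by T t ->
  (q * s * C <= #|[set: Q i]%SET|)%N -> (q * logn p #|T| <= lgS setT i.+1 - lgS setT i)%N.
Proof.
move=> hd ii pT lawT genT qs; have h := hd i gT T s t q ii pT lawT genT qs.
rewrite lgT_step addnK -(leq_exp2l _ _ (prime_gt1 p_pr)) mulnC expnM -(card_pgroup pT).
by rewrite -(pgroup_card (imqG i.+1 (oS i).2)).
Qed.

End FactorFiltration.

(** * The kernel of a p-adic character *)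

Section TypeOne.
Variables (S : nat -> set G) (W : nat -> set word) (Q : nat -> finGroupType).
Variable f : forall i, G -> Q i.
Hypothesis S_opn : forall i, opn (S i).
Hypothesis S_dec : forall i, S i.+1 `<=` S i.
Hypothesis S_cap : \bigcap_i S i = [set 1%g].
Hypothesis S_verbal : forall i, weakly_verbal (W i) (S i) (S i.+1).
Hypothesis fq : forall i, fquot p (S i) (f i).
Variables (xs : nat -> G -> int) (t : G) (C i0 : nat).
Hypothesis xsP : Zp_character p xs t.
Hypothesis hdom : dominates S W f C i0.
Let H := char_kernel p xs.
Let sH : subgroup H. Proof. exact: char_kernel_subgroup xsP. Qed.

(** The powers of [t] below p^(M+1) lie in distinct cosets of the level [M], which contains the
    kernel always and S_i for large i; so the image of the kernel has index at least p^(M+1). *)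
Lemma char_kernel_thin M : exists i1, forall i, (i1 <= i)%N ->
  (M * #|imq (f i) H| <= #|[set: Q i]%SET|)%N.
Proof.
have oL := char_level_open xsP M.
have [i1 hi1] := filtration_enters S_opn S_dec S_cap oL.
exists i1 => i ii; have SL := hi1 i ii; have [fM _ _ fN] := fq i.
apply: (@leq_trans (p ^ M.+1 * #|imq (f i) (char_level p xs M)|)%N).
  apply: leq_mul; last by apply/subset_leq_card/imqS => g; exact.
  by apply: ltnW; apply: ltn_trans (ltn_expl _ (prime_gt1 p_pr)).
pose m (z : 'I_(p ^ M.+1) * Q i) := (f i t ^+ z.1 * z.2)%g.
pose D := finset.setX [set: 'I_(p ^ M.+1)]%SET (imq (f i) (char_level p xs M)).
have -> : (p ^ M.+1 * #|imq (f i) (char_level p xs M)|)%N = #|D|.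
  by rewrite cardsX cardsT card_ord.
have key (a b : 'I_(p ^ M.+1)) x y : (b <= a)%N -> (a, x) \in D -> (b, y) \in D -> m (a, x) = m (b, y) -> a = b.
  move=> ba; rewrite !finset.in_setX /= !finset.in_setT /= => /imqP[g Lg <-] /imqP[h Lh <-].
  rewrite /m /= => e.
  have : char_level p xs M (t ^+ (a - b))%g.
    apply: (imq_sat (fq i) oL.2 SL); apply/imqP; exists (h * g^-1)%g.
      by apply: osubM => //; exact: osubV.
    rewrite fM (morphVg fM) (morphXg _ fM).
    apply: (mulgI (f i t ^+ b)%g); rewrite -expgD subnKC // mulgA -e mulgK //.
  move=> /(char_t_pow_level p_pr xsP) /dvdn_leq h'; apply: val_inj => /=.
  by have := ltn_ord a; case: (posnP (a - b)) => [|/h']; lia.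
have inj : {in D &, injective m}.
  move=> [a x] [b y] Da Db e.
  have ab : a = b by case: (leqP b a) => [/key|/ltnW/key h]; [apply; eauto | apply/esym/h; eauto].
  by move: e; rewrite ab /m /= => /mulgI ->.
by rewrite -(card_in_imset inj); apply: subset_leq_card; exact: finset.subsetT.
Qed.

Lemma lgT_unbounded M : exists i1, forall i, (i1 <= i)%N -> (M <= lgS f setT i)%N.
Proof.
have [i1 h1] := char_kernel_thin (p ^ M); exists i1 => i ii.
have sT : subgroup [set: G] by [].
rewrite -(leq_exp2l _ _ (prime_gt1 p_pr)) -(imq_card fq) // (imqT fq).
apply: leq_trans (h1 i ii); rewrite leq_pmulr //.
exact: (cardG_gt0 (imqG fq i sH)).
Qed.

(** From i to i + 1 the codimension of the kernel grows by the logarithm of a cyclic quotient of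
    S_i/S_(i+1), which satisfies the laws and has one generator. *)
Lemma char_kernel_defect q : exists i1, forall i, (i1 <= i)%N ->
  (q * ((lgS f setT i.+1 - lgS f H i.+1) - (lgS f setT i - lgS f H i))
     <= lgS f setT i.+1 - lgS f setT i)%N.
Proof.
have sT : subgroup [set: G] by [].
have [i1 h1] := char_kernel_thin (q * C); exists (maxn i0 i1) => i ii.
have [nK cK] := char_kernel_quotient p_pr Gp xsP (S_opn i.+1) (fq i.+1)
  (erefl (imqG fq i.+1 sH : {set _})).
set K := imqG fq i.+1 sH in nK cK.
pose B := imqG fq i.+1 (S_opn i).2.1.
have BK : B \subset 'N(K)%g by apply: fintype.subset_trans (normal_norm nK); exact: finset.subsetT.
have pB : p.-group B by have [_ _ pQ _] := fq i.+1; apply: pgroupS pQ; exact: finset.subsetT.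
have cBK : cyclic (B / K)%G by apply: cyclicS cK; apply: quotientS; exact: finset.subsetT.
have [x ex] := cyclicP cBK.
have [t1 gen1] : exists t1 : 'I_1 -> coset_of K, gen_by (B / K)%G t1.
  by apply: (@gen_by_set _ _ [set x]%SET); rewrite ?cards1 // ex.
have lawB : satisfies (W i) B by exact: (@satisfies_imq S W Q f S_opn S_verbal fq i).
have qC : (q * 1 * C <= #|[set: Q i]%SET|)%N.
  rewrite muln1; apply: leq_trans (h1 i (leq_trans (leq_maxr _ _) ii)).
  by rewrite leq_pmulr //; exact: (cardG_gt0 (imqG fq i sH)).
have := dominates_log S_opn S_dec fq hdom (leq_trans (leq_maxl _ _) ii)
  (quotient_pgroup K pB) (satisfies_quotient BK lawB) gen1 qC.
apply: leq_trans; rewrite leq_mul2l; apply/orP; right.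
have eH : (lgS f H i.+1 = logn p #|B :&: K| + lgS f H i)%N.
  by rewrite finset.setIC; exact: lgS_step.
have eT : (lgS f setT i.+1 = logn p #|B| + lgS f setT i)%N := lgT_step S_opn S_dec fq i.
have eB : (logn p #|B| = logn p #|B :&: K| + logn p #|(B / K)%g|)%N.
  by rewrite card_quotient // -lognM ?LagrangeI // ?cardG_gt0 // indexg_gt0.
have := lgS_le fq i sH sT (@subsetT _ _).
change (logn p #|(B / K)%G|) with (logn p #|(B / K)%g|).
move: eB eT eH; generalize (logn p #|(B / K)%g|) (logn p #|B|) (logn p #|B :&: K|).
by generalize (lgS f H i.+1) (lgS f H i) (lgS f setT i.+1) (lgS f setT i); lia.
Qed.

(** The part [B] of the generated subgroup inside the image of S_i satisfies the laws. By Schreier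
    its number of generators is at most [size A] times the order of the image at level i, which
    inside the kernel is negligible against |G : S_i|; this leaves room for [q] copies. *)
Lemma char_kernel_fg_slow (A : seq G) q : (forall x, x \in A -> H x) ->
  exists i1, forall i, (i1 <= i)%N ->
  (q * (lgG f A i.+1 - lgG f A i) <= lgS f setT i.+1 - lgS f setT i)%N.
Proof.
move=> AH; have [i1 h1] := char_kernel_thin (q * size A * C); exists (maxn i0 i1) => i ii.
pose X k := [set:: map (f k) A]%SET.
have XH k : <<X k>>%g \subset imqG fq k sH.
  rewrite gen_subG; apply/fintype.subsetP => y; rewrite inE => /mapP[x /AH Hx ->].
  exact: mem_imq.
pose B := (<<X i.+1>> :&: imqG fq i.+1 (S_opn i).2.1)%G.
have pB : p.-group B by have [_ _ pQ _] := fq i.+1; apply: pgroupS pQ; exact: finset.subsetT.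
have [phi hphi kerE] := fquot_factor (fq i) (fq i.+1) (@S_dec i).
have imX : (phi @* <<X i.+1>>)%g = <<X i>>%g.
  rewrite morphim_gen ?finset.subsetT //; congr <<_>>%g.
  apply/setP => y; apply/morphimP/idP => [[z _]|].
    by rewrite !inE => /mapP[x Ax ->] ->; rewrite hphi map_f.
  rewrite inE => /mapP[x Ax ->]; exists (f i.+1 x); rewrite ?finset.in_setT ?hphi //.
  by rewrite inE map_f.
have BE : B = <<X i.+1>>%g :&: 'ker phi :> {set _} by rewrite /= kerE.
have idx : #|<<X i.+1>>%g : B| = #|<<X i>>%g|.
  by rewrite BE indexgI -imX card_morphim finset.setTI.
have [Y eY cY] := schreier (finset.subsetIl _ _ : B \subset <<X i.+1>>%g).
have cX : (#|X i.+1| <= size A)%N by rewrite cardsE -(size_map (f i.+1)); exact: card_size.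
have [u hu] := gen_by_set eY (leqnn _).
have lawB : satisfies (W i) B.
  by apply: satisfiesS (@satisfies_imq S W Q f S_opn S_verbal fq i); exact: finset.subsetIr.
have qC : (q * #|Y| * C <= #|[set: Q i]%SET|)%N.
  apply: leq_trans (h1 i (leq_trans (leq_maxr _ _) ii)).
  have : (#|Y| <= size A * #|imq (f i) H|)%N.
    apply: leq_trans cY _; rewrite idx; apply: leq_mul => //; apply: subset_leq_card; exact: XH.
  move=> hY; rewrite -[leqRHS]mulnAC leq_mul2r -mulnA leq_mul2l hY !orbT //.
have := dominates_log S_opn S_dec fq hdom (leq_trans (leq_maxl _ _) ii) pB lawB hu qC.
apply: leq_trans; rewrite leq_mul2l; apply/orP; right.
have : (logn p #|<<X i.+1>>%g| = logn p #|B| + logn p #|<<X i>>%g|)%N.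
  rewrite -idx -lognM ?cardG_gt0 ?indexg_gt0 //; congr logn.
  by rewrite Lagrange //; exact: finset.subsetIl.
by rewrite /lgG -/(X i.+1) -/(X i); lia.
Qed.

End TypeOne.
End Factor.

(** * The greedy construction *)

Lemma pgroup_chain (p : nat) (gT : finGroupType) (A P : {group gT}) c : prime p ->
  p.-group P -> A \subset P -> (logn p #|A| <= c <= logn p #|P|)%N ->
  exists M : {group gT}, [/\ A \subset M, M \subset P & logn p #|M| = c].
Proof.
move=> p_pr; have [n] := ubnP #|P|; elim: n P => // n IH P ltP pP AP /andP[Ac cP].
have [e|ne] := eqVneq c (logn p #|P|); first by exists P.
case: (maximal_exists AP) => [eA|[M maxM AM]].
  by case/eqP: ne; apply/eqP; rewrite eqn_leq cP /=; move: Ac; rewrite eA.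
have idx := p_maximal_index pP maxM.
have sMP := proper_sub (maxgroupp maxM).
have eP : (logn p #|P| = (logn p #|M|).+1)%N.
  have lp : logn p p = 1%N by have := pfactorK 1 p_pr; rewrite expn1.
  by rewrite -(Lagrange sMP) idx lognM ?cardG_gt0 ?prime_gt0 // lp addn1.
have [||M' [h1 h2 h3]] := IH M _ (pgroupS sMP pP) AM.
- by apply: leq_trans (proper_card (maxgroupp maxM)) _; rewrite -ltnS.
- by rewrite Ac /=; move: cP ne; rewrite eP leq_eqVlt => /orP[/eqP->|//]; rewrite eqxx.
by exists M'; split=> //; exact: fintype.subset_trans h2 sMP.
Qed.

Section Greedy.
Variables (p : nat) (p_pr : prime p) (G : topGroupType).
Variables (S : nat -> set G) (Q : nat -> finGroupType) (f : forall i, G -> Q i).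
Hypothesis S_opn : forall i, opn (S i).
Hypothesis S_dec : forall i, S i.+1 `<=` S i.
Hypothesis S0 : S 0%N = setT.
Hypothesis fq : forall i, fquot p (S i) (f i).
Variable H : set G.
Hypothesis sH : subgroup H.
Local Notation lT := (lgS p f setT).
Local Notation lH := (lgS p f H).
Local Notation gG A i := (<<[set:: map (f i) A]%SET>>%G).

Let fM i : {morph f i : x y / (x * y)%g}. Proof. by case: (fq i). Qed.
Let sT : subgroup [set: G]. Proof. by []. Qed.

Lemma fquot_preimage_open i (B : {group Q i}) : open_subgroup [set g | f i g \in B].
Proof.
have sB : subgroup [set g | f i g \in B].
  split=> [|x y /= hx hy|x /= hx]; first by rewrite /= (morph1g (fM i)) group1.
    by rewrite fM groupM.
  by rewrite (morphVg (fM i)) groupV.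
split=> //; apply: open_subgroup_nbhs => //.
have [oS [[S1 _ _] _]] := S_opn i.
have nS : nbhs (1%g : G) (S i) by exact: open_nbhs_nbhs.
apply: (@filterS _ _ (nbhs_filter (1%g : G)) _ _ _ nS) => g Sg /=.
by have [_ _ _ fN] := fq i; have /fN -> := Sg; exact: group1.
Qed.

Lemma topgen_closed_subgroup (A : set G) : closed_subgroup (topgen A).
Proof.
split; last by apply: closed_bigI => B [[]].
split=> [B [[[]]]|x y hx hy B hB|x hx B hB] //.
  by have [[[_ BM _] _] _] := hB; apply: BM; [exact: hx | exact: hy].
by have [[[_ _ BV] _] _] := hB; apply: BV; exact: hx.
Qed.

Lemma mem_gG i (A : seq G) x : x \in A -> f i x \in gG A i.
Proof. by move=> Ax; apply: mem_gen; rewrite inE map_f. Qed.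

Lemma gG_sub i (A : seq G) (B : {group Q i}) :
  (forall x, x \in A -> f i x \in B) -> gG A i \subset B.
Proof. by move=> h; rewrite gen_subG; apply/fintype.subsetP => y; rewrite inE => /mapP[x /h ? ->]. Qed.

(** [M0] is all that elements of [H] in S_i can add, and a [p]-group has intermediate subgroups of
    every order, so some [M] has the desired size. By the modular law [M] is generated by the old
    elements and by M meet N, and the latter lifts to elements of [H] in S_i. *)
Lemma greedy_step i (A : seq G) b : (forall x, x \in A -> H x) ->
  exists D : seq G, (forall x, x \in D -> H x /\ S i x) /\
    ((D = [::] /\ (b <= lgG p f A i.+1)%N) \/
     ((lgG p f (A ++ D) i.+1 <= b)%N /\
      (minn b (lgG p f A i + (lH i.+1 - lH i)) <= lgG p f (A ++ D) i.+1)%N)).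
Proof.
move=> AH; have [hb|hb] := leqP b (lgG p f A i.+1); first by exists [::]; split=> //; left.
have sS : subgroup (S i) by case: (S_opn i) => _ [].
pose Hq := imqG fq i.+1 sH; pose Sq := imqG fq i.+1 sS.
pose N := (Hq :&: Sq)%G; pose GA := gG A i.+1.
have GAH : GA \subset Hq by apply: gG_sub => x /AH; exact: mem_imq.
have nS : [set: Q i.+1]%SET \subset 'N(Sq)%g.
  apply/normsP => q _; apply/eqP; rewrite eqEcard cardJg leqnn andbT.
  have [_ fS _ _] := fq i.+1; have [g <-] := fS q.
  apply/fintype.subsetP => _ /imsetP[_ /imqP[u Su <-] ->]; apply/imqP; exists (u ^ g)%g.
    by case: (S_opn i) => _ [_]; exact.
  by rewrite !conjgE !fM (morphVg (fM _)).
have nN : GA \subset 'N(N)%g.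
  apply: normsI; first by apply: fintype.subset_trans GAH _; exact: normG.
  by apply: fintype.subset_trans nS; exact: finset.subsetT.
have [phi hphi kerE] := fquot_factor (fq i) (fq i.+1) (@S_dec i).
pose M0 := (GA <*> N)%G.
have eM0 : M0 = (GA * N)%g :> {set _} by exact: norm_joinEl.
have GAM : GA \subset M0 by exact: joing_subl.
have pM0 : p.-group M0.
  by have [_ _ pQ _] := fq i.+1; apply: pgroupS pQ; exact: finset.subsetT.
have lgM0 : (lgG p f A i + (lH i.+1 - lH i) <= logn p #|M0|)%N.
  have eH : (lH i.+1 = logn p #|N| + lH i)%N := lgS_step S_opn S_dec fq i sH.
  have -> : #|M0| = (#|M0 :&: 'ker phi| * #|(phi @* M0)%g|)%N.
    by rewrite card_morphim finset.setTI LagrangeI.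
  rewrite lognM ?cardG_gt0 // eH addnK addnC; apply: leq_add.
    apply: dvdn_leq_log; rewrite ?cardG_gt0 //; apply: cardSg.
    change (N \subset M0 :&: 'ker phi)%g; rewrite -kerE finset.subsetI joing_subr /=.
    exact: finset.subsetIr.
  apply: dvdn_leq_log; rewrite ?cardG_gt0 //; apply: cardSg.
  apply: gG_sub => x Ax; rewrite -hphi; apply: mem_morphim; rewrite ?finset.in_setT //.
  by apply: (fintype.subsetP GAM); exact: mem_gG.
have [|M [GM MM eM]] := pgroup_chain (c := minn b (logn p #|M0|)) p_pr pM0 GAM.
  rewrite geq_minr andbT leq_min; apply/andP; split; first exact: ltnW.
  by apply: dvdn_leq_log; rewrite ?cardG_gt0 //; exact: cardSg.
(* An element of [H] whose image lies in that of S_i is itself in S_i, because S_i contains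
   S_(i+1). *)
have /choice[sec hsec] : forall n : Q i.+1, exists g, n \in N -> [/\ H g, S i g & f i.+1 g = n].
  move=> n; have [|nn] := boolP (n \in N); last by exists 1%g.
  rewrite inE => /andP[/imqP[h Hh <-] /imqP[u Su e]]; exists h => _; split=> //.
  have [S1 SM SV] := sS; rewrite -(mulKVg u h); apply: SM => //; apply: S_dec.
  by have [_ _ _ fN] := fq i.+1; apply/fN; rewrite fM (morphVg (fM _)) e mulVg.
pose D := [seq sec n | n <- enum (M :&: N)].
have DP x : x \in D -> [/\ H x, S i x & f i.+1 x \in M].
  move=> /mapP[n]; rewrite mem_enum inE => /andP[nM nN' ->].
  by have [h1 h2 ->] := hsec n nN'.
exists D; split; first by move=> x /DP[].
right; have eGM : <<[set:: map (f i.+1) (A ++ D)]%SET>>%g = M :> {set _}.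
  apply/eqP; rewrite finset.eqEsubset; apply/andP; split.
    apply: gG_sub => x; rewrite mem_cat => /orP[Ax|/DP[] //].
    by apply: (fintype.subsetP GM); exact: mem_gG.
  apply/fintype.subsetP => m Mm; have := fintype.subsetP MM m Mm; rewrite eM0.
  move=> /mulsgP[g n Gg Nn em].
  have Mn : n \in M.
    by rewrite -(groupMl _ (fintype.subsetP GM _ Gg)) -em.
  rewrite em groupM //.
    apply: (fintype.subsetP (_ : GA \subset gG (A ++ D) i.+1)) Gg.
    by apply: gG_sub => x Ax; apply: mem_gG; rewrite mem_cat Ax.
  have [_ _ <-] := hsec n Nn; apply: mem_gG; rewrite mem_cat map_f ?orbT //.
  by rewrite mem_enum inE Mn.
rewrite /lgG eGM eM geq_minl; split=> //; rewrite leq_min geq_minl /=.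
exact: leq_trans (geq_minr _ _) lgM0.
Qed.

Hypothesis H_fg : forall A : seq G, (forall x, x \in A -> H x) -> forall q,
  exists i1, forall i, (i1 <= i)%N -> (q * lgG p f A i <= lT i)%N.

(** [b i] is the target and [a i] the size reached, which falls behind by at most the codimension of
    [H]. Elements are adjoined only without overshooting; so if [a] exceeded [b] from some point on,
    nothing more would be adjoined, and the finitely generated result would be negligible by [H_fg],
    against the last hypothesis on [b]. *)
Lemma greedy (b : nat -> nat) q : b 0%N = 0%N ->
  (forall i, b i.+1 <= b i + (lT i.+1 - lT i))%N ->
  (forall m, exists2 i, (m <= i)%N & (lT i < q * b i)%N) ->
  exists (K : set G) (a : nat -> nat),
    [/\ closed_subgroup K, forall i, #|imq (f i) K| = (p ^ a i)%N,
        forall i, (b i <= a i + (lT i - lH i))%N &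
        forall m, exists2 i, (m <= i)%N & (a i <= b i)%N].
Proof.
move=> b0 bS hb.
have /choice[st hst] : forall z : nat * seq G, exists D, (forall x, x \in z.2 -> H x) ->
  (forall x, x \in D -> H x /\ S z.1 x) /\
    ((D = [::] /\ (b z.1.+1 <= lgG p f z.2 z.1.+1)%N) \/
     ((lgG p f (z.2 ++ D) z.1.+1 <= b z.1.+1)%N /\
      (minn (b z.1.+1) (lgG p f z.2 z.1 + (lH z.1.+1 - lH z.1)) <= lgG p f (z.2 ++ D) z.1.+1)%N)).
  move=> [i A] /=; have [h|h] := pselect (forall x, x \in A -> H x); last by exists [::].
  by have [D hD] := greedy_step i (b i.+1) h; exists D.
pose As := fix As i := if i is j.+1 then As j ++ st (j, As j) else [::].
have AH i x : x \in As i -> H x.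
  elim: i x => [//|i IH] x /=; rewrite mem_cat => /orP[/IH //|Dx].
  by have [h _] := hst (i, As i) IH; case: (h x Dx).
have DS i x : x \in st (i, As i) -> S i x.
  by move=> Dx; have [h _] := hst (i, As i) (AH i); case: (h x Dx).
have Asub i k x : (i <= k)%N -> x \in As i -> x \in As k.
  by move=> /subnK <-; elim: (k - i)%N => [//|n IH] /IH h; rewrite addSn /= mem_cat h.
have Sle i k : (i <= k)%N -> S k `<=` S i.
  move=> /subnK <-; elim: (k - i)%N => [//|n IH]; rewrite addSn.
  by move=> x /S_dec /IH.
(* What is adjoined at step i or later lies in S_i, so the image at level i is settled by the
   earlier steps. *)
have stab i k x : x \in As k -> f i x \in gG (As i) i.
  elim: k => [//|k IH] /=; rewrite mem_cat => /orP[/IH //|Dx].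
  have [ki|ik] := ltnP k i; last first.
    have [_ _ _ fN] := fq i; have /fN -> := Sle _ _ ik _ (DS _ _ Dx); exact: group1.
  by apply: mem_gG; apply: (Asub k.+1) => //=; rewrite mem_cat Dx orbT.
pose a i := lgG p f (As i) i.
pose U := [set x | exists i, x \in As i].
exists (topgen U), a; split.
- exact: topgen_closed_subgroup.
- move=> i; have -> : imq (f i) (topgen U) = gG (As i) i; last exact: pgroup_card.
  have sU := (topgen_closed_subgroup U).1.
  apply/eqP; rewrite finset.eqEsubset; apply/andP; split; last first.
    apply: (gG_sub (B := imqG fq i sU)) => x Ax; apply: mem_imq.
    by apply: sub_gen_smallest; exists i.
  apply/fintype.subsetP => _ /imqP[x Ux <-].
  have [oB sB] := fquot_preimage_open (gG (As i) i).
  have : topgen U `<=` [set g | f i g \in gG (As i) i]; last exact.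
  apply: smallest_sub; first by split=> //; exact: open_subgroup_closed.
  by move=> y [k Ak] /=; exact: stab Ak.
- elim=> [|i IH]; first by rewrite b0.
  have H1 := lgS_le p_pr fq i sH sT (@subsetT _ _).
  have H2 := lgS_le p_pr fq i.+1 sH sT (@subsetT _ _).
  have H3 : (lH i <= lH i.+1)%N by rewrite (lgS_step S_opn S_dec fq i sH) leq_addl.
  have H4 : (lT i <= lT i.+1)%N by rewrite (lgS_step S_opn S_dec fq i sT) leq_addl.
  have [_ [[D0 hb']|[_ hmin]]] := hst (i, As i) (AH i).
    by move: hb' D0; rewrite /a /= => hb' ->; rewrite cats0; apply: leq_trans hb' _; exact: leq_addr.
  move: hmin IH (bS i); rewrite /a /= -/(a i).
  move: H1 H2 H3 H4; generalize (lT i.+1) (lT i) (lH i.+1) (lH i) (a i) (b i) (b i.+1).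
  by generalize (lgG p f (As i ++ st (i, As i)) i.+1); clear; lia.
move=> m; apply: contrapT => h.
have {}h i : (m < i)%N -> (b i < a i)%N.
  by move=> mi; rewrite ltnNge; apply/negP => ab; apply: h; exists i => //; exact: ltnW.
have step i : (m <= i)%N -> As i.+1 = As i.
  move=> mi; have [_ [[/= -> _]|[/= hle _]]] := hst (i, As i) (AH i); first by rewrite cats0.
  by have := h i.+1 mi; rewrite /a /= ltnNge hle.
have cst i : (m <= i)%N -> As i = As m.
  by move=> /subnK <-; elim: (i - m)%N => [//|n IH]; rewrite addSn step ?leq_addl.
have [i1 h1] := H_fg (AH m) q.
have [i ii hi] := hb (maxn m.+1 i1).
have mi : (m < i)%N by apply: leq_trans (leq_maxl _ _) ii.
have := h1 i (leq_trans (leq_maxr _ _) ii); rewrite leqNgt => /negP; apply.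
apply: leq_trans hi _; rewrite leq_mul2l -(cst i (ltnW mi)); apply/orP; right.
by apply: ltnW; exact: h.
Qed.

End Greedy.

(** * Lower limits and the spectrum *)

Section LimInf.
Variable R : realType.
Local Open Scope ring_scope.
Implicit Types u : nat -> R.

Lemma limn_inf_itv u : (forall i, 0 <= u i <= 1) -> 0 <= limn_inf u <= 1.
Proof.
move=> u01.
have hl : has_lbound (range u) by exists 0 => _ [i _ <-]; case/andP: (u01 i).
have hu : has_ubound (range u) by exists 1 => _ [i _ <-]; case/andP: (u01 i).
have cv : cvgn (infs u) by apply/cvg_ex; exists (sup (range (infs u))); exact: cvg_infs_sup.
apply/andP; split.
  apply: limr_ge => //; apply: nearW => n; apply: lb_le_inf.
    by exists (u n); exists n => /=.
  by move=> _ [k _ <-]; case/andP: (u01 k).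
apply: limr_le => //; apply: nearW => n.
apply: (@le_trans _ _ (u n)); last by case/andP: (u01 n).
by apply: ge_inf; [exact: has_lbound_sdrop | exists n => /=].
Qed.

Lemma limn_inf_eq u (l : R) : (forall i, 0 <= u i <= 1) ->
  (forall e, 0 < e -> exists m, forall i, (m <= i)%N -> l - e <= u i) ->
  (forall e, 0 < e -> forall m, exists2 i, (m <= i)%N & u i <= l + e) ->
  limn_inf u = l.
Proof.
move=> u01 h1 h2; apply/cvg_lim => //; apply/cvgrPdist_le => e e0.
have hl : has_lbound (range u) by exists 0 => _ [i _ <-]; case/andP: (u01 i).
have [m hm] := h1 e e0; exists m => // n /= mn; rewrite ler_norml; apply/andP; split.
  have [k nk uk] := h2 e e0 n; rewrite lerBrDl -lerBrDr opprK.
  apply: le_trans uk; apply: ge_inf; [exact: has_lbound_sdrop | by exists k].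
rewrite lerBlDr addrC -lerBlDr; apply: lb_le_inf; first by exists (u n); exists n => /=.
by move=> _ [k nk <-]; apply: hm; apply: leq_trans nk.
Qed.

Lemma logb_expn (p a : nat) : (1 < p)%N -> logb R p (p ^ a) = a%:R.
Proof.
move=> p1; rewrite /logb natrX lnXn ?ltr0n; last exact: ltnW.
by rewrite -[_ *+ a]mulr_natl mulfK // gt_eqF // ln_gt0 // ltr1n.
Qed.

End LimInf.

Section Spectrum.
Variables (R : realType) (p : nat) (p_pr : prime p) (G : topGroupType).
Variables (S : nat -> set G) (Q : nat -> finGroupType) (f : forall i, G -> Q i).
Hypothesis S_opn : forall i, opn (S i).
Hypothesis S_dec : forall i, S i.+1 `<=` S i.
Hypothesis S0 : S 0%N = setT.
Hypothesis S_cap : \bigcap_i S i = [set 1%g].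
Hypothesis fq : forall i, fquot p (S i) (f i).
Local Notation lT := (lgS p f setT).
Let sT : subgroup [set: G]. Proof. by []. Qed.

Lemma hdimE (K : set G) : subgroup K ->
  hdim R p S K = limn_inf (fun i => ((lgS p f K i)%:R / (lT i)%:R)%R : R).
Proof.
move=> sK; congr limn_inf; apply: funext => i; have [fM _ _ fN] := fq i.
rewrite (index_imq_aux fM fN sK) (imq_card fq i sK) (logb_expn _ _ (prime_gt1 p_pr)).
have {1}-> : [set: G] = setprod setT (S i).
  apply/seteqP; split=> // x _; exists x => //; exists 1%g; last by rewrite mulg1.
  by case: (S_opn i) => _ [[]].
by rewrite (index_imq_aux fM fN sT) (imq_card fq i sT) (logb_expn _ _ (prime_gt1 p_pr)).
Qed.

Local Open Scope ring_scope.

Lemma natr_ratio_itv (a l : nat) : (a <= l)%N -> 0 <= (a%:R / l%:R : R) <= 1.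
Proof.
move=> al; rewrite divr_ge0 ?ler0n //=.
have [->|l0] := posnP l; first by rewrite invr0 mulr0 ler01.
by rewrite ler_pdivrMr ?ltr0n // mul1r ler_nat.
Qed.

Lemma hdim_itv (K : set G) : subgroup K -> 0 <= hdim R p S K <= 1.
Proof.
move=> sK; rewrite hdimE //; apply: limn_inf_itv => i; apply: natr_ratio_itv.
exact: (lgS_le p_pr fq i sK sT (@subsetT _ _)).
Qed.

Lemma closed_subgroup1 : closed_subgroup [set 1%g : G].
Proof.
split; last first.
  rewrite -S_cap; apply: closed_bigI => i _.
  by have [oi [si _]] := S_opn i; exact: open_subgroup_closed.
by split=> [|x y -> ->|x ->] //=; rewrite ?mulg1 ?invg1.
Qed.

Lemma hdim1 : hdim R p S [set 1%g] = 0.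
Proof.
rewrite hdimE; last exact: (closed_subgroup1.1).
have -> : (fun i => (lgS p f [set 1%g] i)%:R / (lT i)%:R) = (fun=> 0 : R).
  apply: funext => i; rewrite /lgS; have -> : imq (f i) [set 1%g] = [set 1%g]%SET.
    apply/setP => q; rewrite finset.in_set1; have [fM _ _ _] := fq i.
    apply/imqP/eqP => [[g -> <-]|->]; first exact: morph1g.
    by exists 1%g => //; exact: morph1g.
  by rewrite cards1 logn1 mul0r.
by apply: (limn_inf_eq (R := R)) => [i|e e0|e e0 m]; rewrite ?lexx ?ler01 //;
  [exists 0%N => i _; lra | exists m => //; lra].
Qed.

Variable H : set G.
Hypothesis sH : subgroup H.
Local Notation lH := (lgS p f H).
Hypothesis l_inf : forall M, exists i1, forall i, (i1 <= i)%N -> (M <= lT i)%N.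
Hypothesis H_defect : forall q, exists i1, forall i, (i1 <= i)%N -> (q * (lT i - lH i) <= lT i)%N.
Hypothesis H_fg : forall A : seq G, (forall x, x \in A -> H x) -> forall q,
  exists i1, forall i, (i1 <= i)%N -> (q * lgG p f A i <= lT i)%N.

(** The target is the integer part of alpha l_i; rounding and the codimension of [H] disappear in
    the quotient by l_i. Positivity of [alpha] makes the target exceed a fixed fraction of l_i. *)
Lemma hdim_attained (alpha : R) : 0 < alpha <= 1 ->
  exists2 K, closed_subgroup K & hdim R p S K = alpha.
Proof.
move=> /andP[a0 a1].
pose b i := Num.truncn (alpha * (lT i)%:R).
have bP i : (b i)%:R <= alpha * (lT i)%:R < (b i).+1%:R.
  by apply: truncn_itv; rewrite mulr_ge0 ?ler0n // ltW.
(* As q alpha > 2, one gets q b_i > 2 l_i - q, which is at least l_i once l_i >= q. *)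
pose q := (Num.truncn (2 / alpha)).+1.
have qP : 2 < q%:R * alpha.
  have : 2 / alpha < q%:R by apply: truncnS_gt.
  by rewrite ltr_pdivrMr.
have l0 : lT 0%N = 0%N.
  rewrite /lgS; have -> : imq (f 0%N) setT = [set 1%g]%SET; last by rewrite cards1 logn1.
  apply/setP => y; rewrite finset.in_set1; have [fM _ _ fN] := fq 0%N.
  apply/imqP/eqP => [[g _ <-]|->]; first by apply/fN; rewrite S0.
  by exists 1%g => //; exact: morph1g.
have lmono i : (lT i <= lT i.+1)%N by rewrite (lgS_step S_opn S_dec fq i sT) leq_addl.
have [|||K [a [cK aK a_lo a_hi]]] := greedy p_pr S_opn S_dec fq sH H_fg (b := b) (q := q).
- apply/eqP; rewrite -leqn0 -(ler_nat R); have /andP[h _] := bP 0%N.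
  by apply: le_trans h _; rewrite l0 mulr0.
- move=> i; rewrite -ltnS -(ltr_nat R); have /andP[h1 _] := bP i.+1; have /andP[_ h2] := bP i.
  apply: le_lt_trans h1 _; rewrite -addSn natrD natrB //.
  have : alpha * ((lT i.+1)%:R - (lT i)%:R) <= (lT i.+1)%:R - (lT i)%:R.
    by rewrite ler_piMl // subr_ge0 ler_nat.
  by move: h2; rewrite mulrBr; lra.
- move=> m; have [i1 h1] := l_inf q; exists (maxn m i1); first exact: leq_maxl.
  have hl := h1 _ (leq_maxr m i1); set i := maxn m i1 in hl *.
  rewrite -(ltr_nat R) natrM; have /andP[_ h2] := bP i.
  have hq : q%:R <= (lT i)%:R :> R by rewrite ler_nat.
  have q0 : 0 < q%:R :> R by rewrite ltr0n.
  move: h2; rewrite -natr1 => h2.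
  have : q%:R * (alpha * (lT i)%:R) < q%:R * ((b i)%:R + 1) by rewrite ltr_pM2l.
  have : 2 * (lT i)%:R <= q%:R * alpha * (lT i)%:R by rewrite ler_wpM2r ?ler0n // ltW.
  by move: hq; rewrite mulrDr mulr1 mulrA; lra.
exists K => //; have sK := cK.1; rewrite hdimE //.
have aE i : lgS p f K i = a i by rewrite /lgS aK pfactorK.
have al i : (a i <= lT i)%N by rewrite -aE; exact: (lgS_le p_pr fq i sK sT (@subsetT _ _)).
apply: limn_inf_eq => [i|e e0|e e0 m]; first by rewrite aE; exact: natr_ratio_itv.
  (* With k e > 2, the rounding error 1 and the codimension of [H] each use at most half of e
     l_i. *)
  pose k := (Num.truncn (2 / e)).+1.
  have kP : 2 < k%:R * e by have : 2 / e < k%:R by [apply: truncnS_gt]; rewrite ltr_pdivrMr.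
  have [i1 h1] := l_inf k; have [i2 h2] := H_defect k.
  exists (maxn i1 i2) => i ii; rewrite aE.
  have {}h1 := h1 i (leq_trans (leq_maxl _ _) ii).
  have {}h2 := h2 i (leq_trans (leq_maxr _ _) ii).
  have lp : 0 < (lT i)%:R :> R by rewrite ltr0n; apply: leq_trans h1.
  rewrite ler_pdivlMr //; have /andP[_ hb] := bP i; have hlo := a_lo i.
  move: h1 h2 hlo hb; rewrite -(ler_nat R) -(ler_nat R (k * _)%N) natrM.
  rewrite -(ler_nat R (b i)) natrD -natr1; set el := (lT i - lH i)%:R => h1 h2 hlo hb.
  have k0 : 0 < k%:R :> R by rewrite ltr0n.
  have : 1 + el <= e * (lT i)%:R.
    rewrite -(ler_pM2l k0) mulrDr mulr1.
    have : 2 * (lT i)%:R <= k%:R * e * (lT i)%:R by rewrite ler_wpM2r ?ler0n // ltW.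
    by rewrite mulrA; lra.
  by rewrite mulrBl; lra.
have [i mi hi] := a_hi m; exists i => //; rewrite aE.
have [l00|lp] := posnP (lT i); first by rewrite l00 invr0 mulr0; lra.
rewrite ler_pdivrMr ?ltr0n //; have /andP[hb _] := bP i.
have : (a i)%:R <= (b i)%:R :> R by rewrite ler_nat.
have : 0 <= e * (lT i)%:R by rewrite mulr_ge0 ?ler0n // ltW.
by rewrite mulrDl; lra.
Qed.

Lemma full_spectrum : hspec R p S = `[0, 1]%classic.
Proof.
apply/seteqP; split=> [_ [K [sK _] <-]|a]; rewrite /= in_itv /=; first exact: hdim_itv.
move=> /andP[]; rewrite le_eqVlt => /orP[/eqP <- _|a0 a1].
  by exists [set 1%g]; [exact: closed_subgroup1 | exact: hdim1].
by have [|K cK eK] := @hdim_attained a; rewrite ?a0 //; exists K.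
Qed.

End Spectrum.

(** * Direct products *)

Lemma dependent_function_choice (I : Type) (T : I -> Type) (P : forall i, T i -> Prop) :
  (forall i, exists x, P i x) -> exists g : forall i, T i, forall i, P i (g i).
Proof. by move=> h; exists (fun i => sval (cid (h i))) => i; exact: svalP (cid (h i)). Qed.

(** A Stolz-Cesaro argument. The factor 2 reserves half of the bound for the increments after [i1]
    and half for the initial value at [i1]. *)
Lemma slow_negl (a l : nat -> nat) : (forall i, l i <= l i.+1)%N ->
  (forall M, exists i1, forall i, (i1 <= i)%N -> (M <= l i)%N) ->
  (forall q, exists i1, forall i, (i1 <= i)%N -> (q * (a i.+1 - a i) <= l i.+1 - l i)%N) ->
  forall q, exists i1, forall i, (i1 <= i)%N -> (q * a i <= l i)%N.
Proof.
move=> mono linf slow q; have [i1 h1] := slow (2 * q)%N.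
have [i2 h2] := linf (2 * q * a i1)%N; exists (maxn i1 i2) => i ii.
have : (2 * q * a i <= l i + 2 * q * a i1)%N.
  have := leq_trans (leq_maxl _ _) ii => /subnK <-.
  elim: (i - i1)%N => [|n IH]; first by rewrite add0n leq_addl.
  have := h1 (n + i1)%N (leq_addl _ _); have := mono (n + i1)%N.
  have : (2 * q * a (n + i1).+1 <= 2 * q * a (n + i1) + 2 * q * (a (n + i1).+1 - a (n + i1)))%N.
    by rewrite -mulnDr leq_mul2l; apply/orP; right; lia.
  by move: IH; rewrite addSn; lia.
have := h2 i (leq_trans (leq_maxr _ _) ii); lia.
Qed.

Lemma eventually_forall_ord r (P : 'I_r -> nat -> Prop) :
  (forall j, exists i1, forall i, (i1 <= i)%N -> P j i) ->
  exists i1, forall i, (i1 <= i)%N -> forall j, P j i.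
Proof.
move=> /choice[i1 h]; exists (\max_j i1 j) => i ii j; apply: h.
exact: leq_trans (leq_bigmax j) ii.
Qed.

Lemma word_value_morph (G H : topGroupType) (phi : G -> H) (h : nat -> G) w :
  {morph phi : x y / (x * y)%g} -> phi (word_value h w) = word_value (phi \o h) w.
Proof.
move=> phiM; rewrite /word_value (big_morph phi phiM (morph1g phiM)).
by apply: eq_bigr => -[k b] _ /=; case: b => //; exact: morphVg.
Qed.

(** * Metacyclic factors *)

Section FactorLaws.
Variables (p : nat) (p_pr : prime p) (G : topGroupType).
Variables (S : nat -> set G) (Q : nat -> finGroupType) (f : forall i, G -> Q i).
Hypothesis S_opn : forall i, opn (S i).
Hypothesis S_dec : forall i, S i.+1 `<=` S i.
Hypothesis S_cap : \bigcap_i S i = [set 1%g].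
Hypothesis fq : forall i, fquot p (S i) (f i).
Hypothesis meta : forall i, metacyclic [set: Q i]%G.

(** The second derived subgroup is trivial in every quotient by a term of the filtration; preimages
    from these finite quotients are closed, so they absorb topological generation. *)
Lemma metacyclic_soluble : soluble G.
Proof.
exists 2; apply/seteqP; split; last first.
  by move=> _ -> B [[[B1 _ _] _] _].
move=> x Dx; rewrite -S_cap => i _; have [fM fS _ fN] := fq i.
have /metacyclicP[K [cK nK cQK]] := meta i.
have subcl (B : {group Q i}) : closed_subgroup [set g | f i g \in B].
  have [oB sB] := fquot_preimage_open S_opn fq B.
  by split=> //; exact: open_subgroup_closed.
have fR g h : f i [~ g, h]%g = [~ f i g, f i h]%g.
  by rewrite !commgEl !conjgE !fM !(morphVg fM).
have D1 : @derived G 1 `<=` [set g | f i g \in K].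
  apply: smallest_sub; first exact: subcl.
  move=> _ [g _ [h _ <-]] /=; rewrite fR.
  apply: (fintype.subsetP (der1_min (normal_norm nK) (cyclic_abelian cQK))).
  by rewrite derg1 mem_commg ?finset.in_setT.
have : @derived G 2 `<=` [set g | f i g \in (1%G : {group Q i})].
  apply: smallest_sub; first exact: subcl.
  move=> _ [g Dg [h Dh <-]] /=; rewrite fR; apply/set1gP; apply/eqP;
  apply/commgP; apply: (centsP (cyclic_abelian cK)) (D1 g Dg) _ (D1 h Dh).
by move=> /(_ x Dx) /= /set1gP /fN.
Qed.

(* [G] has rank two, so it grows much more slowly than a factor into whose lower
   terms arbitrary finite groups satisfying the laws [W i] embed. *)
Lemma metacyclic_slow (W : nat -> set word) (G' : topGroupType) (S' : nat -> set G')
    (Q' : nat -> finGroupType) (f' : forall i, G' -> Q' i) C i0 q :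
  (forall i, weakly_verbal (W i) (S i) (S i.+1)) ->
  (forall i, opn (S' i)) -> (forall i, S' i.+1 `<=` S' i) ->
  (forall i, fquot p (S' i) (f' i)) -> dominates p S' W f' C i0 ->
  (forall M, exists i1, forall i, (i1 <= i)%N -> (M <= lgS p f' setT i)%N) ->
  exists i1, forall i, (i1 <= i)%N ->
    (q * (lgS p f setT i.+1 - lgS p f setT i) <= lgS p f' setT i.+1 - lgS p f' setT i)%N.
Proof.
move=> verb S'_opn S'_dec fq' hdom linf; have [i1 h1] := linf (q * 2 * C)%N.
exists (maxn i0 i1) => i ii.
have sS : subgroup (S i) by case: (S_opn i) => _ [].
pose T := imqG fq i.+1 sS.
have pT : p.-group T by have [_ _ pQ _] := fq i.+1; apply: pgroupS pQ; exact: finset.subsetT.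
have [t gt] := metacyclic_gen_by (metacyclicS (finset.subsetT T) (meta i.+1)).
have lawT : satisfies (W i) T by exact: (@satisfies_imq p G S W Q f S_opn verb fq i).
rewrite (lgT_step S_opn S_dec fq i) addnK.
apply: (dominates_log p_pr S'_opn S'_dec fq' hdom (leq_trans (leq_maxl _ _) ii) pT lawT gt).
apply: leq_trans (h1 i (leq_trans (leq_maxr _ _) ii)) _.
by rewrite -(imqT fq') (imq_card fq') //; apply: ltnW; apply: ltn_expl; exact: prime_gt1.
Qed.

End FactorLaws.

(** * Decomposition of the filtration into its components *)

Section Product.
Variables (p : nat) (p_pr : prime p) (r : nat) (E : 'I_r -> topGroupType).
Local Notation P := (prod_topology (fun j : 'I_r => E j)).

Definition pinj (j : 'I_r) (x : E j) : P := eqtype.dfwith (fun i => 1%g : E i) x.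

Lemma pinj_continuous j : continuous (@pinj j).
Proof. exact: (@dfwith_continuous _ (fun j => E j)). Qed.

Lemma pproj_continuous j : continuous (fun x : P => x j).
Proof. exact: (@proj_continuous _ (fun j => E j)). Qed.

Lemma pinjM j : {morph @pinj j : x y / (x * y)%g}.
Proof.
move=> x y; apply: functional_extensionality_dep => k.
rewrite -[RHS]/(pinj x k * pinj y k)%g /pinj.
have [<-|jk] := eqVneq j k; first by rewrite !eqtype.dfwith_in.
by rewrite !eqtype.dfwith_out // mulg1.
Qed.

Lemma pproj_pinj j (x : E j) : pinj x j = x. Proof. exact: eqtype.dfwith_in. Qed.

Lemma subgroup_box (B : set P) (x : P) : subgroup B -> (forall j, B (pinj (x j))) -> B x.
Proof.
move=> [B1 BM _] hx.
pose y n : P := fun k => if (k < n)%N then x k else 1%g.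
have -> : x = y r by apply: functional_extensionality_dep => k; rewrite /y ltn_ord.
elim: {1 3}r (leqnn r) => [_|n IH nr].
  by have -> : y 0%N = 1%g by apply: functional_extensionality_dep.
have -> : y n.+1 = (y n * pinj (x (Ordinal nr)))%g; last by apply: BM => //; exact/IH/ltnW.
apply: functional_extensionality_dep => k.
rewrite -[RHS]/(y n k * pinj (x (Ordinal nr)) k)%g /pinj /y.
have [<-|jk] := eqVneq (Ordinal nr) k.
  by rewrite eqtype.dfwith_in /= ltnSn ltnn mul1g.
rewrite eqtype.dfwith_out // mulg1 ltnS leq_eqVlt.
by case: eqP => // e; case/eqP: jk; exact: val_inj.
Qed.

Lemma preimage_closed_subgroup (G H : topGroupType) (phi : G -> H) (B : set H) :
  continuous phi -> {morph phi : x y / (x * y)%g} -> closed_subgroup B ->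
  closed_subgroup (phi @^-1` B).
Proof.
move=> cphi phiM [[B1 BM BV] cB]; split; last by apply: preimage_closed.
split=> [|x y hx hy|x hx]; rewrite /preimage /= ?(morph1g phiM) // ?phiM ?(morphVg phiM).
  exact: BM.
exact: BV.
Qed.

Variable S : nat -> set P.
Hypothesis S_filt : iterated_verbal_filtration S.

Let S_opn i : opn (S i). Proof. by case: S_filt => -[_ h _] _ _; exact: h. Qed.
Let S_dec i : S i.+1 `<=` S i. Proof. by case: S_filt => -[h _ _] _ _; exact: h. Qed.
Let S_cap : \bigcap_i S i = [set 1%g]. Proof. by case: S_filt => -[]. Qed.
Let S0 : S 0%N = setT. Proof. by case: S_filt. Qed.
Let cS i : closed_subgroup (S i).
Proof. by have [oi [si _]] := S_opn i; split=> //; exact: open_subgroup_closed. Qed.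

(** Verbal subgroups are stable under continuous endomorphisms, in particular under projection to a
    factor followed by inclusion. Hence each term of the filtration is the product of its
    components. *)
Lemma filtration_pinj i j (x : P) : S i x -> S i (pinj (x j)).
Proof.
have [_ _ hv] := S_filt.
elim: i x => [x _|i IH x]; first by rewrite S0.
have [W eW] := hv i.
pose phi (x : P) : P := pinj (x j).
have phiM : {morph phi : x y / (x * y)%g} by move=> y z; exact: pinjM.
have cphi : continuous phi.
  by move=> y; exact: (cvg_comp _ _ (@pproj_continuous j y) (@pinj_continuous j (y j))).
suff : S i.+1 `<=` phi @^-1` (S i.+1) by exact.
rewrite {1}eW; apply: smallest_sub; first exact: preimage_closed_subgroup.
move=> _ [h hh [w Ww <-]]; rewrite /preimage /= word_value_morph // eW.
by apply: sub_gen_smallest; exists (phi \o h) => [k|]; [exact: IH | exists w].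
Qed.

Lemma filtration_prod i (x : P) : (forall j, S i (pinj (x j))) -> S i x.
Proof. by apply: subgroup_box; case: (cS i). Qed.

Definition comp_filtration j i : set (E j) := [set x | S i (pinj x)].
Arguments comp_filtration : clear implicits.
Local Notation SS := comp_filtration.

Lemma comp_opn j i : opn (SS j i).
Proof.
have [oi [[S1 SM SV] SJ]] := S_opn i; have pM := @pinjM j; split.
  by apply: open_comp => // x _; exact: pinj_continuous.
split; first split=> [|x y|x]; rewrite /SS /= ?(morph1g pM) ?pM ?(morphVg pM) //.
- exact: SM.
- exact: SV.
by move=> x g; rewrite /SS /= !conjgE !pM (morphVg pM) -conjgE; exact: SJ.
Qed.

Lemma comp_dec j i : SS j i.+1 `<=` SS j i.
Proof. by move=> x; exact: S_dec. Qed.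

Lemma comp_cap j : \bigcap_i SS j i = [set 1%g].
Proof.
apply/seteqP; split=> [x hx|_ ->]; last first.
  by move=> i _; case: (comp_opn j i) => _ [[]].
have : (\bigcap_i S i) (pinj x) by move=> i _; exact: hx.
rewrite S_cap => /= e; by rewrite -(pproj_pinj x) e.
Qed.

(** The words are those of the product and common to all factors; this is what allows one factor to
    be compared with another. *)
Lemma comp_verbal : exists W : nat -> set word,
  forall j i, weakly_verbal (W i) (SS j i) (SS j i.+1).
Proof.
have [_ _ /choice[W hW]] := S_filt; exists W => j i.
have vS w (h : nat -> P) : W i w -> (forall k, S i (h k)) -> S i.+1 (word_value h w).
  by move=> Ww hh; rewrite hW; apply: sub_gen_smallest; exists h => //; exists w.
split; first exact: comp_dec.
  move=> w h Ww hh; rewrite /SS /= -/(word_value h w) (word_value_morph h w (@pinjM j)).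
  exact: vS.
move=> A [oA sA] hA x; rewrite /SS /= => Sx.
suff : S i.+1 `<=` (fun y : P => y j) @^-1` A by move=> /(_ _ Sx); rewrite /preimage /= pproj_pinj.
rewrite hW; apply: smallest_sub.
  apply: preimage_closed_subgroup => //; first exact: pproj_continuous.
  by split=> //; exact: open_subgroup_closed.
move=> _ [h hh [w Ww <-]]; rewrite /preimage /= (@word_value_morph P (E j) (fun y => y j)) //.
by apply: hA => // k; exact: filtration_pinj.
Qed.

Section ProductQuotient.
Variables (Qs : forall (j : 'I_r) (i : nat), finGroupType) (fs : forall j i, E j -> Qs j i).
Hypothesis fsq : forall j i, fquot p (SS j i) (@fs j i).

Definition prod_quot i (x : P) : {dffun forall j : 'I_r, Qs j i} := [ffun j => fs i (x j)].

Lemma fquot_prod i : fquot p (S i) (@prod_quot i).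
Proof.
split.
- move=> x y; apply/ffunP => j; rewrite !ffunE.
  by have [fM _ _ _] := fsq j i; rewrite -fM.
- move=> q; have /dependent_function_choice[g hg] : forall j, exists g, fs i g = q j.
    by move=> j; have [_ fS _ _] := fsq j i; exact: fS.
  by exists g; apply/ffunP => j; rewrite ffunE.
- have -> : [set: {dffun forall j : 'I_r, Qs j i}]%G =
      setXn_group (fun j => [set: Qs j i]%G).
    by apply: val_inj; apply/setP => x; rewrite /= finset.in_setT; apply/esym/setXnP => j; rewrite finset.in_setT.
  rewrite /pgroup cardsXn; apply: (big_ind (fun n => p.-nat n)) => //= [u v pu pv|j _].
    by rewrite pnatM pu pv.
  by have [_ _ pQ _] := fsq j i.
move=> x; split=> [/ffunP e|Sx].
  apply: filtration_prod => j; have [_ _ _ fN] := fsq j i; apply/fN.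
  by have := e j; rewrite !ffunE.
apply/ffunP => j; rewrite !ffunE; have [_ _ _ fN] := fsq j i; apply/fN.
exact: filtration_pinj.
Qed.

Lemma lgS_prod (Hs : forall j, set (E j)) i : (forall j, subgroup (Hs j)) ->
  lgS p prod_quot [set x | forall j, Hs j (x j)] i = (\sum_j lgS p (@fs j) (Hs j) i)%N.
Proof.
move=> sHs; rewrite /lgS.
have -> : imq (@prod_quot i) [set x | forall j, Hs j (x j)] = setXn (fun j => imq (@fs j i) (Hs j)).
  apply/setP => q; apply/imqP/setXnP => [[x Hx <-] j|hq].
    by rewrite ffunE; apply: mem_imq.
  have /dependent_function_choice[g hg] : forall j, exists g, Hs j g /\ fs i g = q j.
    by move=> j; have /imqP[g Hg e] := hq j; exists g.
  exists g => [j|]; first by case: (hg j).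
  by apply/ffunP => j; rewrite ffunE; case: (hg j).
rewrite cardsXn (eq_bigr (fun j => p ^ lgS p (@fs j) (Hs j) i)%N); last first.
  by move=> j _; exact: (imq_card (fsq j) i (sHs j)).
by rewrite -expn_sum pfactorK.
Qed.

Lemma lgG_prod (A : seq P) i :
  (lgG p prod_quot A i <= \sum_j lgG p (@fs j) (map (fun x : P => x j) A) i)%N.
Proof.
pose B := setXn_group (fun j => <<[set:: map (@fs j i) (map (fun x : P => x j) A)]%SET>>%G).
have AB : <<[set:: map (@prod_quot i) A]%SET>>%g \subset B.
  rewrite gen_subG; apply/fintype.subsetP => y; rewrite inE => /mapP[x Ax ->].
  apply/setXnP => j; rewrite ffunE; apply: mem_gen.
  by rewrite inE -map_comp; apply/mapP; exists x.
apply: (@leq_trans (logn p #|B|)); first by apply: dvdn_leq_log; rewrite ?cardG_gt0 //; exact: cardSg.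
rewrite cardsXn.
rewrite (eq_bigr (fun j => p ^ lgG p (@fs j) (map (fun x : P => x j) A) i)%N).
  by rewrite -expn_sum pfactorK.
by move=> j _; exact: (pgroup_card (fsq j)).
Qed.

End ProductQuotient.

Hypothesis E_pro : forall j, pro_p p (E j).
Hypothesis E_pd : forall j, exists tr, @pd_trace p (E j) setT tr.
Hypothesis E_nonsoluble : exists j, ~ soluble (E j).

Lemma product_spectrum (R : realType) : hspec R p S = `[0%R, 1%R]%classic.
Proof.
have X j i : {Q : finGroupType & {f : E j -> Q | fquot p (SS j i) f}}.
  have [Q hQ] := cid (pro_p_quotient p_pr (@E_pro j) (comp_opn j i)).
  by exists Q; exact: cid hQ.
pose Qs j i := projT1 (X j i); pose fs j i : E j -> Qs j i := sval (projT2 (X j i)).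
have fsq j i : fquot p (SS j i) (fs j i) by exact: (svalP (projT2 (X j i))).
have [W hW] := comp_verbal.
pose metac j := forall i, metacyclic [set: Qs j i]%G.
pose type1 j (H : set (E j)) := exists xs t C i0, [/\ Zp_character p xs t,
  dominates p (SS j) W (fs j) C i0 & H = char_kernel p xs].
have dich j : metac j \/ exists H, type1 j H.
  have [tr htr] := E_pd j.
  have [h|[xs [t [U [xsP oU dU]]]]] := pd_dichotomy p_pr (@E_pro j) htr.
    by left=> i; apply: (h _ _ _ (comp_opn j i) (fsq j i)).
  right; exists (char_kernel p xs), xs, t.
  have [C [i0 hd]] := pd_dominates p_pr (@E_pro j) (comp_opn j) (@comp_dec j) (comp_cap j)
    (hW j) (fsq j) htr oU dU.
  by exists C, i0.
(* A nonsoluble factor is of the second kind; its growth will dominate that of the metacyclic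
   factors. *)
have [j0 [H0 [xs0 [t0 [C0 [i00 [xsP0 hd0 _]]]]]]] : exists j H, type1 j H.
  have [j nsol] := E_nonsoluble; exists j; case: (dich j) => // me.
  by case: nsol; apply: (metacyclic_soluble (comp_opn j) (comp_cap j) (fsq j) me).
have linf0 := lgT_unbounded p_pr (@E_pro j0) (comp_opn j0) (@comp_dec j0) (comp_cap j0) (fsq j0) xsP0.
have sT j : subgroup [set: E j] by [].
have /dependent_function_choice[Hs hHs] j : exists H : set (E j), type1 j H \/ (metac j /\ H = setT).
  by case: (dich j) => [me|[H h]]; [exists setT; right | exists H; left].
have sHs j : subgroup (Hs j).
  by case: (hHs j) => [[xs [t [C [i0 [xsP _ ->]]]]]|[_ ->]] //; exact: char_kernel_subgroup xsP.
pose f i := prod_quot fs i; have fq := fquot_prod fsq.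
pose lj j := lgS p (fs j) setT; pose hj j := lgS p (fs j) (Hs j).
have ljmono j i : (lj j i <= lj j i.+1)%N.
  by rewrite /lj (lgS_step (comp_opn j) (@comp_dec j) (fsq j) i (sT j)) leq_addl.
pose H := [set x : P | forall j, Hs j (x j)].
have eL i : lgS p f setT i = (\sum_j lj j i)%N.
  have -> : [set: P] = [set x | forall j, [set: E j] (x j)] by apply/seteqP; split.
  exact: lgS_prod.
have eH i : lgS p f H i = (\sum_j hj j i)%N by exact: lgS_prod.
have ljL j i : (lj j i <= lgS p f setT i)%N by rewrite eL (bigD1 j) //= leq_addr.
have def j q : exists i1, forall i, (i1 <= i)%N -> (q * (lj j i - hj j i) <= lgS p f setT i)%N.
  case: (hHs j) => [[xs [t [C [i0 [xsP hd eHs]]]]]|[_ eHs]]; last first.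
    by exists 0%N => i _; rewrite /hj eHs subnn muln0.
  have slow := char_kernel_defect p_pr (@E_pro j) (comp_opn j) (@comp_dec j) (comp_cap j) (hW j)
    (fsq j) xsP hd.
  have linf := lgT_unbounded p_pr (@E_pro j) (comp_opn j) (@comp_dec j) (comp_cap j) (fsq j) xsP.
  rewrite -eHs in slow.
  have [i1 h1] := @slow_negl (fun i => lj j i - hj j i)%N (lj j) (ljmono j) linf slow q.
  by exists i1 => i ii; apply: leq_trans (h1 i ii) (ljL j i).
have fg j (A : seq (E j)) q : (forall x, x \in A -> Hs j x) ->
    exists i1, forall i, (i1 <= i)%N -> (q * lgG p (fs j) A i <= lgS p f setT i)%N.
  case: (hHs j) => [[xs [t [C [i0 [xsP hd ->]]]]]|[me ->]] AH.
    have slow q' := char_kernel_fg_slow p_pr (@E_pro j) (comp_opn j) (@comp_dec j) (comp_cap j) (hW j)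
      (fsq j) xsP hd q' AH.
    have linf := lgT_unbounded p_pr (@E_pro j) (comp_opn j) (@comp_dec j) (comp_cap j) (fsq j) xsP.
    have [i1 h1] := @slow_negl _ (lj j) (ljmono j) linf slow q.
    by exists i1 => i ii; apply: leq_trans (h1 i ii) (ljL j i).
  (* A metacyclic factor is negligible as a whole when measured against the factor [j0]. *)
  have slow q' := metacyclic_slow p_pr (comp_opn j) (@comp_dec j) (fsq j) me q' (hW j)
    (comp_opn j0) (@comp_dec j0) (fsq j0) hd0 linf0.
  have [i1 h1] := @slow_negl _ (lj j0) (ljmono j0) linf0 slow q.
  exists i1 => i ii; apply: leq_trans (leq_trans (h1 i ii) (ljL j0 i)).
  rewrite leq_mul2l; apply/orP; right; apply: dvdn_leq_log; rewrite ?cardG_gt0 //.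
    exact: (cardG_gt0 (imqG (fsq j) i (sT j))).
  by rewrite (imqT (fsq j)); apply: cardSg; exact: finset.subsetT.
have r0 : (0 < r)%N by apply: leq_trans (ltn_ord j0).
have sum_le (x : 'I_r -> nat -> nat) : (forall j q, exists i1, forall i, (i1 <= i)%N ->
    (q * x j i <= lgS p f setT i)%N) ->
  forall q, exists i1, forall i, (i1 <= i)%N -> (q * \sum_j x j i <= lgS p f setT i)%N.
  (* Each of the [r] summands is estimated with the constant r q. *)
  move=> hx q; have [i1 h1] := eventually_forall_ord (fun j => hx j (r * q)%N).
  exists i1 => i ii; rewrite -(leq_pmul2l r0) mulnA big_distrr /=.
  apply: leq_trans (leq_sum _ (fun j _ => h1 i ii j)) _.
  by rewrite sum_nat_const card_ord.
apply: (@full_spectrum R p p_pr P S _ f S_opn S_dec S0 S_cap fq H).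
- split=> [j|x y hx hy j|x hx j]; first by case: (sHs j).
    by case: (sHs j) => _ + _; apply; [exact: hx | exact: hy].
  by case: (sHs j) => _ _; apply; exact: hx.
- move=> M; have [i1 h1] := linf0 M; exists i1 => i ii; exact: leq_trans (h1 i ii) (ljL j0 i).
- move=> q; have [i1 h1] := sum_le _ def q; exists i1 => i ii.
  apply: leq_trans (h1 i ii); rewrite eL eH leq_mul2l; apply/orP; right.
  rewrite leq_subLR -big_split /=; apply: leq_sum => j _.
  by rewrite -leq_subLR.
move=> A AH q.
have Aj j x : x \in map (fun x : P => x j) A -> Hs j x by move=> /mapP[y /AH Hy ->]; exact: Hy.
have [i1 h1] := sum_le (fun j i => lgG p (fs j) (map (fun x : P => x j) A) i)
  (fun j q' => fg j _ q' (Aj j)) q.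
exists i1 => i ii; apply: leq_trans (h1 i ii); rewrite leq_mul2l; apply/orP; right.
exact: lgG_prod.
Qed.

End Product.

(** * Demushkin groups *)

Section Cochains.
Variables (p : nat) (G : topGroupType).
Hypothesis cG : compact [set: G].
Local Notation Fp := 'F_p.

Lemma continuous_discrete (X : topologicalType) (A : zmodType) (F : X -> discrete_topology A) :
  (forall x, \forall y \near x, F y = F x) -> continuous F.
Proof.
move=> h x U nU; apply: filterS (h x) => y /= ->.
exact: nbhs_singleton nU.
Qed.

Lemma continuous_discrete_near (X : topologicalType) (A : zmodType) (F : X -> discrete_topology A) x :
  continuous F -> \forall y \near x, F y = F x.
Proof. by move=> cF; apply: (cF x [set F x]); exact: discrete_set1. Qed.

(** Tube lemma on G^n: a continuous cochain is invariant under an open subgroup [M] of G^n, and [M]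
    contains a box N^n. *)
Lemma cochain_smooth n (F : cochain G Fp n) : continuous F ->
  exists2 N, opn N & forall g m : 'I_n -> G, (forall i, N (m i)) ->
    F (fun i => g i * m i)%g = F g.
Proof.
move=> cF.
pose P : topGroupType := prod_topology (fun _ : 'I_n => G).
have cP : compact [set: P].
  have := @tychonoff 'I_n (fun=> G) (fun=> setT) (fun=> cG).
  by congr compact; apply/seteqP; split.
pose M : set P := [set m | forall g : P, F (g * m)%g = F g].
have sM : subgroup M.
  split=> [g|x y hx hy g|x hx g]; first by rewrite mulg1.
    by rewrite mulgA hy hx.
  by rewrite -[in RHS](mulgKV x g) hx.
have oM : open M.
  apply: open_subgroup_nbhs => //.
  apply: (@tube_nbhs P P (fun g m => F (g * m)%g = F g)) => // g.
  have c1 : (fun z : P * P => (z.1 * z.2)%g) @ (g, 1%g) --> (g * 1)%g := @mulg_continuous P (g, 1%g).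
  have nF : nbhs (g : P) [set y | F y = F g] := @continuous_discrete_near P 'F_p F g cF.
  have h1 : \forall z \near ((g, 1%g) : P * P), F (z.1 * z.2)%g = F g.
    by apply: (c1 [set y | F y = F g]); rewrite mulg1.
  have h2 : \forall z \near ((g, 1%g) : P * P), F z.1 = F g.
    by apply: (@cvg_fst _ _ (nbhs g) (nbhs (1%g : P)) _ [set y | F y = F g]).
  have FF : Filter (nbhs ((g, 1%g) : P * P)) := nbhs_filter _.
  exact: (@filterS2 _ _ FF _ _ (fun z : P * P => F (z.1 * z.2)%g = F z.1)
    (fun z e1 e2 => etrans e1 (esym e2)) h1 h2).
pose Nj (j : 'I_n) := [set x : G | M (@pinj n (fun=> G) j x)].
have oNj j : open_subgroup (Nj j).
  have pM := @pinjM n (fun=> G) j; have [M1 MM MV] := sM; split.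
    by apply: open_comp => // x _; exact: pinj_continuous.
  split=> [|x y|x]; rewrite /Nj /= ?(morph1g pM) ?pM ?(morphVg pM) //; [exact: MM | exact: MV].
have /choice[Nc hNc] : forall j, exists N, opn N /\ N `<=` Nj j.
  by move=> j; have [N oN NN] := opn_core cG (oNj j).1 (oNj j).2; exists N.
exists (\bigcap_j Nc j).
  split.
    apply: open_subgroup_nbhs.
      split=> [j _|x y hx hy j _|x hx j _]; case: (hNc j) => -[_ [[h1 h2 h3] _]] _ //.
        by apply: h2; [exact: hx | exact: hy].
      by apply: h3; exact: hx.
    have : \forall x \near (1%g : G), forall j, Nc j x.
      apply: filter_forall => j; case: (hNc j) => -[oN [[N1 _ _] _]] _.
      exact: open_nbhs_nbhs.
    by apply: filterS => x hx j _.
  split; last by move=> x g hx j _; case: (hNc j) => -[_ [_ h]] _; apply: h; exact: hx.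
  split=> [j _|x y hx hy j _|x hx j _]; case: (hNc j) => -[_ [[h1 h2 h3] _]] _ //.
    by apply: h2; [exact: hx | exact: hy].
  by apply: h3; exact: hx.
move=> g m hm; apply: (@subgroup_box n (fun=> G) M m sM _ g) => j.
by apply: (hNc j).2; exact: hm.
Qed.

Lemma cochain_continuous n (F : cochain G Fp n) N : opn N ->
  (forall g m : 'I_n -> G, (forall i, N (m i)) -> F (fun i => g i * m i)%g = F g) ->
  continuous F.
Proof.
move=> [oN [[N1 _ _] _]] h; apply: continuous_discrete => g.
have FF : Filter (nbhs g) := nbhs_filter g.
have hi i : \forall y \near g, N ((g i)^-1 * y i)%g.
  apply: (@proj_continuous _ (fun _ : 'I_n => G) i g [set z | N ((g i)^-1 * z)%g]).
  by apply: open_nbhs_nbhs; split; [exact: open_lmul | rewrite /= mulVg].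
apply: filterS (filter_forall _ hi) => y hy; rewrite -(h g _ hy); congr F.
by apply: funext => i; rewrite mulKVg.
Qed.

Definition cochain1 (x : G -> Fp) : cochain G Fp 1 := fun g => x (g ord0).
Definition cochain2 (f : G -> G -> Fp) : cochain G Fp 2 := fun g => f (g ord0) (g ord_max).
Definition pair_fun (g h : G) : 'I_2 -> G := fun i => if i == ord0 then g else h.

Lemma pair_funE (g : 'I_2 -> G) : pair_fun (g ord0) (g ord_max) = g.
Proof.
apply: funext => i; rewrite /pair_fun; case: eqP => [->//|ni]; congr g.
by apply: val_inj; case: i ni => -[|[|[]]] //= hi ni; case: ni; exact: val_inj.
Qed.

Lemma const_funE (g : 'I_1 -> G) : (fun=> g ord0) = g.
Proof. by apply: funext => i; rewrite (ord1 i). Qed.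

Lemma smooth_cochain1 (x : G -> Fp) : smooth setT x <-> continuous (cochain1 x).
Proof.
split=> [[N [oN _] h]|cx].
  by apply: (cochain_continuous oN) => g m hm; rewrite /cochain1 h.
have [N oN h] := cochain_smooth cx; exists N => // g n _ Nn.
by have := h (fun=> g) (fun=> n) (fun=> Nn).
Qed.

Lemma smooth_cochain2 (f : G -> G -> Fp) : smooth2 setT f <-> continuous (cochain2 f).
Proof.
split=> [[N [oN _] h]|cx].
  by apply: (cochain_continuous oN) => g m hm; rewrite /cochain2 h.
have [N oN h] := cochain_smooth cx; exists N => // g k m n _ _ Nm Nn.
have := h (pair_fun g k) (pair_fun m n); rewrite /cochain2 /pair_fun /=; apply.
by move=> i; case: ifP.
Qed.

Lemma coboundary_map1 (x : G -> Fp) (g : 'I_2 -> G) :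
  coboundary_map (@trivial_act p G) (cochain1 x) g =
    (x (g ord_max) + x (g ord0) - x (g ord0 * g ord_max)%g)%R.
Proof.
rewrite /coboundary_map big_ord1 /trivial_act /cochain1 /tuple_merge /= /tuple_tail /tuple_init /=.
have -> : lift ord0 (ord0 : 'I_1) = ord_max by exact: val_inj.
have -> : lift ord_max (ord0 : 'I_1) = ord0 by exact: val_inj.
by rewrite expr1 mulrNz mulr1z expr2 mulrNN mulr1 mulr1z addrAC.
Qed.

Lemma coboundary_map2 (f : G -> G -> Fp) (g : 'I_3 -> G) (a := g ord0)
    (b := g (lift ord0 ord0)) (c := g ord_max) :
  coboundary_map (@trivial_act p G) (cochain2 f) g =
    (f b c - f (a * b)%g c + f a (b * c)%g - f a b)%R.
Proof.
rewrite /coboundary_map !big_ord_recl big_ord0 addr0 /trivial_act /cochain2.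
rewrite /tuple_merge /= /tuple_tail /tuple_init /=.
have e1 : lift ord0 (ord_max : 'I_2) = ord_max by exact: val_inj.
have e2 : lift ord_max (ord0 : 'I_2) = ord0 by exact: val_inj.
have e3 : lift ord_max (ord_max : 'I_2) = lift ord0 ord0 by exact: val_inj.
have e4 : lift (ord0 : 'I_2) ord0 = ord_max by exact: val_inj.
rewrite ?e4 ?e1 ?e2 ?e3 /= -/a -/b -/c.
have s1 : ((-1) ^+ 1 = - (GRing.one int))%R by [].
have s2 : ((-1) ^+ (bump 0 0).+1 = GRing.one int)%R by [].
have s3 : ((-1) ^+ 3 = - (GRing.one int))%R by [].
by rewrite s1 s2 s3 !mulrNz !mulr1z !addrA.
Qed.

Lemma cochain2E (F : cochain G Fp 2) :
  F = cochain2 (fun g h => F (pair_fun g h) : Fp).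
Proof. by apply: funext => g; rewrite /cochain2 pair_funE. Qed.

Lemma cochain1E (F : cochain G Fp 1) : F = cochain1 (fun g => F (fun=> g) : Fp).
Proof. by apply: funext => g; rewrite /cochain1 const_funE. Qed.

Lemma cocycle2P (f : G -> G -> Fp) : cocycle (@trivial_act p G) (cochain2 f) <-> Z2 setT f.
Proof.
split=> [[cf df]|[sf df]]; split; try exact/smooth_cochain2.
  move=> a b c _ _ _.
  pose g (i : 'I_3) := if i == ord0 then a else if i == ord_max then c else b.
  by have := df g; rewrite coboundary_map2.
by move=> g; rewrite coboundary_map2; exact: df.
Qed.

Lemma cocycle1P (x : G -> Fp) : cocycle (@trivial_act p G) (cochain1 x) <-> hom1 setT x.
Proof.
split=> [[cf df]|[sf df]]; split; try exact/smooth_cochain1.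
  move=> g h _ _; have /eqP := df (pair_fun g h); rewrite coboundary_map1 /pair_fun /=.
  by rewrite subr_eq0 addrC => /eqP.
by move=> g; rewrite coboundary_map1 df // [(x (g ord_max) + _)%R]addrC subrr.
Qed.

Lemma coboundary2P (f : G -> G -> Fp) :
  coboundary (@trivial_act p G) (cochain2 f) <-> B2 setT f.
Proof.
split=> [[h ch eh]|[b sb eb]].
  exists (fun g => h (fun=> g) : Fp); first by apply/smooth_cochain1; rewrite -cochain1E.
  move=> g k _ _; have := eh (pair_fun g k); rewrite {1}/cochain2 /pair_fun /= => ->.
  by rewrite {1}(cochain1E h) coboundary_map1 /= [(_ + h _)%R]addrC.
exists (cochain1 b); first exact/smooth_cochain1.
by move=> g; rewrite coboundary_map1 /cochain2 eb // [(b _ + b (g ord_max))%R]addrC.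
Qed.

Lemma coboundary1_eq0 (F : cochain G Fp 1) : coboundary (@trivial_act p G) F ->
  forall g, F g = (0 : Fp)%R.
Proof.
move=> [h _ eh] g; rewrite eh /coboundary_map big_ord0 addr0 expr1 mulrNz mulr1z.
have -> : tuple_tail g = tuple_init g by apply: funext => -[].
by rewrite /trivial_act subrr.
Qed.

Lemma B2_lin a (f f' : G -> G -> Fp) : B2 setT f -> B2 setT f' ->
  B2 setT (fun g h => a * f g h + f' g h)%R.
Proof.
move=> [b sb eb] [b' sb' eb']; exists (fun g => a * b g + b' g)%R.
  exact: (smooth_op (fun u v => a * u + v)%R).
by move=> g h _ _; rewrite eb // eb' //; ring.
Qed.

(** H^2 is spanned by the class of [z0], and the trace of a cocycle is its coefficient on [z0].
    Nondegeneracy transfers because 1-coboundaries vanish for the trivial action. *)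
Lemma demushkin_pd_trace : demushkin p G ->
  exists tr : (G -> G -> Fp) -> Fp, pd_trace setT tr.
Proof.
move=> [_ _ _ [z [zc zi zs]] [nd _]].
pose z0 (g h : G) : Fp := z ord0 (pair_fun g h).
have z0E : z ord0 = cochain2 z0 by exact: cochain2E.
have z0Z : Z2 setT z0 by apply/cocycle2P; rewrite -z0E.
have lcE (c : 'I_1 -> Fp) : Fp_lincomb c z = cochain2 (fun g h => c ord0 * z0 g h)%R.
  by apply: funext => g; rewrite /Fp_lincomb big_ord1 z0E.
have z0_free (c : Fp) : B2 setT (fun g h => c * z0 g h)%R -> c = 0%R.
  by move=> /coboundary2P hb; apply: (zi (fun=> c) _ ord0); rewrite lcE.
have z0_span (f : G -> G -> Fp) : Z2 setT f -> exists c : Fp, B2 setT (fun g h => f g h - c * z0 g h)%R.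
  move=> /cocycle2P /zs[c hc]; exists (c ord0); apply/coboundary2P.
  by move: hc; rewrite /cohomologous lcE.
pose tr f := xget (0 : Fp)%R [set c | B2 setT (fun g h => f g h - c * z0 g h)%R].
have trP f : Z2 setT f -> B2 setT (fun g h => f g h - tr f * z0 g h)%R.
  by move=> /z0_span[c hc]; rewrite /tr; case: xgetP => [c' -> //|h]; case: (h c).
have trU f c : Z2 setT f -> B2 setT (fun g h => f g h - c * z0 g h)%R -> tr f = c.
  move=> Zf hc; apply/eqP; rewrite -subr_eq0; apply/eqP/z0_free.
  have := B2_lin (-1)%R (trP f Zf) hc; apply: B2_ext => g h _ _; ring.
have tr0 f : Z2 setT f -> (tr f = 0%R <-> B2 setT f).
  move=> Zf; split=> [e|Bf].
    by have := trP f Zf; rewrite e; apply: B2_ext => g h _ _; rewrite mul0r subr0.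
  by apply: trU => //; apply: B2_ext Bf => g h _ _; rewrite mul0r subr0.
exists tr; split=> //.
  move=> a f f' Zf Zf'; apply: trU; first exact: Z2_lin.
  have := B2_lin a (trP f Zf) (trP f' Zf'); apply: B2_ext => g h _ _; ring.
right=> x hx [u _ xu]; apply: contrapT => hno.
have /coboundary1_eq0 : coboundary (@trivial_act p G) (cochain1 x).
  apply: nd; first exact/cocycle1P.
  move=> b cb; pose y g : Fp := b (fun=> g).
  have bE : b = cochain1 y by exact: cochain1E.
  have hy : hom1 setT y by apply/cocycle1P; rewrite -bE.
  have Zxy : Z2 setT (cp x y) by exact: cp_Z2.
  have : B2 setT (cp x y).
    by apply/(tr0 _ Zxy); apply: contrapT => ne; apply: hno; exists y.
  move=> /coboundary2P; rewrite bE; congr (@coboundary _ _ _ 2 _).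
  apply: funext => g; rewrite /cochain2 /cup /cochain1 /cp; congr (x (g _) * y (g _))%R; exact: val_inj.
by move=> /(_ (fun=> u)); rewrite /cochain1 => e; move: xu; rewrite e eqxx.
Qed.

End Cochains.

(** * Free groups *)

(** Finite groups have to be topological groups in order to be targets of the universal property. *)
Definition discrete_group (T : finGroupType) : Type := discrete_topology T.

Section DiscreteGroup.
Variable T : finGroupType.
Local Notation D := (discrete_group T).

HB.instance Definition _ := Topological.copy D (discrete_topology T).
HB.instance Definition _ := Group.copy D T.

Lemma discrete_group_open (A : set D) : open A.
Proof. exact: (@discrete_open (discrete_topology T)). Qed.

Lemma discrete_group_nbhs (x : D) : nbhs x [set x].
Proof. by apply: open_nbhs_nbhs; split => //; exact: discrete_group_open. Qed.

Let mul_continuous : continuous (fun x : D * D => (x.1 * x.2)%g).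
Proof.
move=> [x y] U nU; exists ([set x], [set y]).
  by split; exact: discrete_group_nbhs.
by move=> [a b] [/= -> ->]; exact: nbhs_singleton nU.
Qed.

Let inv_continuous : continuous (fun x : D => x^-1%g).
Proof.
by apply/continuousP => A _; exact: discrete_group_open.
Qed.

HB.instance Definition _ :=
  PreTopologicalGroup_isTopologicalGroup.Build D mul_continuous inv_continuous.

Lemma discrete_group_pro_p p : prime p -> p.-group [set: T]%G -> pro_p p D.
Proof.
move=> p_pr pT.
have finT (A : set D) : finite_set A by exact: (@finite_finset T A).
split; first exact: finite_compact.
- exact: (@discrete_hausdorff (discrete_topology T)).
- exact: zero_dimension_totally_disconnected (@discrete_zero_dimension (discrete_topology T)).
move=> N oN nN.
have finC : finite_set [set setprod [set x] N | x in [set: D]] by exact: finite_image.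
have [Q [f [fM fS fN]]] := normal_finite_quotient nN finC.
have sT : subgroup [set: D] by [].
have {1}-> : [set: D] = setprod setT N.
  apply/seteqP; split=> // x _; exists x => //; exists 1%g; last by rewrite mulg1.
  by case: nN => -[].
rewrite (index_imq_aux fM fN sT).
have fM' : {in [set: T]%SET &, {morph (f : T -> Q) : x y / (x * y)%g}} by move=> x y _ _; exact: fM.
have -> : imq f setT = (Morphism fM' @* [set: T]%G)%g.
  apply/setP => q; apply/imqP/morphimP => [[x _ <-]|[x _ _ ->]]; last by exists x.
  by exists x; rewrite ?finset.in_setT.
have : p.-group (Morphism fM' @* [set: T]%G)%g by exact: morphim_pgroup.
by move=> /card_pgroup ->; eexists.
Qed.

End DiscreteGroup.

Section CentralExtension.
Variables (p : nat) (Q : finGroupType) (c : Q -> Q -> 'F_p).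

(* The ignored argument makes the cocycle condition available to the group instance. *)
Definition central_extension
    (_ : forall x y z, (c y z - c (x * y)%g z + c x (y * z)%g - c x y = 0)%R) : Type :=
  ('F_p * Q)%type.

Hypothesis cP : forall x y z, (c y z - c (x * y)%g z + c x (y * z)%g - c x y = 0)%R.
Local Notation X := (central_extension cP).

HB.instance Definition _ := Finite.copy X ('F_p * Q)%type.

Let c1l y : c 1%g y = c 1%g 1%g.
Proof.
have := cP 1%g 1%g y; rewrite !mul1g => e; apply/eqP; rewrite -subr_eq0.
by apply/eqP; move: e; rewrite subrr add0r.
Qed.

Let mulX (u v : X) : X := ((u.1 + v.1 + c u.2 v.2)%R, (u.2 * v.2)%g).
(** The cocycle is not assumed to be normalised, hence the correction by c(1,1). *)
Let oneX : X := ((- c 1%g 1%g)%R, 1%g).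
Let invX (u : X) : X := ((- u.1 - c u.2^-1 u.2 - c 1%g 1%g)%R, u.2^-1%g).

Let mulXA : associative mulX.
Proof.
move=> u v w; rewrite /mulX /= mulgA; congr pair; apply/eqP; rewrite -subr_eq0.
apply/eqP; rewrite -[RHS](cP u.2 v.2 w.2); ring.
Qed.

Let mul1X : left_id oneX mulX.
Proof. by move=> [a x]; rewrite /mulX /= mul1g c1l; congr pair; ring. Qed.

Let mulVX : left_inverse oneX invX mulX.
Proof. by move=> [a x]; rewrite /mulX /= mulVg; congr pair; ring. Qed.

HB.instance Definition _ := Finite_isGroup.Build X mulXA mul1X mulVX.

Lemma central_extensionM (u v : X) :
  (u * v)%g = (((u : 'F_p * Q).1 + (v : 'F_p * Q).1 + c (u : 'F_p * Q).2 (v : 'F_p * Q).2)%R,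
               ((u : 'F_p * Q).2 * (v : 'F_p * Q).2)%g) :> ('F_p * Q).
Proof. by []. Qed.

Lemma central_extension_pgroup : prime p -> p.-group [set: Q]%G -> p.-group [set: X]%G.
Proof.
move=> p_pr; rewrite /pgroup !cardsT => pQ.
have -> : #|(X : finType)| = (p * #|(Q : finType)|)%N by rewrite card_prod card_Fp.
by rewrite pnatM pnat_id.
Qed.

End CentralExtension.

Section Free.
Variables (p : nat) (p_pr : prime p) (F : topGroupType).

(** The cocycle factors through a finite quotient [Q], where it defines an extension of [Q] by F_p
    that is again a finite [p]-group. By freeness [q] lifts to the extension, and the F_p-coordinate
    of the lift is, up to sign, a cochain with coboundary [f]. *)
Lemma free_cocycle_B2 (f : F -> F -> 'F_p) : free_pro_p p F -> Z2 setT f -> B2 setT f.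
Proof.
move=> [Fp [X [iota [iota1 univ]]]] [[N [oN _] hN] hf].
have cF : compact [set: F] by case: Fp.
have [Q [q fq]] := pro_p_quotient p_pr Fp oN; have [qM qS pQ qN] := fq.
have /choice[s hs] := qS.
pose c a b := f (s a) (s b).
have fE g h : f g h = c (q g) (q h).
  have key x : exists2 n, N n & x = (s (q x) * n)%g.
    exists ((s (q x))^-1 * x)%g; last by rewrite mulKVg.
    by apply/qN; rewrite qM (morphVg qM) hs mulVg.
  have [m Nm eg] := key g; have [n Nn eh] := key h.
  by rewrite {1}eg {1}eh hN.
have cP x y z : (c y z - c (x * y)%g z + c x (y * z)%g - c x y = 0)%R.
  have := hf (s x) (s y) (s z) I I I.
  by rewrite (fE (s y)) (fE _ (s z)) (fE (s x)) (fE (s x)) !qM !hs.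
pose Y := central_extension cP; pose DY : topGroupType := discrete_group Y.
pose DQ : topGroupType := discrete_group Q.
have proY : pro_p p DY by apply: discrete_group_pro_p => //; exact: central_extension_pgroup.
have proQ : pro_p p DQ by exact: discrete_group_pro_p.
pose pr (y : DY) : DQ := (y : 'F_p * Q).2.
have prM : {morph pr : x y / (x * y)%g} by [].
(* Where q(iota x) = 1 the lift must be 1, so that the lifted family still converges to 1. *)
pose j x : DY := if q (iota x) == 1%g then (1%g : DY) else ((0%R, q (iota x)) : 'F_p * Q).
have jE x : pr (j x) = q (iota x) by rewrite /j /pr; case: eqP => [->|].
have fin1 : finite_set (iota @^-1` (~` N)) by apply: iota1; case: oN => // _ [].
have j1 : converges_to_1 j.
  move=> U oU [U1 _ _]; apply: sub_finite_set fin1 => x; rewrite /preimage /=.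
  move=> nU /qN e; apply: nU.
  by have -> : j x = 1%g by rewrite /j; case: eqP.
have q1 : converges_to_1 (q \o iota : X -> DQ).
  move=> U oU [U1 _ _]; apply: sub_finite_set fin1 => x; rewrite /preimage /=.
  move=> nU /qN e; apply: nU.
  by have -> : (q (iota x) : DQ) = 1%g by exact: e.
have [Phi [[cPhi PhiM Phij] _]] := univ DY j proY j1.
have [psi [_ psiU]] := univ DQ (q \o iota) proQ q1.
have kPhi : opn [set g | Phi g = 1%g].
  split; first by apply: (@open_comp _ _ Phi [set 1%g]) => //; exact: discrete_group_open.
  split=> [|x g /= e]; last by rewrite conjgE !PhiM e mul1g (morphVg PhiM) mulVg.
  split=> [|x y /= ex ey|x /= ex]; first exact: morph1g.
    by rewrite PhiM ex ey mulg1.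
  by rewrite (morphVg PhiM) ex invg1.
have cq : continuous (q : F -> DQ).
  apply/continuousP => A _; rewrite openE => x Ax; rewrite /interior.
  have nx : nbhs x [set y | N (x^-1 * y)%g].
    case: oN => oN [[N1 _ _] _].
    by apply: open_nbhs_nbhs; split; [exact: open_lmul | rewrite /= mulVg].
  apply: (filterS _ nx) => y /qN; rewrite qM (morphVg qM) => /(congr1 (mulg (q x))).
  by rewrite mulKVg mulg1 /preimage /= => ->.
(* Both [q] and the projection of the lift extend the same family into [Q], so uniqueness identifies
   them. *)
have e1 : psi = q by apply: psiU; split.
have e2 : psi = pr \o Phi.
  apply: psiU; split.
  - apply/continuousP => A _; rewrite comp_preimage.
    by apply: (@open_comp _ _ Phi (pr @^-1` A)) => //; exact: discrete_group_open.
  - by move=> x y /=; rewrite PhiM prM.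
  - by apply: funext => x /=; have := congr1 (fun k => k x) Phij; rewrite /= => ->; exact: jE.
have prPhi g : pr (Phi g) = q g by have := congr1 (fun k => k g) e2; rewrite e1 => /esym.
exists (fun g => - (Phi g : 'F_p * Q).1)%R.
  exists [set g | Phi g = 1%g]; first by split.
  by move=> g n _ /= en; rewrite PhiM en mulg1.
move=> g h _ _; rewrite PhiM central_extensionM fE -!prPhi /pr /=; ring.
Qed.

Lemma free_pd_trace : free_pro_p p F -> exists tr : (F -> F -> 'F_p) -> 'F_p, pd_trace setT tr.
Proof.
move=> hF; exists (fun=> 0%R); split; last by left.
  by move=> a f f' _ _; rewrite mulr0 addr0.
by move=> f Zf; split=> // _; exact: free_cocycle_B2.
Qed.

End Free.

Theorem theorem1p4 (R : realType) (p : nat) (p_prime : prime p)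
  (r : nat) (E : 'I_r -> topGroupType)
  (E_factors : forall j : 'I_r,
     [/\ pro_p p (E j), finitely_generated (E j) &
         free_pro_p p (E j) \/ demushkin p (E j)])
  (E_nonsoluble : exists j : 'I_r, ~ soluble (E j))
  (S : nat -> set (prod_topology (fun j : 'I_r => E j)))
  (S_filtration : iterated_verbal_filtration S) :
  hspec R p S = `[0%R : R, 1%R : R]%classic.
Proof.
apply: product_spectrum => // j; first by have [] := E_factors j.
have [proE _ [hF|hD]] := E_factors j; first exact: free_pd_trace.
by apply: demushkin_pd_trace => //; case: proE.
Qed.
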